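(* Assume the Template Hypothesis stated in the context. Then there exists $k\in\mathbb{Z}_+$ such that a $k$-connected binary matroid $M$ with at least $2k$ elements has no minor isomorphic to any of $\mathrm{PG}(3,2)\backslash e$, $L_{19}$, $L_{11}$ if and only if $M$ is an even-cycle matroid.
   Context: Binary frame template: a tuple $\Phi=(C,X,Y_0,Y_1,A_1,\Delta,\Lambda)$ where $C,X,Y_0,Y_1$ are disjoint finite sets, $A_1$ is a binary matrix with rows indexed by $X$ and columns by $Y_0\cup Y_1\cup C$, $\Lambda$ is a subgroup of $\mathrm{GF}(2)^X$ and $\Delta$ a subgroup of $\mathrm{GF}(2)^{Y_0\cup Y_1\cup C}$; moreover (standard form) there are partitions $C=C_0\cup C_1$, $X=X_0\cup X_1$ with $A_1[X_0,C_0]$ an identity matrix and $A_1[X_1,C]$ a zero matrix. A binary frame matrix is a binary matrix each of whose columns has at most two nonzero entries. A binary matrix $A'$ with rows indexed by $B$ and columns by $E$ ($B,E$ disjoint finite sets) respects $\Phi$ if: $X\subseteq B$ and $C,Y_0,Y_1\subseteq E$; $A'[X,C\cup Y_0\cup Y_1]=A_1$; there is $Z\subseteq E-(C\cup Y_0\cup Y_1)$ with $A'[X,Z]=0$, each column of $A'[B-X,Z]$ a unit vector, and $A'[B-X,E-(C\cup Y_0\cup Y_1\cup Z)]$ a binary frame matrix; each column of $A'[X,E-(C\cup Y_0\cup Y_1\cup Z)]$ lies in $\Lambda$; each row of $A'[B-X,C\cup Y_0\cup Y_1]$ lies in $\Delta$. A matrix $A\in\mathrm{GF}(2)^{B\times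 E}$ conforms to $\Phi$ if for such $A'$ and $Z$ we have $A[B,E-Z]=A'[B,E-Z]$ and for each $i\in Z$ there is $j\in Y_1$ such that column $i$ of $A$ equals the sum of columns $i$ and $j$ of $A'$. A matroid $M$ conforms to $\Phi$ if $M\cong M(A)/C\backslash Y_1$ for some $A$ conforming to $\Phi$ ($M(A)$ is the vector matroid of $A$); $\mathcal{M}(\Phi)$ is the set of such matroids, and $\mathcal{M}^*(\Phi)$ the set of matroids whose duals conform to $\Phi$. Template Hypothesis: for every proper minor-closed class $\mathcal{M}$ of binary matroids there exist $k\in\mathbb{Z}_+$ and binary frame templates $\Phi_1,\dots,\Phi_s,\Psi_1,\dots,\Psi_t$ such that $\mathcal{M}$ contains each $\mathcal{M}(\Phi_i)$ and each $\mathcal{M}^*(\Psi_j)$, and every $k$-connected member of $\mathcal{M}$ with at least $2k$ elements either lies in some $\mathcal{M}(\Phi_i)$ or has its dual in some $\mathcal{M}(\Psi_j)$. Even-cycle matroid: a binary matroid $M\binom{w}{D}$ where $D$ is the vertex-edge incidence matrix over $\mathrm{GF}(2)$ of a graph $G=(V,E)$ and $w\in\mathrm{GF}(2)^E$ is the characteristic vector of some $W\subseteq E$. $\mathrm{PG}(3,2)\backslash e$ is $\mathrm{PG}(3,2)$ with one element deleted. $L_{19}$ is the dual of the cycle matroid of the graph obtained from $K_7$ by deleting two adjacent edges. $L_{11}$ is the vector matroid over $\mathrm{GF}(2)$ of the matrix with rows $10000010101$, $01000010011$, $00100001110$, $00010001101$, $00001001011$, $00000100111$. *)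

(* Defs.v *)
From HB Require Import structures.
From mathcomp Require Import all_boot all_order all_algebra.
From mathcomp Require Import zify.

Set Implicit Arguments.
Unset Strict Implicit.
Unset Printing Implicit Defensive.

Import GRing.Theory.

(* Matroids on a finite type, given by their rank functions. *)
Record matroid (E : finType) := Matroid {
  rk : {set E} -> nat;
  rk_card : forall S, rk S <= #|S|;
  rk_mono : forall S T : {set E}, S \subset T -> rk S <= rk T;
  rk_submod : forall S T, rk (S :|: T) + rk (S :&: T) <= rk S + rk T
}.

Section MatroidOps.
Variables (E : finType) (M : matroid E).

Definition dual_rk (S : {set E}) : nat := #|S| + rk M (~: S) - rk M setT.

Lemma dual_rk_ge (S : {set E}) : rk M setT <= #|S| + rk M (~: S).
Proof.
have := rk_submod M S (~: S); rewrite setUCr.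
have := rk_card M S; lia.
Qed.

Lemma dual_rk_card (S : {set E}) : dual_rk S <= #|S|.
Proof. by rewrite /dual_rk; have := rk_mono M (subsetT (~: S)); lia. Qed.

Lemma dual_rk_mono (S T : {set E}) : S \subset T -> dual_rk S <= dual_rk T.
Proof.
move=> sST; rewrite /dual_rk.
have := rk_submod M (~: T) (T :\: S).
have -> : ~: T :|: (T :\: S) = ~: S.
  apply/setP=> x; rewrite !inE; have /implyP := subsetP sST x.
  by case: (x \in S); case: (x \in T).
have := rk_card M (T :\: S); rewrite cardsD (setIidPr sST).
have := subset_leq_card sST; lia.
Qed.

Lemma dual_rk_submod (S T : {set E}) :
  dual_rk (S :|: T) + dual_rk (S :&: T) <= dual_rk S + dual_rk T.
Proof.
rewrite /dual_rk; have := rk_submod M (~: S) (~: T).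
rewrite -setCI -setCU.
have := dual_rk_ge S; have := dual_rk_ge T.
have := dual_rk_ge (S :|: T); have := dual_rk_ge (S :&: T).
have := cardsUI S T; lia.
Qed.

Definition dual : matroid E := Matroid dual_rk_card dual_rk_mono dual_rk_submod.

Section Minor.
Variables C D : {set E}.

Definition minor_ground : finType := {x : E | x \notin C :|: D}.

Definition minor_rk (S : {set minor_ground}) : nat :=
  rk M ((val @: S) :|: C) - rk M C.

Lemma minor_rk_card (S : {set minor_ground}) : minor_rk S <= #|S|.
Proof.
have cardS : #|val @: S| = #|S| by apply: card_imset; apply: val_inj.
have := rk_submod M (val @: S) C; have := rk_card M (val @: S).
rewrite /minor_rk; lia.
Qed.

Lemma minor_rk_mono (S T : {set minor_ground}) :
  S \subset T -> minor_rk S <= minor_rk T.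
Proof.
by move=> sST; rewrite leq_sub2r // rk_mono // setSU // imsetS.
Qed.

Lemma minor_rk_submod (S T : {set minor_ground}) :
  minor_rk (S :|: T) + minor_rk (S :&: T) <= minor_rk S + minor_rk T.
Proof.
have := rk_submod M (val @: S :|: C) (val @: T :|: C).
have <- : val @: (S :|: T) :|: C = (val @: S :|: C) :|: (val @: T :|: C).
  by rewrite imsetU setUUl.
have <- : val @: (S :&: T) :|: C = (val @: S :|: C) :&: (val @: T :|: C).
  by rewrite -setUIl imsetI // => x y _ _; apply: val_inj.
have le (R : {set minor_ground}) : rk M C <= rk M (val @: R :|: C).
  by rewrite rk_mono ?subsetUr.
have := le S; have := le T; have := le (S :|: T); have := le (S :&: T).
rewrite /minor_rk; lia.
Qed.

(* M / C \ D, for disjoint C and D *)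
Definition minor : matroid minor_ground :=
  Matroid minor_rk_card minor_rk_mono minor_rk_submod.

End Minor.

Definition connectivity (S : {set E}) : nat := rk M S + rk M (~: S) - rk M setT.

Definition separation (j : nat) (S : {set E}) : Prop :=
  [/\ j <= #|S|, j <= #|~: S| & connectivity S < j].

Definition kconnected (k : nat) : Prop :=
  forall (j : nat) (S : {set E}), 0 < j < k -> ~ separation j S.

End MatroidOps.

Definition matroid_iso (E F : finType) (M : matroid E) (N : matroid F) : Prop :=
  exists2 f : E -> F, bijective f & forall S : {set E}, rk N (f @: S) = rk M S.

Definition has_minor (E F : finType) (M : matroid E) (N : matroid F) : Prop :=
  exists C D : {set E}, [disjoint C & D] /\ matroid_iso N (minor M C D).

(* Matrices over GF(2) with arbitrary finite row and column index sets. *)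
Definition bmatrix (B E : finType) := B -> E -> 'F_2.

Section VectorMatroid.
Variables (B E : finType) (A : bmatrix B E).

Definition column (e : E) : {ffun B -> ('F_2)^o} := [ffun b => A b e].

Definition colspace (S : {set E}) : {vspace {ffun B -> ('F_2)^o}} :=
  <<[seq column e | e <- enum S]>>%VS.

Definition column_rk (S : {set E}) : nat := \dim (colspace S).

Lemma colspaceE (S : {set E}) : colspace S = (\sum_(e in S) <[column e]>)%VS.
Proof. by rewrite /colspace span_def big_map big_enum. Qed.

Lemma colspaceS (S T : {set E}) : S \subset T -> (colspace S <= colspace T)%VS.
Proof.
move=> /subsetP sST; rewrite !colspaceE; apply/subv_sumP => e eS.
exact: sumv_sup (sST e eS) _.
Qed.

Lemma column_rk_card (S : {set E}) : column_rk S <= #|S|.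
Proof. by rewrite /column_rk (leq_trans (dim_span _)) // size_map -cardE. Qed.

Lemma column_rk_mono (S T : {set E}) : S \subset T -> column_rk S <= column_rk T.
Proof. by move=> sST; apply/dimvS/colspaceS. Qed.

Lemma column_rk_submod (S T : {set E}) :
  column_rk (S :|: T) + column_rk (S :&: T) <= column_rk S + column_rk T.
Proof.
rewrite /column_rk -(dimv_sum_cap (colspace S)) leq_add // dimvS //.
  rewrite colspaceE; apply/subv_sumP => e; rewrite inE => /orP[] he.
    by apply: subv_trans (addvSl _ _); rewrite colspaceE (sumv_sup e).
  by apply: subv_trans (addvSr _ _); rewrite colspaceE (sumv_sup e).
by rewrite subv_cap !colspaceS ?subsetIl ?subsetIr.
Qed.

Definition vector_matroid : matroid E :=
  Matroid column_rk_card column_rk_mono column_rk_submod.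

End VectorMatroid.

Definition binary (E : finType) (M : matroid E) : Prop :=
  exists (B F : finType) (A : bmatrix B F), matroid_iso M (vector_matroid A).

(* A graph, possibly with loops and parallel edges, is a map giving the two     *)
(* ends of each edge; the order of the ends is never used.                      *)
Definition graph (V E : finType) := E -> V * V.

(* The column of a loop is zero, since 1 + 1 = 0. *)
Definition incidence (V E : finType) (G : graph V E) : bmatrix V E :=
  fun v e => ((v == (G e).1)%:R + (v == (G e).2)%:R)%R.

(* Lemma forestP below shows that its independent sets are the forests of G.    *)
Definition cycle_matroid (V E : finType) (G : graph V E) : matroid E :=
  vector_matroid (incidence G).

Definition even_cycle_matrix (V E : finType) (G : graph V E) (W : {set E}) :
    bmatrix (option V) E :=
  fun r e => if r is Some v then incidence G v e else ((e \in W)%:R)%R.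

Definition even_cycle (E : finType) (M : matroid E) : Prop :=
  exists (V F : finType) (G : graph V F) (W : {set F}),
    matroid_iso M (vector_matroid (even_cycle_matrix G W)).

Section CycleMatroid.
Variables (V E : finType) (G : graph V E).

Definition adj (S : {set E}) : rel V := fun u v =>
  [exists e in S, (G e == (u, v)) || (G e == (v, u))].

(* An edge set is a forest if it contains no cycle, that is, if no edge e of it *)
(* has its two ends joined by a path of the other edges.                        *)
Definition forest (S : {set E}) : bool :=
  [forall e in S, ~~ connect (adj (S :\ e)) (G e).1 (G e).2].

Local Open Scope ring_scope.

Lemma forestP (S : {set E}) :
  (rk (cycle_matroid G) S == #|S|) = forest S.
Proof.
have F2D (a : 'F_2) : a + a = 0.
  by rewrite -mulr2n -mulr_natr (_ : 2%:R = 0) ?mulr0 //; apply: val_inj.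
pose c := column (incidence G).
pose d (u v : V) : {ffun V -> ('F_2)^o} := [ffun b => (b == u)%:R + (b == v)%:R].
have cE e : c e = d (G e).1 (G e).2 by apply/ffunP=> b; rewrite !ffunE.
have dD u v w : d u w = d u v + d v w.
  apply/ffunP=> b; rewrite !ffunE addrA -(addrA (b == u)%:R).
  by rewrite F2D addr0.
have dC u v : d u v = d v u by apply/ffunP=> b; rewrite !ffunE addrC.
have adjC (T : {set E}) : symmetric (adj T).
  by move=> u v; apply: eq_existsb => e; rewrite orbC.
have conn (T : {set E}) u v :
    connect (adj T) u v = (d u v \in colspace (incidence G) T).
  apply/idP/idP.
    case/connectP=> p; elim: p u => [|w p IHp] u /=.
      move=> _ ->; rewrite (_ : d u u = 0) ?mem0v //.
      by apply/ffunP=> b; rewrite !ffunE F2D.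
    case/andP=> /existsP[e /andP[eT Ge]] wp vE; rewrite (dD u w) memvD ?IHp //.
    have -> : d u w = c e.
      by rewrite cE; case/orP: Ge => /eqP-> //=; rewrite dC.
    by rewrite memv_span // map_f // mem_enum.
  rewrite colspaceE => /memv_sumP[x xT dE].
  pose phi (y : {ffun V -> ('F_2)^o}) : 'F_2 := \sum_(b | connect (adj T) u b) y b.
  have phid a b : phi (d a b) = (connect (adj T) u a)%:R + (connect (adj T) u b)%:R.
    have one z : \sum_(b | connect (adj T) u b) ((b == z)%:R : 'F_2)
        = (connect (adj T) u z)%:R.
      case uz: (connect (adj T) u z).
        rewrite (bigD1 z) //= eqxx big1 ?addr0 // => i /andP[_ /negbTE-> //].
      rewrite big1 // => i ui; case: eqP => // iz; by rewrite iz uz in ui.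
    rewrite /phi -!one -big_split /=; apply: eq_bigr => z _; by rewrite ffunE.
  have phi0 : phi (d u v) = 0.
    rewrite dE /phi (eq_bigr (fun b => \sum_(e in T) x e b)) => [|b _]; last first.
      by rewrite sum_ffunE.
    rewrite exchange_big big1 //= => e eT.
    have /vlineP[a ->] := xT e eT.
    have : phi (c e) = 0.
      rewrite cE phid.
      have ae : adj T (G e).1 (G e).2.
        by apply/existsP; exists e; rewrite eT -surjective_pairing eqxx.
      rewrite (same_connect_r (sym_connect_sym (adjC T)) (connect1 ae)) //.
    move=> phice; transitivity (a * phi (c e)); last by rewrite phice mulr0.
    by rewrite mulr_sumr; apply: eq_bigr => b _; rewrite [LHS]ffunE.
  move: phi0; rewrite phid connect0.
  by case: connect => // /eqP.
have -> : forest S = [forall e in S, c e \notin colspace (incidence G) (S :\ e)].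
  by apply: eq_forallb => e; rewrite conn -cE.
have spanU (T : {set E}) e : e \in T ->
    colspace (incidence G) T = (<[c e]> + colspace (incidence G) (T :\ e))%VS.
  by move=> eT; rewrite !colspaceE (big_setD1 e).
apply/eqP/forall_inP => [rkS e eS | indS].
  apply/negP => ce; move: rkS; rewrite /= /column_rk (spanU S e eS).
  rewrite (addv_idPr _) ?memvE // => rkS.
  have := column_rk_card (incidence G) (S :\ e).
  by rewrite /column_rk rkS (cardsD1 e S) eS ltnn.
have sub n (T : {set E}) : #|T| = n -> T \subset S ->
    column_rk (incidence G) T = #|T|.
  elim: n T => [|n IHn] T cT TS.
    by apply/eqP; rewrite eqn_leq column_rk_card cT.
  have /card_gt0P[e eT] : (0 < #|T|)%N by rewrite cT.
  have eS := subsetP TS e eT.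
  have cT' : #|T :\ e| = n by move: cT; rewrite (cardsD1 e T) eT => -[].
  have T'S : T :\ e \subset S :\ e by rewrite setSD.
  have ne : c e \notin colspace (incidence G) (T :\ e).
    by apply: contra (indS e eS); apply/subvP/colspaceS.
  have := IHn _ cT' (subset_trans T'S (subsetDl _ _)).
  rewrite /column_rk (spanU T e eT) => rkT'.
  rewrite dimv_disjoint_sum; last first.
    apply/eqP; rewrite -subv0; apply/subvP=> x; rewrite memv_cap.
    move=> /andP[/vlineP[a ->]]; have [->|a0] := eqVneq a 0.
      by rewrite scale0r => _; exact: mem0v.
    by rewrite rpredZeq (negPf a0) (negPf ne).
  rewrite dim_vline rkT' (cardsD1 e T) eT.
  by case: eqP ne => // ->; rewrite mem0v.
exact: sub erefl (subxx S).
Qed.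

Local Close Scope ring_scope.

End CycleMatroid.

(* PG(n - 1, 2) *)
Definition PG_ground (n : nat) : finType := {v : 'rV['F_2]_n | v != 0%R}.

Definition PG (n : nat) : matroid (PG_ground n) :=
  vector_matroid (fun (i : 'I_n) (v : PG_ground n) => val v ord0 i).

Definition PG32_del (e : PG_ground 4) : matroid (minor_ground set0 [set e]) :=
  minor (PG 4) set0 [set e].

(* K_7 without the edges 01 and 02 *)
Definition L19_edge : finType :=
  {p : 'I_7 * 'I_7 | (p.1 < p.2) && ((val p.1, val p.2) \notin [:: (0, 1); (0, 2)])}.

Definition L19_graph : graph 'I_7 L19_edge := fun e => val e.

Definition L19 : matroid L19_edge := dual (cycle_matroid L19_graph).

Definition L11_rows : seq (seq nat) :=
  [:: [:: 1; 0; 0; 0; 0; 0; 1; 0; 1; 0; 1];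
      [:: 0; 1; 0; 0; 0; 0; 1; 0; 0; 1; 1];
      [:: 0; 0; 1; 0; 0; 0; 0; 1; 1; 1; 0];
      [:: 0; 0; 0; 1; 0; 0; 0; 1; 1; 0; 1];
      [:: 0; 0; 0; 0; 1; 0; 0; 1; 0; 1; 1];
      [:: 0; 0; 0; 0; 0; 1; 0; 0; 1; 1; 1]].

Definition L11 : matroid 'I_11 :=
  vector_matroid (fun (i : 'I_6) (j : 'I_11) =>
    ((nth 0 (nth [::] L11_rows i) j)%:R : 'F_2)%R).

Record template := Template {
  tC : finType;
  tX : finType;
  tY0 : finType;
  tY1 : finType;
  tA1 : bmatrix tX (tY0 + tY1 + tC)%type;
  tDelta : {set {ffun (tY0 + tY1 + tC)%type -> 'F_2}};
  tLambda : {set {ffun tX -> 'F_2}};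
  tDelta_group : zmod_closed tDelta;
  tLambda_group : zmod_closed tLambda;
  (* X0 and C0 with complements X1 and C1; "identity matrix" is relative to a   *)
  (* bijection f between its row and column labels.                             *)
  t_standard :
    exists (X0 : {set tX}) (C0 : {set tC})
           (f : {x | x \in X0} -> {c | c \in C0}),
      [/\ bijective f,
          forall x c, tA1 (val x) (inr (val c)) = ((f x == c)%:R)%R
        & forall x c, x \notin X0 -> tA1 x (inr c) = 0%R]
}.

Section Conform.
Variable Phi : template.

Definition tcols : finType := (tY0 Phi + tY1 Phi + tC Phi)%type.

(* Since conformity of matroids is up to isomorphism, we take B to be the       *)
(* disjoint union of X and P = B - X, and E to be the disjoint union of         *)
(* tcols = Y0 + Y1 + C and Q.                                                   *)
Definition respects (P Q : finType) (A' : bmatrix (tX Phi + P)%type (tcols + Q)%type)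
    (Z : {set Q}) : Prop :=
  [/\ forall x y, A' (inl x) (inl y) = tA1 x y,
      forall z, z \in Z ->
        (forall x, A' (inl x) (inr z) = 0%R) /\
        (exists p, forall p', A' (inr p') (inr z) = ((p' == p)%:R)%R),
      forall q, q \notin Z -> #|[set p | A' (inr p) (inr q) != 0%R]| <= 2,
      forall q, q \notin Z -> [ffun x => A' (inl x) (inr q)] \in tLambda Phi
    & forall p, [ffun y => A' (inr p) (inl y)] \in tDelta Phi].

Definition matrix_conforms (P Q : finType)
    (A : bmatrix (tX Phi + P)%type (tcols + Q)%type) : Prop :=
  exists (A' : bmatrix (tX Phi + P)%type (tcols + Q)%type) (Z : {set Q}),
    [/\ respects A' Z,
        forall b y, A b (inl y) = A' b (inl y),
        forall b q, q \notin Z -> A b (inr q) = A' b (inr q)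
      & forall i, i \in Z -> exists j : tY1 Phi, forall b,
          A b (inr i) = (A' b (inr i) + A' b (inl (inl (inr j))))%R].

Definition C_cols (Q : finType) : {set (tcols + Q)%type} :=
  [set inl (inr c) | c in [set: tC Phi]].

Definition Y1_cols (Q : finType) : {set (tcols + Q)%type} :=
  [set inl (inl (inr j)) | j in [set: tY1 Phi]].

Definition conforms (E : finType) (M : matroid E) : Prop :=
  exists (P Q : finType) (A : bmatrix (tX Phi + P)%type (tcols + Q)%type),
    matrix_conforms A /\
    matroid_iso M (minor (vector_matroid A) (C_cols Q) (Y1_cols Q)).

End Conform.

Definition matroid_class := forall E : finType, matroid E -> Prop.

(* As has_minor M N is up to isomorphism, this includes closure under isomorphism. *)
Definition minor_closed (K : matroid_class) : Prop :=
  forall (E F : finType) (M : matroid E) (N : matroid F),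
    K E M -> has_minor M N -> K F N.

Definition proper_binary_class (K : matroid_class) : Prop :=
  (forall (E : finType) (M : matroid E), K E M -> binary M) /\
  (exists (E : finType) (M : matroid E), binary M /\ ~ K E M).

Definition template_hypothesis : Prop :=
  forall K : matroid_class, minor_closed K -> proper_binary_class K ->
  exists (k s t : nat) (Phi : 'I_s -> template) (Psi : 'I_t -> template),
    [/\ 0 < k,
        forall (i : 'I_s) (E : finType) (M : matroid E),
          conforms (Phi i) M -> K E M,
        forall (j : 'I_t) (E : finType) (M : matroid E),
          conforms (Psi j) (dual M) -> K E M
      & forall (E : finType) (M : matroid E),
          K E M -> kconnected M k -> 2 * k <= #|E| ->
          (exists i, conforms (Phi i) M) \/ (exists j, conforms (Psi j) (dual M))].

(* Main.v *)
(* If M is an even-cycle matroid of rank r in which every set of fewer than d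
   elements has a spanning complement, then at least r vertices have a nonempty
   star, each star has at least d elements, and each element lies in at most two
   of them, so r d <= 2 |M|. This, with a count of simple even-cycle matroids on
   four vertices for PG(3,2)\e, shows that none of the three matroids is
   even-cycle; even-cycle matroids are closed under minors.

   Conversely, apply the hypothesis to the class of binary matroids with none of
   the three minors. The matroids conforming to any given template have all
   graphic matroids as minors, and L_19 is cographic, so no dual template occurs. For a template Phi, excluding PG(3,2)\e forces every row of Delta to
   annihilate the combinations of columns of A_1 that lie in Lambda, so Delta can
   be taken trivial, and forces Lambda to have dimension at most 1 modulo the
   columns of C. Contracting, for each j in Y_1, a column of Z that meets its own
   row of P turns the columns of Y_1 into vertices of a complete graph. Modulo a
   basis, every further vector is then an even set of vertices. The excluded
   minors forbid even sets of size 6 or more and force all 4-element sets to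
   share a common pair {a, b}: the only other possibilities yield PG(3,2)\e or
   L_11. Hence, modulo the single vector x = a + b (or modulo Lambda, when Lambda
   is not spanned by C), every column of a conforming matroid is an edge. The
   columns of Y_0 are in the span of the others by connectivity, and x plays the
   role of the sign row of an even-cycle matrix. *)
Require Import Defs.
From mathcomp Require Import all_boot all_order all_algebra.
From mathcomp Require Import zify.

Set Implicit Arguments.
Unset Strict Implicit.
Unset Printing Implicit Defensive.

Import GRing.Theory.

(** * Linear algebra over GF(2) *)

Section BinarySpan.
Local Open Scope ring_scope.

(** Over GF(2) a matroid is determined by which sets of columns sum into the contracted subspace, so
    each change of representation is verified on subset sums alone. Contraction appears in two
    forms: a quotient by a subspace, suited to the search for minors, and a pivot inside a fixed
    space, suited to preserving the shape of columns. The constraints on a template come from a test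
    matroid that has every column the template admits over a chosen set of rows; an excluded minor
    is exhibited in it by showing that prescribed vectors are columns modulo contracted ones. These
    vectors are even vertex sets, which become bit masks once a base vertex is fixed, so each
    forbidden configuration is a Boolean computation. The final $k$ is that of the hypothesis
    enlarged by the sizes $|Y_0|$, so that $Y_0$ is too small to form a separation. *)

Lemma F2_cases (a : 'F_2) : {a = 0} + {a = 1}.
Proof.
by case: a => -[|[|m]] // i; [left | right]; apply: val_inj.
Qed.

Lemma F2_neq0 (a : 'F_2) : (a != 0) = (a == 1).
Proof. by case: (F2_cases a) => ->. Qed.

Lemma F2_natr_bool (a : 'F_2) : (a != 0)%:R = a.
Proof. by case: (F2_cases a) => ->. Qed.

Lemma addvv (V : lmodType 'F_2) (v : V) : v + v = 0.
Proof.
rewrite -{1 2}(scale1r v) -scalerDl (_ : 1 + 1 = 0) ?scale0r //.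
exact: val_inj.
Qed.

Lemma addF2 (a : 'F_2) : a + a = 0.
Proof. exact: (addvv (a : ('F_2)^o)). Qed.

Lemma oppv (V : lmodType 'F_2) (v : V) : - v = v.
Proof. by apply/esym/eqP; rewrite -addr_eq0 addvv. Qed.

Lemma addvK (V : lmodType 'F_2) (v w : V) : v + w + w = v.
Proof. by rewrite -addrA addvv addr0. Qed.

Lemma addv_eq0 (V : lmodType 'F_2) (v w : V) : (v + w == 0) = (v == w).
Proof. by rewrite addr_eq0 oppv. Qed.

Lemma sumv_symdiff (V : lmodType 'F_2) (E : finType) (c : E -> V)
    (S T : {set E}) :
  \sum_(e in S) c e + \sum_(e in T) c e =
  \sum_(e in (S :\: T) :|: (T :\: S)) c e.
Proof.
rewrite (big_setID T) [X in _ + X](big_setID S) /= (setIC T S).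
rewrite addrACA addvv add0r [RHS](big_setID S) /=; congr (_ + _);
  by apply: eq_bigl => x; rewrite !inE; case: (x \in S); case: (x \in T).
Qed.

Section Family.
Variables (V : vectType 'F_2) (E : finType).
Implicit Types (c : E -> V) (S T : {set E}) (U W : {vspace V}) (v : V).

Definition sp c S : {vspace V} := (\sum_(e in S) <[c e]>)%VS.

Lemma mem_congr U v w : v + w \in U -> (v \in U) = (w \in U).
Proof.
move=> vw; apply/idP/idP => h; first by rewrite -(rpredDl _ h).
by rewrite -(rpredDr _ h).
Qed.

Lemma mem_line v w : (v \in <[w]>%VS) = (v == 0) || (v == w).
Proof.
apply/vlineP/orP => [[a ->]|[/eqP->|/eqP->]].
- by case: (F2_cases a) => ->; rewrite ?scale0r ?scale1r eqxx; [left|right].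
- by exists 0; rewrite scale0r.
- by exists 1; rewrite scale1r.
Qed.

Lemma mem_add_line U v w :
  (v \in (U + <[w]>)%VS) = (v \in U) || (v + w \in U).
Proof.
apply/memv_addP/orP => [[u uU [x xw ->]]|[vU|vwU]].
- move: xw; rewrite mem_line => /orP[]/eqP->; rewrite ?addr0 ?addvK uU; first by left.
  by right.
- by exists v => //; exists 0; rewrite ?mem0v ?addr0.
- by exists (v + w) => //; exists w; rewrite ?memv_line // addvK.
Qed.

Lemma sp_set0 c : sp c set0 = 0%VS.
Proof. by rewrite /sp big_set0. Qed.

Lemma sp_setU1 c e S : sp c (e |: S) = (sp c S + <[c e]>)%VS.
Proof.
have [eS|eS] := boolP (e \in S).
  rewrite (setUidPr _) ?sub1set //; apply/esym/addv_idPl.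
  by rewrite /sp (sumv_sup e).
by rewrite /sp big_setU1 //= addvC.
Qed.

Lemma sp_setU c S T : sp c (S :|: T) = (sp c S + sp c T)%VS.
Proof.
apply/eqP; rewrite eqEsubv; apply/andP; split.
  apply/subv_sumP => e; rewrite inE => /orP[] h; rewrite /sp.
    by apply: subv_trans (addvSl _ _); apply: (sumv_sup e).
  by apply: subv_trans (addvSr _ _); apply: (sumv_sup e).
by rewrite subv_add; apply/andP; split; apply/subv_sumP => e h;
  apply: (sumv_sup e); rewrite // inE h ?orbT.
Qed.

Lemma spS c S T : S \subset T -> (sp c S <= sp c T)%VS.
Proof. by move=> /setUidPr <-; rewrite sp_setU addvSl. Qed.

(** Coefficients over GF(2) amount to subsets, which is why spans are handled through subset sums
    throughout. *)
Lemma mem_spP c S U v :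
  reflect (exists2 T : {set E}, T \subset S & v + \sum_(e in T) c e \in U)
          (v \in (sp c S + U)%VS).
Proof.
apply: (iffP idP) => [|[T sTS vU]].
  case/memv_addP => x xS [u uU ->]; case/memv_sumP: xS => y yl ->.
  exists [set e in S | y e != 0]; first by apply/subsetP => e; rewrite !inE => /andP[].
  rewrite (_ : \sum_(i in [set e in S | y e != 0]) c i = \sum_(i in S) y i).
    by rewrite addrAC addvv add0r.
  rewrite big_mkcond [RHS]big_mkcond; apply: eq_bigr => e _.
  rewrite inE; case: (boolP (e \in S)) => //= eS.
  by have := yl e eS; rewrite mem_line; case: (eqVneq (y e)) => [->|_] //= /eqP.
rewrite -[v](addvK _ (\sum_(e in T) c e)) addrC memv_add //.
by apply: memv_suml => e eT; rewrite memvE /sp (sumv_sup e) // (subsetP sTS).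
Qed.

Lemma dimv_add_line U v : \dim (U + <[v]>) = (\dim U + (v \notin U))%N.
Proof.
have [vU|vU] := boolP (v \in U).
  by rewrite addn0 (addv_idPl _) -?memvE.
have v0 : v != 0 by apply: contra vU => /eqP->; rewrite mem0v.
rewrite dimv_disjoint_sum ?dim_vline ?v0 //.
apply/eqP; rewrite -subv0; apply/subvP => x.
rewrite memv_cap mem_line => /andP[xU /orP[/eqP->|/eqP xv]]; rewrite ?mem0v //.
by rewrite -xv xU in vU.
Qed.

End Family.

Lemma sp_comp (V : vectType 'F_2) (E F : finType) (c : E -> V) (g : F -> E)
    (S : {set F}) : sp c (g @: S) = sp (c \o g) S.
Proof.
apply/eqP; rewrite eqEsubv; apply/andP; split.
  by apply/subv_sumP => e /imsetP[f fS ->]; rewrite /sp (sumv_sup f).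
apply/subv_sumP => f fS; rewrite /sp (sumv_sup (g f)) //.
exact: imset_f.
Qed.

(** Adding [e] to [S] raises the dimension exactly when no set consisting of [e] and elements of [S]
    sums into the subspace, and this can be read off from subset sums on both sides alike. *)
Lemma eq_dim_sp (V W : vectType 'F_2) (E : finType) (c : E -> V) (d : E -> W)
    (U : {vspace V}) (X : {vspace W}) :
  (forall S : {set E}, (\sum_(e in S) c e \in U) = (\sum_(e in S) d e \in X)) ->
  forall S : {set E},
    (\dim (sp c S + U) + \dim X = \dim (sp d S + X) + \dim U)%N.
Proof.
move=> cd S; have [n] := ubnP #|S|; elim: n S => // n IHn S.
have [->|[e eS]] := set_0Vmem S.
  by rewrite !sp_set0 !add0v addnC.
rewrite (cardsD1 e) eS add1n ltnS => /IHn IH.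
rewrite -(setD1K eS) !sp_setU1 -!addvA ![(<[_]> + _)%VS]addvC !addvA !dimv_add_line.
have -> : (c e \in (sp c (S :\ e) + U)%VS) = (d e \in (sp d (S :\ e) + X)%VS).
  have h (T : {set E}) : T \subset S :\ e -> (c e + \sum_(i in T) c i \in U) =
                                 (d e + \sum_(i in T) d i \in X).
    move=> sTS; have sT := subsetP sTS.
    have eT : e \notin T by apply/negP => /sT; rewrite !inE eqxx.
    by have := cd (e |: T); rewrite !big_setU1.
  by apply/mem_spP/mem_spP => -[T sT]; [rewrite h|rewrite -h] => //; exists T.
lia.
Qed.

End BinarySpan.

(** * Minors and representations *)

Section MinorEmbedding.

(** Minors without subtypes: [C] is contracted, and whatever lies neither in [C] nor in the image of
    [g] is deleted. *)
Definition minor_emb (E F : finType) (M : matroid E) (N : matroid F)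
    (g : F -> E) (C : {set E}) : Prop :=
  [/\ injective g, forall f, g f \notin C
    & forall S : {set F}, rk M (g @: S :|: C) = rk N S + rk M C].

Lemma has_minorP (E F : finType) (M : matroid E) (N : matroid F) :
  has_minor M N <-> exists g C, minor_emb M N g C.
Proof.
split=> [[C [D [_ [f bij_f rk_f]]]]|[g [C [inj_g gC rk_g]]]].
  exists (val \o f), C; split.
  - exact: inj_comp val_inj (bij_inj bij_f).
  - by move=> x /=; have := valP (f x); rewrite inE negb_or => /andP[].
  move=> S; rewrite -rk_f /= /minor_rk imset_comp subnK //.
  by rewrite rk_mono // subsetUr.
pose D := ~: (g @: setT :|: C); exists C, D; split.
  by rewrite disjoints_subset setCK subsetUr.
have gP x : g x \notin C :|: D.
  by rewrite !inE negb_or gC /= negbK imset_f.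
pose h x : minor_ground C D := Sub (g x) (gP x).
have inj_h : injective h by move=> x y /(congr1 val) /= /inj_g.
exists h.
  apply: inj_card_bij => //.
  rewrite card_sig -[X in _ <= X]cardsT -(card_imset _ inj_g).
  apply/subset_leq_card/subsetP => x; rewrite !inE negb_or negbK.
  by case: (x \in C); rewrite ?orbF ?andbF.
move=> S; rewrite /= /minor_rk.
have -> : val @: (h @: S) = g @: S by rewrite -imset_comp; apply: eq_imset.
by rewrite rk_g addnK.
Qed.

Lemma has_minor_trans (E F G : finType) (M : matroid E) (N : matroid F)
    (L : matroid G) : has_minor M N -> has_minor N L -> has_minor M L.
Proof.
move=> /has_minorP[g [C [inj_g gC rk_g]]] /has_minorP[h [D [inj_h hD rk_h]]].
apply/has_minorP; exists (g \o h), (g @: D :|: C); split.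
- exact: inj_comp.
- by move=> x; rewrite inE negb_or /= mem_imset // hD gC.
by move=> S; rewrite imset_comp setUA -imsetU !rk_g rk_h addnA.
Qed.

Lemma iso_has_minor (E F : finType) (M : matroid E) (N : matroid F) :
  matroid_iso M N -> has_minor N M.
Proof.
case=> f bij_f rk_f; apply/has_minorP; exists f, set0; split.
- exact: bij_inj.
- by move=> x; rewrite inE.
by move=> S; rewrite setU0 rk_f; have := rk_card N set0; rewrite cards0; lia.
Qed.

Lemma rk_set0 (E : finType) (M : matroid E) : rk M set0 = 0.
Proof. by have := rk_card M set0; rewrite cards0; lia. Qed.

Lemma rk_matroid_iso (E : finType) (M N : matroid E) :
  (forall S, rk M S = rk N S) -> matroid_iso M N.
Proof.
by move=> eMN; exists id => [|S]; [exists id | rewrite imset_id eMN].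
Qed.

(** The dual contracts what the minor deletes, so the new contracted set [D] is the complement of
    [C] and the image of [g]. *)
Lemma has_minor_dual (E F : finType) (M : matroid E) (N : matroid F) :
  has_minor M N -> has_minor (dual M) (dual N).
Proof.
move=> /has_minorP[g [C [inj_g gC rk_g]]]; apply/has_minorP.
pose D := ~: (g @: setT :|: C); exists g, D; split=> //.
  by move=> x; rewrite !inE negbK imset_f.
have gD (S : {set F}) : ~: (g @: S :|: D) = g @: (~: S) :|: C.
  apply/setP => x; rewrite !inE negb_or negbK.
  have [/imsetP[y _ ->]|nx] := boolP (x \in g @: setT).
    by rewrite !mem_imset // !inE (negPf (gC y)) !orbF andbT.
  have h (T : {set F}) : x \in g @: T = false.
    by apply: contraNF nx; apply/subsetP/imsetS/subsetT.
  by rewrite !h.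
move=> S; rewrite /= /dual_rk gD.
have := gD set0; rewrite imset0 set0U setC0 => ->.
rewrite !rk_g.
have cD : #|g @: S :|: D| = #|S| + #|D|.
  rewrite cardsU card_imset // (_ : _ :&: _ = set0) ?cards0 ?subn0 //.
  apply/setP => x; rewrite !inE; apply/negP => /andP[/(subsetP (imsetS g (subsetT S)))->].
  by [].
have := dual_rk_ge N S; have := dual_rk_ge M D.
have := gD set0; rewrite imset0 set0U setC0 => ->; rewrite rk_g cD.
by have := rk_mono N (subsetT (~: S)); lia.
Qed.

End MinorEmbedding.

Section Representation.

(* [c] represents [M] after the subspace [U] has been factored out. *)
Definition rep (V : vectType 'F_2) (E : finType) (M : matroid E) (c : E -> V)
    (U : {vspace V}) : Prop :=
  forall S : {set E}, rk M S + \dim U = \dim (sp c S + U)%VS.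

Lemma rep_vector (B E : finType) (A : bmatrix B E) :
  rep (vector_matroid A) (column A) 0%VS.
Proof. by move=> S; rewrite /= /column_rk colspaceE dimv0 addn0 addv0. Qed.

Lemma rep_minor_emb (V : vectType 'F_2) (E F : finType) (M : matroid E)
    (N : matroid F) (c : E -> V) (U : {vspace V}) g C :
  rep M c U -> minor_emb M N g C -> rep N (c \o g) (sp c C + U)%VS.
Proof.
move=> rM [inj_g gC rk_g] S.
have := rM (g @: S :|: C); have := rM C.
by rewrite sp_setU sp_comp rk_g addvA; lia.
Qed.

Lemma rep_iso (V : vectType 'F_2) (E F : finType) (M : matroid E)
    (N : matroid F) (c : F -> V) (U : {vspace V}) :
  rep N c U -> matroid_iso M N -> 
  exists2 f : E -> F, bijective f & rep M (c \o f) U.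
Proof.
move=> rN [f bij_f rk_f]; exists f => // S.
by rewrite -sp_comp -rN rk_f.
Qed.

Lemma rep_sums (V W : vectType 'F_2) (E : finType) (M : matroid E)
    (c : E -> V) (d : E -> W) (U : {vspace V}) (X : {vspace W}) :
  (forall S : {set E},
     ((\sum_(e in S) c e)%R \in U) = ((\sum_(e in S) d e)%R \in X)) ->
  rep M c U -> rep M d X.
Proof.
move=> cd rM S; have := eq_dim_sp cd S; rewrite -rM; lia.
Qed.

Lemma rep_column_iso (B E : finType) (M : matroid E) (A : bmatrix B E) :
  rep M (column A) 0%VS -> matroid_iso M (vector_matroid A).
Proof.
move=> rM; apply: rk_matroid_iso => S.
by have := rM S; rewrite -(rep_vector A); lia.
Qed.

End Representation.

(** * Contraction as a pivot *)

Section Contraction.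
Local Open Scope ring_scope.
Variables (B : finType) (E : finType).
Local Notation V := {ffun B -> ('F_2)^o}.

Lemma ffun_neq0 (v : V) : v != 0 -> {b | v b = 1}.
Proof.
move=> v0; case: (pickP (fun b => v b != 0)) => [b|v00].
  by rewrite F2_neq0 => /eqP; exists b.
case/eqP: v0; apply/ffunP => b; rewrite ffunE.
by have /eqP := negbFE (v00 b).
Qed.

(** When [w b = 1] this is the projection along [w] that clears coordinate [b]. The vectors stay in
    the same space, so one predicate can describe the columns before and after contraction. *)
Definition pivot (w : V) (b : B) (v : V) : V := if v b == 0 then v else v + w.

Lemma pivot_sum (I : finType) (S : {set I}) (c : I -> V) w b :
  \sum_(i in S) pivot w b (c i) = pivot w b (\sum_(i in S) c i).
Proof.
elim/big_rec2: _ => [|i x y _ ->]; rewrite /pivot ?ffunE //.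
case: (F2_cases (c i b)) => ->; case: (F2_cases (x b)) => -> /=;
  rewrite ?add0r ?addr0 ?addF2 ?eqxx //=; rewrite ?addrA //.
- by rewrite addrAC.
- by rewrite addrAC addvK.
Qed.

Lemma pivot_eq0 (w v : V) b :
  w b = 1 -> (pivot w b v == 0) = (v \in <[w]>%VS).
Proof.
rewrite mem_line /pivot => wb; case: (eqVneq (v b) 0) => vb.
  by case: (eqVneq v w) vb => [->|_]; rewrite ?orbF // wb.
rewrite addv_eq0; case: (eqVneq v 0) vb => [->|//].
by rewrite ffunE eqxx.
Qed.

(* Contracting an element [e] amounts to pivoting on a nonzero entry of its
   column. *)
Lemma contract_family (P : pred V) :
  (forall w : V, P w -> w != 0 ->
     exists2 b, w b = 1 & forall v, P v -> P (pivot w b v)) ->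
  forall (c : E -> V) (C : {set E}), (forall e, P (c e)) ->
  exists d : E -> V, (forall e, P (d e)) /\
    forall S : {set E}, (\sum_(e in S) c e \in sp c C) = (\sum_(e in S) d e == 0).
Proof.
move=> pivP c C Pc; have [n] := ubnP #|C|; elim: n C => // n IHn C.
have [->|[e eC]] := set_0Vmem C.
  by move=> _; exists c; split=> // S; rewrite sp_set0 memv0.
rewrite (cardsD1 e) eC add1n ltnS => /IHn [d [Pd cd]].
have sp1 (S : {set E}) : (\sum_(i in S) c i \in sp c C) =
    (\sum_(i in S) d i \in <[d e]>%VS).
  rewrite -(setD1K eC) sp_setU1 mem_add_line mem_line cd; congr (_ || _).
  (* Written as a sum over a singleton, the column of [e] can be added by a symmetric difference, to
     which [cd] applies. *)
  have s1 (W : lmodType 'F_2) (f : E -> W) : f e = \sum_(i in [set e]) f i.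
    by rewrite big_set1.
  by rewrite -addv_eq0 (s1 _ c) (s1 _ d) !sumv_symdiff cd.
have [de0|de0] := eqVneq (d e) 0.
  by exists d; split=> // S; rewrite sp1 de0 mem_line orbb.
have [b db Pb] := pivP _ (Pd e) de0.
exists (pivot (d e) b \o d); split=> [i|S]; first exact: Pb.
by rewrite sp1 pivot_sum pivot_eq0.
Qed.

End Contraction.

(** * Even-cycle matroids are closed under minors *)

Section EvenCycle.
Local Open Scope ring_scope.

Lemma column_ffun (B E : finType) (c : E -> {ffun B -> ('F_2)^o}) :
  column (fun b e => c e b) =1 c.
Proof. by move=> e; apply/ffunP => b; rewrite ffunE. Qed.

Lemma rep_eq (V : vectType 'F_2) (E : finType) (M : matroid E)
    (c d : E -> V) (U : {vspace V}) : c =1 d -> rep M c U -> rep M d U.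
Proof.
move=> cd rM; refine (rep_sums _ rM) => S.
by rewrite (eq_bigr _ (fun e _ => cd e)).
Qed.

(** A class of columns stable under pivoting is stable under minors. It is applied to all vectors
    for binary matroids and to [ec_vector] for even-cycle matroids. *)
Lemma contract_rep (B E F : finType) (M : matroid E) (N : matroid F)
    (P : pred {ffun B -> ('F_2)^o}) (c : E -> {ffun B -> ('F_2)^o}) :
  (forall w : {ffun B -> ('F_2)^o}, P w -> w != 0 ->
     exists2 b, w b = 1 & forall v, P v -> P (pivot w b v)) ->
  (forall e, P (c e)) -> rep M c 0%VS -> has_minor M N ->
  exists2 d : F -> {ffun B -> ('F_2)^o}, forall f, P (d f) & rep N d 0%VS.
Proof.
move=> pivP Pc rM /has_minorP[g [C embg]].
have [d [Pd cd]] := contract_family pivP C Pc.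
exists (d \o g) => [f|]; first exact: Pd.
refine (rep_sums _ (rep_minor_emb rM embg)) => S.
have [inj_g _ _] := embg.
have sum_g (W : zmodType) (h : E -> W) :
    \sum_(f in S) (h \o g) f = \sum_(e in g @: S) h e.
  by rewrite big_imset // => x y _ _ /inj_g.
by rewrite addv0 memv0 !sum_g cd.
Qed.

Lemma binary_minor (E F : finType) (M : matroid E) (N : matroid F) :
  binary M -> has_minor M N -> binary N.
Proof.
move=> [B [E' [A /(rep_iso (rep_vector A))[f _ rM]]]] MN.
have [w _ /ffun_neq0[b wb]|//|d _ rN] := contract_rep (P := predT) _ _ rM MN.
  by exists b.
exists B, F, (fun b e => d e b); apply: rep_column_iso.
by apply: rep_eq rN => e; rewrite column_ffun.
Qed.

(** A column of an even-cycle matrix: [None] is the sign row, on which nothing is required, and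
    [u = w] is a loop of the graph. *)
Definition ec_vector (V : finType) (v : {ffun option V -> ('F_2)^o}) : bool :=
  [exists u, exists w, forall z, v (Some z) == (z == u)%:R + (z == w)%:R].

Lemma ec_vectorP (V : finType) (v : {ffun option V -> ('F_2)^o}) :
  reflect (exists u w, forall z, v (Some z) = (z == u)%:R + (z == w)%:R)
          (ec_vector v).
Proof.
apply: (iffP existsP) => -[u].
  by case/existsP => w /forallP h; exists u, w => z; apply/eqP.
by case=> w h; exists u; apply/existsP; exists w; apply/forallP => z; rewrite h.
Qed.

(** A nonzero [w] that vanishes on the vertex rows is 1 in the sign row, and pivoting there changes
    only signs. Otherwise [w] is an edge from [u] to [u'], and pivoting at [u] moves every edge end
    at [u] to [u']: the edge is contracted, after resigning at [u] when it is odd. *)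
Lemma ec_pivot (V : finType) (w : {ffun option V -> ('F_2)^o}) :
  ec_vector w -> w != 0 ->
  exists2 b, w b = 1 & forall v, ec_vector v -> ec_vector (pivot w b v).
Proof.
move=> /ec_vectorP[u [u' hw]] w0.
have [uu'|uu'] := eqVneq u u'.
  have hw0 z : w (Some z) = 0 by rewrite hw uu' addF2.
  exists None => [|v ev].
    have [[z|]] := ffun_neq0 w0; last by [].
    by rewrite hw0.
  have [t [t' hv]] := ec_vectorP _ ev; apply/ec_vectorP; exists t, t' => z.
  by rewrite /pivot; case: ifP; rewrite ?ffunE ?hw0 ?addr0 hv.
have wu : w (Some u) = 1 by rewrite hw eqxx (negPf uu') addr0.
exists (Some u) => // v ev; rewrite /pivot; case: ifP => // /negbT.
rewrite F2_neq0 => /eqP; have [t [t' hv]] := ec_vectorP _ ev.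
have endsC x y z : (z == x)%:R + (z == y)%:R = (z == y)%:R + (z == x)%:R :> 'F_2.
  by rewrite addrC.
rewrite hv => tt'.
have {tt'} [s hs] : exists s, forall z,
    (z == t)%:R + (z == t')%:R = (z == u)%:R + (z == s)%:R :> 'F_2.
  move: tt'; case: (eqVneq u t) => [<- _|_]; first by exists t'.
  by case: (eqVneq u t') => [<- _|_] //; exists t => z; rewrite endsC.
apply/ec_vectorP; exists s, u' => z.
by rewrite ffunE hv hw hs addrACA addF2 add0r.
Qed.

Lemma even_cycleP (E : finType) (M : matroid E) :
  even_cycle M <->
  exists (V : finType) (c : E -> {ffun option V -> ('F_2)^o}),
    (forall e, ec_vector (c e)) /\ rep M c 0%VS.
Proof.
split=> [[V [F [G [W /(rep_iso (rep_vector _))[f _ rM]]]]]|[V [c [ec rM]]]].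
  exists V, (column (even_cycle_matrix G W) \o f); split=> // e.
  apply/ec_vectorP; exists (G (f e)).1, (G (f e)).2 => z.
  by rewrite ffunE.
have [u hu] := fin_all_exists (fun e => ec_vectorP _ (ec e)).
have [w hw] := fin_all_exists hu.
exists V, E, (fun e => (u e, w e)), [set e | c e None != 0].
apply: rep_column_iso; apply: rep_eq rM => e.
by apply/ffunP => -[z|]; rewrite ffunE /= ?hw // inE F2_natr_bool.
Qed.

Lemma even_cycle_minor (E F : finType) (M : matroid E) (N : matroid F) :
  even_cycle M -> has_minor M N -> even_cycle N.
Proof.
move=> /even_cycleP[V [c [ec rM]]] MN; apply/even_cycleP; exists V.
by have [d ed rN] := contract_rep (@ec_pivot V) ec rM MN; exists d.
Qed.

End EvenCycle.

(** * Vertex stars *)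

Section Separation.
Local Open Scope ring_scope.

(** Subtracting the projection onto [U] kills [U] but not [v]; the form is a coordinate in which the
    image of [v] is nonzero. *)
Lemma separating_form (B : finType) (U : {vspace {ffun B -> ('F_2)^o}})
    (v : {ffun B -> ('F_2)^o}) : v \notin U ->
  exists y : {ffun B -> 'F_2},
    (forall u, u \in U -> \sum_b y b * u b = 0) /\ \sum_b y b * v b = 1.
Proof.
move=> vU; pose f u := u - projv U u.
have fU u : u \in U -> f u = 0 by move=> uU; rewrite /f projv_id // subrr.
have fv : f v != 0.
  by apply: contra vU; rewrite subr_eq0 => /eqP->; rewrite memv_proj.
have [b fvb] := ffun_neq0 fv.
pose delta i : {ffun B -> ('F_2)^o} := [ffun j => (j == i)%:R].
have fE u : f u b = \sum_i f (delta i) b * u i.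
  have uE : u = \sum_i u i *: delta i.
    apply/ffunP => j; rewrite sum_ffunE (bigD1 j) //= big1 => [|i ij].
      by rewrite !ffunE eqxx addr0 [_ *: _]mulr1.
    by rewrite !ffunE eq_sym (negPf ij) scaler0.
  rewrite {1}uE /f linear_sum -sumrB sum_ffunE; apply: eq_bigr => i _.
  by rewrite linearZ -scalerBr ffunE mulrC.
exists [ffun i => f (delta i) b]; split=> [u uU|].
  under eq_bigr do rewrite ffunE; by rewrite -fE fU // ffunE.
by under eq_bigr do rewrite ffunE; rewrite -fE.
Qed.

Lemma card_lt_exp_dim (V : vectType 'F_2) (E : finType) (c : E -> V) (S : {set E}) :
  {in S &, injective c} -> (forall e, e \in S -> c e != 0) ->
  (#|S| < 2 ^ \dim (sp c S))%N.
Proof.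
move=> inj_c c0; pose U := sp c S; pose d := \dim U.
have cU e : e \in S -> c e \in U by move=> eS; rewrite memvE /U /sp (sumv_sup e).
pose h e : {ffun 'I_d -> 'F_2} := [ffun i => coord (vbasis U) i (c e)].
have inj_h : {in S &, injective h}.
  move=> e f eS fS /ffunP ef; apply: inj_c => //.
  rewrite (coord_vbasis (cU e eS)) (coord_vbasis (cU f fS)).
  by apply: eq_bigr => i _; have := ef i; rewrite !ffunE => ->.
have <- : #|{ffun 'I_d -> 'F_2}| = (2 ^ d)%N by rewrite card_ffun card_Fp // card_ord.
rewrite -(card_in_imset inj_h) -cardsT.
apply/proper_card/properP; split; first exact: subsetT.
exists 0; rewrite ?inE //; apply/imsetP => -[e eS /ffunP h0].
case/eqP: (c0 e eS); rewrite (coord_vbasis (cU e eS)) big1 // => i _.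
by have := h0 i; rewrite !ffunE => <-; rewrite scale0r.
Qed.

Lemma dim_sp_le (V : vectType 'F_2) (E : finType) (c : E -> V) (S : {set E}) :
  (\dim (sp c S) <= #|S|)%N.
Proof.
rewrite (leq_trans (dimv_leq_sum _ _ _)) // -sum1_card leq_sum // => e _.
by rewrite dim_vline; case: eqP.
Qed.

Lemma dim_ffun (B : finType) : \dim {: {ffun B -> ('F_2)^o}} = #|B|.
Proof. by rewrite dimvf /dim /= muln1. Qed.

End Separation.

Lemma rk_spE (V : vectType 'F_2) (E : finType) (M : matroid E) (c : E -> V) :
  rep M c 0%VS -> forall S, rk M S = \dim (sp c S).
Proof. by move=> rM S; have := rM S; rewrite dimv0 addn0 addv0. Qed.

Section Stars.
Variables (V E : finType) (M : matroid E) (c : E -> {ffun option V -> ('F_2)^o}).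
Hypothesis ec : forall e, ec_vector (c e).
Hypothesis rM : rep M c 0%VS.

Definition star v : {set E} := [set e | c e (Some v) != 0%R].
Definition support_vertices : {set V} := [set v | star v != set0].

(** Row [Some v] vanishes off the star, so the span of the complement contains no column of the
    star. *)
Lemma star_cocycle v : star v != set0 -> rk M (~: star v) < rk M setT.
Proof.
case/set0Pn => e; rewrite inE => ev.
have e_nsp : c e \notin sp c (~: star v).
  apply/negP; rewrite -[sp _ _]addv0 => /mem_spP[T sT].
  rewrite memv0 => /eqP/ffunP/(_ (Some v)); rewrite !ffunE sum_ffunE big1.
    by move=> h; rewrite addr0 in h; rewrite h eqxx in ev.
  by move=> i /(subsetP sT); rewrite !inE negbK => /eqP.
have := rk_mono M (subsetT (e |: ~: star v)).
by rewrite (rk_spE rM) sp_setU1 dimv_add_line e_nsp -(rk_spE rM) addn1.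
Qed.

Lemma sum_card_star : \sum_v #|star v| <= 2 * #|E|.
Proof.
under eq_bigr do rewrite -sum1_card big_mkcond /=.
rewrite exchange_big /= mulnC -sum_nat_const leq_sum // => e _.
have [u [w hw]] := ec_vectorP _ (ec e).
rewrite -big_mkcond sum1_card /= -(leq_add2r 0) addn0.
apply: leq_trans (subset_leq_card (_ : _ \subset [set u; w])) _.
  apply/subsetP => v ev; have : e \in star v by [].
  rewrite !inE hw; by case: (v == u); case: (v == w).
by rewrite addn0 cards2; case: eqP.
Qed.

(** The sign row contributes at most 1, and the edges, written as differences to one support vertex
    [v0], contribute at most the number of the other support vertices. The bound 1 covers the case
    where all columns are loops of the graph. *)
Lemma rk_le_support_vertices : rk M setT <= maxn 1 #|support_vertices|.
Proof.
pose delta v : {ffun option V -> ('F_2)^o} := [ffun b => (b == v)%:R%R].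
have cE e : exists u w, [/\ u \in support_vertices \/ u = w,
    w \in support_vertices \/ u = w
  & c e = (c e None *: delta None + (delta (Some u) + delta (Some w)))%R].
  have [u [w hw]] := ec_vectorP _ (ec e); exists u, w.
  have [uw|uw] := eqVneq u w.
    split; [by right|by right|]; apply/ffunP => -[z|]; rewrite !ffunE /=.
      by rewrite hw uw !addF2 scaler0 addr0.
    by rewrite ?addF2 !addr0 [RHS]mulr1.
  split; [left; rewrite inE|left; rewrite inE|].
  - by apply/set0Pn; exists e; rewrite inE hw eqxx (negPf uw) addr0.
  - by apply/set0Pn; exists e; rewrite inE hw eqxx (eq_sym w u) (negPf uw) add0r.
  apply/ffunP => -[z|]; rewrite !ffunE /=.
    by rewrite hw scaler0 add0r.
  by rewrite !addr0 [RHS]mulr1.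
have [VM0|[v0 v0M]] := set_0Vmem support_vertices.
  rewrite VM0 cards0 (rk_spE rM); apply: leq_trans (dimvS (_ : _ <= <[delta None]>)%VS) _.
    apply/subv_sumP => e _; have [u [w [hu hv ->]]] := cE e.
    have -> : u = w by case: hu; rewrite ?VM0 ?inE.
    by rewrite addvv addr0 -memvE memvZ ?memv_line.
  by rewrite dim_vline; case: eqP.
pose g v := (delta (Some v) + delta (Some v0))%R.
have sp_le : (sp c setT <= <[delta None]> + sp g (support_vertices :\ v0))%VS.
  apply/subv_sumP => e _; have [u [w [hu hw ->]]] := cE e.
  rewrite -memvE memv_add // ?memvZ ?memv_line //.
  have g_sp x : x \in support_vertices -> g x \in sp g (support_vertices :\ v0).
    have [-> _|x0 xV] := eqVneq x v0; first by rewrite /g addvv mem0v.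
    by rewrite memvE /sp (sumv_sup x) // in_setD1 x0.
  have [->|uw] := eqVneq u w; first by rewrite addvv mem0v.
  have -> : (delta (Some u) + delta (Some w) = g u + g w)%R.
    by rewrite addrACA addvv addr0.
  by apply: memvD; apply: g_sp; [case: hu|case: hw] => // /eqP; rewrite (negPf uw).
rewrite (rk_spE rM); apply: leq_trans (dimvS sp_le) _.
rewrite (leq_trans (leq_of_leqif (dimv_add_leqif _ _))) //.
rewrite leq_max; apply/orP; right; rewrite (cardsD1 v0 support_vertices) v0M.
by rewrite leq_add ?dim_sp_le // dim_vline; case: eqP.
Qed.

Lemma star_count d : 
  (forall S, rk M (~: S) < rk M setT -> d <= #|S|) ->
  #|support_vertices| * d <= 2 * #|E|.
Proof.
move=> hd; apply: leq_trans sum_card_star.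
rewrite [X in _ <= X](bigID (mem support_vertices)) /=.
apply: leq_trans (leq_addr _ _); rewrite -sum_nat_const leq_sum // => v.
by rewrite inE => /star_cocycle/hd.
Qed.

End Stars.

(** * The excluded minors are not even-cycle *)

Lemma minor_emb_val (E : finType) (M : matroid E) (C D : {set E}) :
  minor_emb M (minor M C D) val C.
Proof.
split; first exact: val_inj.
  by move=> f; have := valP f; rewrite inE negb_or => /andP[].
by move=> S; rewrite /= /minor_rk subnK // rk_mono // subsetUr.
Qed.

Section NotEvenCycle.
Local Open Scope ring_scope.

Lemma PG32_del_simple (e : PG_ground 4) :
  exists c : minor_ground set0 [set e] -> {ffun 'I_4 -> ('F_2)^o},
    [/\ injective c, forall f, c f != 0, forall f, c f <> [ffun i => val e ord0 i]
      & rep (PG32_del e) c 0%VS].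
Proof.
exists (column (fun (i : 'I_4) (v : PG_ground 4) => val v ord0 i) \o val).
split=> [f g /= /ffunP fg|f|f /= /ffunP fe|].
- apply/val_inj/val_inj/rowP => i.
  by have := fg i; rewrite !ffunE /= !(ord1 ord0).
- apply: contra (valP (val f)) => /eqP/ffunP h.
  by apply/eqP/rowP => i; have := h i; rewrite !ffunE mxE.
- have := valP f; rewrite !inE /= => /eqP[]; apply/val_inj/rowP => i.
  by have := fe i; rewrite !ffunE.
have := rep_minor_emb (rep_vector (fun (i : 'I_4) (v : PG_ground 4) => val v ord0 i))
  (minor_emb_val _ set0 [set e]).
by rewrite sp_set0 addv0.
Qed.

Lemma card_PG32_del (e : PG_ground 4) : #|{: minor_ground set0 [set e]}| = 14%N.
Proof.
rewrite card_sig (eq_card (_ : _ =i predC1 e)) ?cardC1 => [|x]; last first.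
  by rewrite !inE.
by rewrite card_sig -[LHS]/(#|predC1 (0 : 'rV['F_2]_4)|.-1) cardC1 card_mx card_Fp.
Qed.

Lemma rep_nonzero_rk (V : vectType 'F_2) (E : finType) (M : matroid E) (c : E -> V) :
  rep M c 0%VS -> (forall e, c e != 0) -> forall e, rk M [set e] = 1%N.
Proof.
by move=> rM c0 e; rewrite (rk_spE rM) -[[set e]]setU0 sp_setU1 sp_set0 add0v dim_vline c0.
Qed.

Lemma PG32_del_not_even_cycle (e : PG_ground 4) : ~ even_cycle (PG32_del e).
Proof.
set N := PG32_del e; have [p [inj_p p0 _ rp]] := PG32_del_simple e.
move=> /even_cycleP[V [c [ec rc]]]; have cE := card_PG32_del e.
set E := minor_ground set0 [set e] in N p inj_p p0 rp c ec rc cE *.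
have dim_p (S : {set E}) : (#|S| < 2 ^ rk N S)%N.
  by rewrite (rk_spE rp); apply: card_lt_exp_dim => // f g _ _; apply: inj_p.
have rk4 : (rk N setT <= 4)%N.
  by rewrite (rk_spE rp) (leq_trans (dimvS (subvf _))) // dim_ffun card_ord.
have dim4 (S : {set E}) : (7 < #|S|)%N -> (4 <= rk N S)%N.
  move=> S7; rewrite leqNgt; apply/negP => h.
  by have := leq_trans (dim_p S) (leq_pexp2l (m := 2) (n2 := 3) isT h); rewrite ltnNge S7.
(* Removing fewer than 7 of the 14 elements leaves at least 8, which have rank 4. Hence there are at
   most 28 / 7 = 4 support vertices, and rank 4 requires that many. *)
have star7 := star_count ec rc (d := 7).
have rk_n := rk_le_support_vertices ec rc.
have rk4' : (4 <= rk N setT)%N by rewrite dim4 // cardsT cE.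
set X := support_vertices c in star7 rk_n.
have cX : #|X| = 4.
  apply/eqP; rewrite eqn_leq; apply/andP; split; last first.
    by have := leq_trans rk4' rk_n; rewrite leq_max.
  rewrite -(leq_pmul2r (isT : (0 < 7)%N)); rewrite cE in star7; apply: star7 => S hS.
  rewrite leqNgt; apply/negP => S7.
  have := cardsC S; rewrite cE => cS.
  have : (4 <= rk N (~: S))%N by apply: dim4; lia.
  lia.
(* A simple even-cycle matroid on four vertices is a restriction of the doubled
   K_4 with one further loop, which has 13 elements. *)
have inj_c : injective c.
  move=> f g cfg; apply/eqP/negP => /negP fg.
  have : rk N [set f; g] = 2.
    rewrite (rk_spE rp) sp_setU1 dimv_add_line -(rk_spE rp) // (rep_nonzero_rk rp) //.
    rewrite -[[set g]]setU0 sp_setU1 sp_set0 add0v mem_line (negPf (p0 _)).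
    by rewrite (inj_eq inj_p) (negPf fg).
  by rewrite (rk_spE rc) sp_setU1 cfg dimv_add_line -(rk_spE rc) // (rep_nonzero_rk rp) //;
    rewrite memvE -[[set g]]setU0 sp_setU1 addvSr.
have c0 f : c f != 0.
  have := rep_nonzero_rk rp p0 f.
  rewrite (rk_spE rc) -[[set f]]setU0 sp_setU1 sp_set0 add0v dim_vline.
  by case: eqP.
pose h f := (c f None != 0, [set v | c f (Some v) != 0]).
have inj_h : injective h.
  move=> f g [fg1 /setP fg2]; apply: inj_c; apply/ffunP => -[v|].
    by have := fg2 v; rewrite !inE => fgv;
      rewrite -[LHS]F2_natr_bool fgv F2_natr_bool.
  by rewrite -[LHS]F2_natr_bool fg1 F2_natr_bool.
pose K := setX setT [set A : {set V} | (A \subset X) && (#|A| == 2)] :|: [set (true, set0)].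
have hK f : h f \in K.
  have [u [w hw]] := ec_vectorP _ (ec f); rewrite !inE /=.
  have [uw|uw] := eqVneq u w.
    have z v : c f (Some v) = 0 by rewrite hw uw addF2.
    apply/orP; right; apply/eqP; congr (_, _).
      by apply: contra (c0 f) => /eqP h0; apply/eqP/ffunP => -[v|]; rewrite ffunE.
    by apply/setP => v; rewrite !inE z eqxx.
  apply/orP; left; apply/andP; split.
    apply/subsetP => v; rewrite inE => hv; rewrite inE; apply/set0Pn; exists f.
    by rewrite inE.
  rewrite (_ : [set v | _] = [set u; w]) ?cards2 ?uw //.
  apply/setP => v; rewrite !inE hw; case: (eqVneq v u) => [->|_].
    by rewrite (negPf uw).
  by case: (v == w).
have : (#|h @: setT| <= #|K|)%N by apply/subset_leq_card/subsetP => _ /imsetP[f _ ->].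
rewrite card_imset // cardsT cE => cK; have : (14 <= 13)%N; last by [].
apply: leq_trans cK (leq_trans (leq_card_setU _ _) _).
by rewrite cardsX cardsT card_bool cards_draws cX cards1.
Qed.

Lemma natr_F2 n : (n%:R != 0 :> 'F_2) = odd n.
Proof.
elim: n => [|n IHn]; first by rewrite eqxx.
rewrite -[n.+1]addn1 natrD oddD /= addbT -IHn.
by case: (F2_cases (n%:R)) => ->.
Qed.

(** The row space of [L11] has minimum weight at least 4, so its cocircuits have at least four
    elements; this is evaluated over all choices of the six bits. *)
Lemma L11_row_weight (b : {ffun 'I_6 -> bool}) : (exists i, b i) ->
  (3 < #|[set j : 'I_11 | odd (\sum_(i < 6) b i * nth 0 (nth [::] L11_rows i) j)]|)%N.
Proof.
pose ord_of (i : nat) : 'I_6 := inord i.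
(* The function is replaced by a list of six Booleans so that the sums compute. *)
have bE (i : 'I_6) : b i = nth false [seq b (ord_of k) | k <- iota 0 6] i.
  by rewrite (nth_map 0%N) ?size_iota ?nth_iota // add0n /ord_of inord_val.
case=> i0; rewrite bE -sum1_card big_mkcond /=.
under eq_bigr do rewrite inE.
under eq_bigr => j _ do under eq_bigr do rewrite bE.
case: i0 => i /=.
move: (b _) (b _) (b _) (b _) (b _) (b _) => b0 b1 b2 b3 b4 b5 lt_i hi.
rewrite !big_ord_recl !big_ord0 /= {bE}.
do 6 (destruct i as [|i]; [revert hi; case: b0 b1 b2 b3 b4 b5 => [] [] [] [] [] [] //=|]).
by [].
Qed.

(** Rank 6 and cocircuits of size at least 4 would require 6 * 4 <= 2 * 11. *)
Lemma L11_not_even_cycle : ~ even_cycle L11.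
Proof.
pose A : bmatrix 'I_6 'I_11 :=
  fun i j => (nth 0%N (nth [::] L11_rows i) j)%:R.
have rA : rep L11 (column A) 0%VS := rep_vector A.
move=> /even_cycleP[V [c [ec rc]]].
have full (S : {set 'I_11}) : (#|S| < 4)%N -> \dim (sp (column A) (~: S)) = 6.
  (* If the complement of [S] did not span, a nonzero combination of rows would vanish on it, and
     its support of size at least 4 would lie in [S]. *)
  move=> S4; suff -> : sp (column A) (~: S) = fullv by rewrite dim_ffun card_ord.
  apply/eqP; rewrite eqEsubv subvf; apply/negPn/negP => /subvPn[v _].
  case/separating_form => y [y0 yv].
  have /L11_row_weight : exists i, [ffun i => y i != 0] i.
    apply/existsP; apply: contra_eqT yv; rewrite negb_exists => /forallP h.
    rewrite big1 // => i _; have := h i; rewrite ffunE negbK => /eqP->.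
    by rewrite mul0r.
  apply/negP; rewrite -leqNgt -ltnS (leq_trans _ S4) // ltnS.
  apply/subset_leq_card/subsetP => j; rewrite inE; apply: contraTT => jS.
  have /eqP : \sum_b y b * column A j b = 0.
    by apply: y0; rewrite memvE /sp (sumv_sup j) // inE.
  rewrite -natr_F2 negbK natr_sum; congr (_ == _); apply: eq_bigr => i _.
  by rewrite natrM !ffunE F2_natr_bool.
have rk6 : rk L11 setT = 6%N.
  by rewrite (rk_spE rA) -setC0 full // cards0.
have : (#|support_vertices c| * 4 <= 2 * #|'I_11|)%N.
  apply: (star_count ec rc) => S; rewrite rk6 (rk_spE rA) => hS.
  by rewrite leqNgt; apply/negP => /full h; rewrite h in hS.
have := rk_le_support_vertices ec rc; rewrite rk6 card_ord; lia.
Qed.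

Lemma simple_rk_card (V : vectType 'F_2) (E : finType) (M : matroid E) (c : E -> V) :
  rep M c 0%VS -> injective c -> (forall e, c e != 0) ->
  forall S : {set E}, (#|S| <= 2)%N -> rk M S = #|S|.
Proof.
move=> rM inj_c c0 S S2; apply/eqP; rewrite eqn_leq rk_card /=.
have : (#|S| < 2 ^ rk M S)%N.
  by rewrite (rk_spE rM); apply: card_lt_exp_dim => // e f _ _; apply: inj_c.
by case: (rk M S) S2 => [|[|d]]; case: #|S| => [|[|[|n]]].
Qed.

Lemma L19_cycle_simple :
  injective (column (incidence L19_graph)) /\
  forall e, column (incidence L19_graph) e != 0.
Proof.
have lt_e (e : L19_edge) : ((val e).1 < (val e).2)%N by case/andP: (valP e).
have cE e v : column (incidence L19_graph) e v =
    (v == (val e).1)%:R + (v == (val e).2)%:R by rewrite ffunE.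
split=> [e f ef|e].
  have h v : (v == (val e).1) (+) (v == (val e).2) = (v == (val f).1) (+) (v == (val f).2).
    have := congr1 (fun x : {ffun _ -> _} => x v) ef; rewrite !cE.
    by do 4 case: (v == _).
  apply/val_inj; rewrite [val e]surjective_pairing [val f]surjective_pairing.
  move: (lt_e e) (lt_e f) (h (val e).1) (h (val e).2) (h (val f).1).
  move: (val e).1 (val e).2 (val f).1 (val f).2 => a b a' b' ltab ltab'.
  rewrite -!val_eqE /= !eqxx => h1 h2 h3.
  by congr (_, _); apply: val_inj => /=; lia.
apply: contraTneq (lt_e e) => /ffunP/(_ (val e).1); rewrite cE ffunE eqxx.
by case: eqP => [->|//]; rewrite ltnn.
Qed.

Lemma card_L19_edge : #|{: L19_edge}| = 19%N.
Proof.
rewrite card_sig -sum1_card big_mkcond /=.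
rewrite -(pair_bigA_idem (op := addn) _ (fun i j : 'I_7 =>
  if (i < j)%N && ((val i, val j) \notin [:: (0, 1); (0, 2)]%N) then 1%N else 0%N)) //=.
by rewrite !big_ord_recl !big_ord0.
Qed.

(** Cocircuits of the dual are cycles, of length at least 3 in a simple graph, and the rank is at
    least 19 - 6 = 13; but 13 * 3 exceeds 2 * 19. *)
Lemma L19_not_even_cycle : ~ even_cycle L19.
Proof.
set G := incidence L19_graph.
have [inj_G G0] := L19_cycle_simple.
have rG : rep (cycle_matroid L19_graph) (column G) 0%VS := rep_vector G.
move=> /even_cycleP[V [c [ec rc]]].
have rkG : (rk (cycle_matroid L19_graph) setT <= 6)%N.
  pose delta v : {ffun 'I_7 -> ('F_2)^o} := [ffun b => (b == v)%:R].
  pose g v := delta v + delta ord0.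
  have le : (sp (column G) setT <= sp g [set~ ord0])%VS.
    apply/subv_sumP => e _; rewrite -memvE.
    have g_sp x : g x \in sp g [set~ ord0].
      have [->|x0] := eqVneq x ord0; first by rewrite /g addvv mem0v.
      by rewrite memvE /sp (sumv_sup x) // !inE.
    have -> : column G e = g (val e).1 + g (val e).2.
      by rewrite addrACA addvv addr0; apply/ffunP => v; rewrite !ffunE.
    by rewrite memvD.
  rewrite (rk_spE rG) (leq_trans (dimvS le)) // (leq_trans (dim_sp_le _ _)) //.
  by rewrite cardsC1 card_ord.
have rk13 : (13 <= rk L19 setT)%N.
  by rewrite /= /dual_rk cardsT card_L19_edge; lia.
have : (#|support_vertices c| * 3 <= 2 * #|{: L19_edge}|)%N.
  apply: (star_count ec rc) => S; rewrite ltnNge; apply: contraR.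
  rewrite -ltnNge ltnS => S2.
  rewrite /= /dual_rk setCK setCT rk_set0 addn0 cardsT.
  have -> := simple_rk_card rG inj_G G0 S2.
  by rewrite addnC cardsC.
have := rk_le_support_vertices ec rc; rewrite card_L19_edge; lia.
Qed.

End NotEvenCycle.

(** * Bit masks *)

Section Masks.
Local Open Scope ring_scope.

(** Missing bits count as false and surplus bits are ignored, so masks need no padding. *)
Fixpoint comb (V : lmodType 'F_2) (m : bitseq) (s : seq V) : V :=
  match m, s with
  | b :: m', v :: s' => (if b then v else 0) + comb m' s'
  | _, _ => 0
  end.

Fixpoint xorm (m n : bitseq) : bitseq :=
  match m, n with
  | a :: m', b :: n' => (a (+) b) :: xorm m' n'
  | [::], _ => n
  | _, [::] => m
  end.

Fixpoint combm (m : bitseq) (s : seq bitseq) : bitseq :=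
  match m, s with
  | b :: m', v :: s' => xorm (if b then v else [::]) (combm m' s')
  | _, _ => [::]
  end.

Fixpoint all_masks (n : nat) : seq bitseq :=
  if n is n'.+1 then
    [seq b :: m | b <- [:: false; true], m <- all_masks n'] else [:: [::]].

Lemma mem_all_masks n (m : bitseq) : (m \in all_masks n) = (size m == n).
Proof.
elim: n m => [|n IHn] [|b m] //=; rewrite cats0 mem_cat.
- by apply/negP => /orP[] /mapP[].
rewrite eqSS -IHn; case: b.
  rewrite [X in X || _](_ : _ = false); last by apply/mapP => -[].
  by rewrite mem_map // => ? ? [].
rewrite orbC [X in X || _](_ : _ = false); last by apply/mapP => -[].
by rewrite mem_map // => ? ? [].
Qed.

Section Comb.
Variable V : vectType 'F_2.
Implicit Types (m n : bitseq) (s : seq V) (U : {vspace V}).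

Lemma comb_nil m : comb m ([::] : seq V) = 0.
Proof. by case: m. Qed.

Lemma comb_xorm m n s : comb (xorm m n) s = comb m s + comb n s.
Proof.
elim: m n s => [|a m IHm] [|b n] [|v s] //=; rewrite ?add0r ?addr0 //.
rewrite IHm addrACA; congr (_ + _).
by case: a; case: b; rewrite ?addvv ?addr0 ?add0r.
Qed.

Lemma comb_combm m (ms : seq bitseq) s :
  comb (combm m ms) s = comb m [seq comb k s | k <- ms].
Proof.
elim: m ms => [|a m IHm] [|k ms] //=.
by rewrite comb_xorm IHm; case: a.
Qed.

Lemma comb_mask m s : comb m s = \sum_(v <- mask m s) v.
Proof.
elim: m s => [|b m IHm] [|v s] /=; rewrite ?big_nil //.
by rewrite IHm; case: b; rewrite ?big_cons ?add0r.
Qed.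

Lemma comb_cat_false m k s : comb (m ++ nseq k false) s = comb m s.
Proof.
elim: m s => [|b m IHm] [|v s] //=; last by rewrite IHm.
  by case: k.
by elim: k v s => [|k IHk] v [|w s] //=; rewrite add0r ?comb_nil // IHk.
Qed.

(** The bound on the length excludes true bits that [comb] would ignore. *)
Definition indep U s :=
  forall m, (size m <= size s)%N -> comb m s \in U -> ~~ has id m.

Definition addlines U s : {vspace V} := foldl (fun W v => (W + <[v]>)%VS) U s.

Lemma mem_addlines U s v :
  reflect (exists2 m, size m = size s & v + comb m s \in U) (v \in addlines U s).
Proof.
rewrite /addlines; apply: (iffP idP).
  elim: s U v => [|w s IHs] U v /=; first by exists [::]; rewrite ?addr0.
  case/IHs => m sm; rewrite mem_add_line => /orP[] h.
    by exists (false :: m); rewrite /= ?sm // add0r.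
  exists (true :: m); rewrite /= ?sm //.
  by rewrite [w + _]addrC addrA.
elim: s U v => [|w s IHs] U v /= [[|b m]] //=; first by rewrite addr0.
case=> sm h; apply: IHs; exists m => //; rewrite mem_add_line.
case: b h; rewrite ?add0r => h; last by rewrite h.
by rewrite -addrA [_ + w]addrC h orbT.
Qed.

Lemma sub_addlines U s : (U <= addlines U s)%VS.
Proof.
rewrite /addlines; elim: s U => [|w s IHs] U //=.
exact: subv_trans (addvSl _ _) (IHs _).
Qed.

(* In a quotient by the lines of [K], the vectors [b] stay independent and each
   combination of them in [cols] is, up to the lines of [K], a combination of
   one or two vectors or one of [L]. *)
Definition config_ok (n : nat) (K b cols L : seq bitseq) : bool :=
  all (fun q => all (fun m =>
    let s := xorm (combm q K) (combm m b) in
    (size s <= n)%N && (has id s || ~~ has id m)) (all_masks (size b)))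
    (all_masks (size K)) &&
  all (fun m => has (fun q =>
    let s := xorm (combm q K) (combm m b) in
    (s \in L) || (0 < count id s <= 2)%N) (all_masks (size K))) cols.

Lemma config_indep (n : nat) K b cols L U s :
  config_ok n K b cols L -> size s = n -> indep U s ->
  indep (addlines U [seq comb k s | k <- K]) [seq comb k s | k <- b].
Proof.
case/andP => /allP ok1 _ ss ind m; rewrite size_map => sm.
case/mem_addlines => q; rewrite size_map -!comb_combm -comb_xorm => sq h.
(* [config_ok] enumerates masks of full length only, so [m] is padded. *)
pose m' := m ++ nseq (size b - size m) false.
have cm' : comb (combm m' b) s = comb (combm m b) s.
  by rewrite !comb_combm comb_cat_false.
have : m' \in all_masks (size b).
  by rewrite mem_all_masks size_cat size_nseq subnKC.
move/(allP (ok1 q _)); rewrite mem_all_masks sq eqxx => /(_ isT) /andP[sz].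
have /negPf-> /= : ~~ has id (xorm (combm q K) (combm m' b)).
  by apply: ind; rewrite ?ss // comb_xorm cm' addrC -comb_xorm.
by rewrite has_cat negb_or => /andP[].
Qed.

Lemma config_pres (n : nat) K b cols L U s (pres : V -> Prop) :
  config_ok n K b cols L ->
  (forall v w, pres v -> v + w \in addlines U [seq comb k s | k <- K] -> pres w) ->
  (forall m, (0 < count id m <= 2)%N -> pres (comb m s)) ->
  (forall m, m \in L -> pres (comb m s)) ->
  forall m, m \in cols -> pres (comb m [seq comb k s | k <- b]).
Proof.
case/andP => _ /allP ok2 presU pres2 presL m /ok2/hasP[q].
rewrite mem_all_masks => /eqP sq h; rewrite -comb_combm.
have /presU : pres (comb (xorm (combm q K) (combm m b)) s).
  by case/orP: h; [apply: presL|apply: pres2].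
apply; rewrite comb_xorm addvK; apply/mem_addlines; exists q; rewrite ?size_map //.
by rewrite comb_combm addvv mem0v.
Qed.

End Comb.
End Masks.

(** * Finding a minor modulo contracted columns *)

Section Realization.
Local Open Scope ring_scope.

Lemma map_neq0D (I : Type) (s : seq I) (x y : I -> 'F_2) :
  [seq (x i + y i) != 0 | i <- s] = xorm [seq x i != 0 | i <- s] [seq y i != 0 | i <- s].
Proof.
elim: s => //= i s ->; congr (_ :: _).
by case: (F2_cases (x i)) => ->; case: (F2_cases (y i)) => ->.
Qed.

Variables (V : vectType 'F_2) (E : finType) (M : matroid E) (c : E -> V).
Variables (U0 : {vspace V}).
Hypothesis rM : rep M c U0.
Implicit Types (U : {vspace V}) (v w : V).

(** [U] is the subspace factored out once the columns of [D] are contracted as well; in that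
    quotient, [present U v] says that [v] is a column. *)
Definition contracted U : Prop := exists D : {set E}, U = (sp c D + U0)%VS.
Definition present U v : bool := [exists e, c e + v \in U].

Lemma present_mono U W v : (U <= W)%VS -> present U v -> present W v.
Proof. by move=> /subvP UW /existsP[e /UW h]; apply/existsP; exists e. Qed.

Lemma present_eq U v w : present U v -> v + w \in U -> present U w.
Proof.
move=> /existsP[e h] vw; apply/existsP; exists e.
by rewrite -[c e](addvK _ v) -addrA memvD.
Qed.

Lemma contracted_line U v : contracted U -> present U v -> contracted (U + <[v]>)%VS.
Proof.
move=> [D UD] /existsP[e ev]; exists (e |: D).
rewrite sp_setU1 -addvA [(<[_]> + _)%VS]addvC addvA -UD; apply/vspaceP => x.
rewrite !mem_add_line; congr (_ || _).
by apply: mem_congr; rewrite addrACA addvv add0r addrC.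
Qed.

Lemma contracted_addlines U s :
  contracted U -> (forall v, v \in s -> present U v) -> contracted (addlines U s).
Proof.
rewrite /addlines; elim: s U => [|v s IHs] U //= cU ps; apply: IHs.
  by apply: contracted_line => //; apply: ps; rewrite inE eqxx.
move=> w ws; apply: (present_mono (addvSl _ _)).
by apply: ps; rewrite inE ws orbT.
Qed.

Lemma realize (F : finType) (N : matroid F) r (d : F -> {ffun 'I_r -> ('F_2)^o}) U s :
  contracted U -> rep N d 0%VS -> injective d -> (forall f, d f != 0) ->
  size s = r -> indep U s ->
  (forall f, present U (comb [seq d f i != 0 | i <- enum 'I_r] s)) ->
  has_minor M N.
Proof.
move=> [D UD] rN inj_d d0 ss ind prs.
pose phi (x : {ffun 'I_r -> ('F_2)^o}) := comb [seq x i != 0 | i <- enum 'I_r] s.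
have phiD x y : phi (x + y) = phi x + phi y.
  rewrite /phi -comb_xorm -map_neq0D; congr comb.
  by apply: eq_map => i; rewrite ffunE.
have phi0 : phi 0 = 0 by have := phiD 0 0; rewrite [RHS]addvv addr0.
have phiU x : (phi x \in U) = (x == 0).
  apply/idP/eqP => [/ind|->]; last by rewrite phi0 mem0v.
  rewrite size_map size_enum_ord ss leqnn => /(_ isT) /hasPn h.
  apply/ffunP => i; rewrite ffunE.
  by have /negPn/eqP := h _ (map_f (fun i => x i != 0) (mem_enum 'I_r i)).
have [g hg] := fin_all_exists (fun f => existsP (prs f)).
have gU f f' : (c (g f) + c (g f') \in U) = (f == f').
  rewrite -(inj_eq inj_d) -addv_eq0 -phiU phiD; apply: mem_congr.
  by rewrite addrACA memvD ?hg.
have gD f : g f \notin D.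
  apply/negP => gfD; have : c (g f) \in U.
    by rewrite UD memvE (subv_trans _ (addvSl _ _)) // /sp (sumv_sup (g f)).
  by rewrite (mem_congr (hg f)) -/(phi _) phiU (negPf (d0 f)).
apply/has_minorP; exists g, D; split=> //.
  by move=> f f' ff; apply/eqP; rewrite -gU ff addvv mem0v.
have sums (S : {set F}) : (\sum_(f in S) d f \in (0 : {vspace {ffun 'I_r -> ('F_2)^o}})%VS) =
    (\sum_(f in S) (c \o g) f \in U).
  rewrite memv0 -phiU (big_morph phi phiD phi0); apply: mem_congr.
  by rewrite addrC -big_split; apply: memv_suml => f _; apply: hg.
have rN' := rep_sums sums rN; move=> S.
have := rN' S; have := rM (g @: S :|: D); have := rM D.
rewrite -UD sp_setU sp_comp -addvA -UD; lia.
Qed.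

Hypothesis noPG : forall e : PG_ground 4, ~ has_minor M (PG32_del e).
Hypothesis noL11 : ~ has_minor M L11.

Definition PG_cols (m0 : bitseq) : seq bitseq :=
  [seq m <- all_masks 4 | has id m && (m != m0)].

(** The missing point [m0] is arbitrary, because the deletion of each point of PG(3,2) is
    excluded. *)
Lemma no_PG U s m0 :
  contracted U -> size s = 4 -> indep U s -> size m0 = 4 -> has id m0 ->
  ~ (forall m, m \in PG_cols m0 -> present U (comb m s)).
Proof.
move=> cU ss ind sm0 m0n prs.
pose r : 'rV['F_2]_4 := \row_i (nth false m0 i)%:R.
have m0E : m0 = [seq r ord0 i != 0 | i <- enum 'I_4].
  apply: (@eq_from_nth _ false) => [|i]; first by rewrite size_map size_enum_ord.
  rewrite sm0 => i4; rewrite (nth_map (Ordinal i4)) ?size_enum_ord // mxE.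
  by rewrite nth_enum_ord //; case: nth.
have r0 : r != 0.
  apply: contraTneq m0n => r0; rewrite m0E -all_predC; apply/allP => b /mapP[i _ ->].
  by rewrite r0 mxE.
have [d [inj_d d0 dr rd]] := PG32_del_simple (Sub r r0 : PG_ground 4).
apply: (noPG (realize cU rd inj_d d0 ss ind _)) => f.
apply: prs; rewrite mem_filter mem_all_masks size_map size_enum_ord eqxx andbT.
apply/andP; split.
  apply/hasP; have [i di] := ffun_neq0 (d0 f); exists true => //.
  by apply/mapP; exists i; rewrite ?mem_enum // di.
apply/eqP => mE; case: (dr f); apply/ffunP => i; rewrite ffunE /=.
move: mE; rewrite m0E => /eq_in_map/(_ i (mem_enum _ _)) h.
by rewrite -[LHS]F2_natr_bool h F2_natr_bool.
Qed.

Definition L11_cols : seq bitseq :=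
  [seq [seq odd (nth 0%N (nth [::] L11_rows i) j) | i <- iota 0 6] | j <- iota 0 11].

Lemma no_L11 U s : contracted U -> size s = 6 -> indep U s ->
  ~ (forall m, m \in L11_cols -> present U (comb m s)).
Proof.
move=> cU ss ind prs.
pose A : bmatrix 'I_6 'I_11 := fun i j => (nth 0%N (nth [::] L11_rows i) j)%:R.
have maskE j : [seq column A j i != 0 | i <- enum 'I_6] =
    [seq odd (nth 0%N (nth [::] L11_rows i) j) | i <- iota 0 6].
  rewrite -val_enum_ord -map_comp; apply: eq_map => i.
  by rewrite ffunE /A /= -natr_F2.
have cols_uniq : uniq L11_cols by vm_compute.
have colE (j : 'I_11) : [seq column A j i != 0 | i <- enum 'I_6] = nth [::] L11_cols j.
  by rewrite maskE (nth_map 0%N) ?size_iota // nth_iota.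
apply: (noL11 (realize cU (rep_vector A) _ _ ss ind _)) => [i j ij|j|j].
- apply/val_inj/eqP; rewrite -(nth_uniq [::] _ _ cols_uniq) ?size_map ?size_iota ?ltn_ord //.
  by rewrite -!colE ij.
- have /(all_nthP [::])/(_ j) : all (has id) L11_cols by vm_compute.
  rewrite size_map size_iota -colE => /(_ (ltn_ord j)).
  apply: contraTneq => ->.
  by rewrite -all_predC; apply/allP => b /mapP[i _ ->]; rewrite ffunE.
- by apply: prs; rewrite colE mem_nth // size_map size_iota.
Qed.

End Realization.

(** * Vectors attached to the vertices of a complete graph *)

Section GraphFamily.
Local Open Scope ring_scope.
Variables (V : vectType 'F_2) (E : finType) (M : matroid E) (c : E -> V).
Variables (U0 : {vspace V}).
Hypothesis rM : rep M c U0.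
Hypothesis noPG : forall e : PG_ground 4, ~ has_minor M (PG32_del e).
Hypothesis noL11 : ~ has_minor M L11.
Variables (T : finType) (t : T -> V).
Implicit Types (U : {vspace V}) (D J S : {set T}) (s : seq T).
Local Notation contracted := (contracted c U0).
Local Notation present := (present c).

(** Only even sets are tested, since they are what differences to a base vertex span; a single
    vertex may have the zero vector, as [None] will have. *)
Definition affine_indep U D : Prop :=
  forall S, S \subset D -> ~~ odd #|S| -> \sum_(i in S) t i \in U -> S = set0.

Definition complete U : Prop := forall i j, present U (t i + t j).

Definition fam U s : bool := present U (\sum_(i <- s) t i).

Lemma complete_mono U W : (U <= W)%VS -> complete U -> complete W.
Proof. by move=> UW cU i j; apply: present_mono UW _. Qed.

Lemma fam_perm U s s' : perm_eq s s' -> fam U s = fam U s'.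
Proof. by move=> ss'; rewrite /fam (perm_big _ ss'). Qed.

Lemma sum_base s p0 :
  \sum_(p <- s) (t p + t p0) = \sum_(p <- s) t p + (if odd (size s) then t p0 else 0).
Proof.
elim: s => [|p s IHs]; rewrite ?big_nil ?addr0 // !big_cons IHs /=.
by case: (odd _) => /=; [rewrite addrACA addvv|rewrite addr0 addrAC].
Qed.

(** A combination of differences to [p0] is a sum over an even set, which [p0] joins when the mask
    has odd weight. *)
Lemma comb_base m s p0 :
  comb m [seq t p + t p0 | p <- s] =
  \sum_(p <- if odd (size (mask m s)) then p0 :: mask m s else mask m s) t p.
Proof.
rewrite comb_mask -map_mask big_map sum_base; case: ifP => _; rewrite ?addr0 //.
by rewrite big_cons addrC.
Qed.

Lemma affine_indep_indep U D p0 s :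
  affine_indep U D -> uniq (p0 :: s) -> {subset p0 :: s <= D} ->
  indep U [seq t p + t p0 | p <- s].
Proof.
move=> aff us sD m; rewrite size_map comb_base; set q := mask m s => sm.
set q' := if _ then _ else _ => hU.
have uq' : uniq q'.
  move: us; rewrite /q' /= => /andP[p0s us].
  case: ifP => _; rewrite /= mask_uniq // andbT.
  by apply: contra p0s; apply: mem_mask.
have q'D : [set p in q'] \subset D.
  apply/subsetP => p; rewrite inE => pq; apply: sD; move: pq.
  rewrite /q' inE; case: ifP => _; rewrite ?inE.
    by case/orP => [->//|/mem_mask->]; rewrite orbT.
  by move/mem_mask->; rewrite orbT.
have q'0 : [set p in q'] = set0.
  apply: aff => //.
    have -> : #|[set p in q']| = size q' by rewrite cardsE; apply/card_uniqP.
    by rewrite /q'; case: ifPn => //= ->.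
  by rewrite (eq_bigl [in q']) -?big_uniq // => p; rewrite inE.
have : q = [::].
  have h p : p \in q' = false by have := in_set0 p; rewrite -q'0 inE.
  by move: h; rewrite /q'; case: (q) => // p r; case: ifP => _ /(_ p); rewrite !inE eqxx ?orbT.
rewrite /q => mq; apply/negP => mt; move: mq sm mt; clear.
by elim: m s => [|[] m IHm] [|p s] //= h sm; apply: (IHm s).
Qed.

(** Masks of weight one and two are the edges at [p0] and away from it, all present by [complete];
    only the vectors of [K] and [L] have to be supplied. *)
Lemma config_fam n U D p0 s (K b cols L : seq bitseq) :
  contracted U -> affine_indep U D -> complete U ->
  uniq (p0 :: s) -> {subset p0 :: s <= D} -> size s = n ->
  config_ok n K b cols L ->
  (forall m, m \in K ++ L ->
     fam U (if odd (size (mask m s)) then p0 :: mask m s else mask m s)) ->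
  exists W (s' : seq V), [/\ contracted W, size s' = size b, indep W s'
    & forall m, m \in cols -> present W (comb m s')].
Proof.
move=> cU aff pairs us sD sn ok fKL.
pose s1 := [seq t p + t p0 | p <- s].
have ind := affine_indep_indep aff us sD.
have pr m : m \in K ++ L -> present U (comb m s1).
  by move/fKL; rewrite /fam -comb_base.
pose W := addlines U [seq comb k s1 | k <- K].
have UW : (U <= W)%VS := sub_addlines _ _.
exists W, [seq comb k s1 | k <- b]; split.
- apply: contracted_addlines => // v /mapP[k kK ->].
  by apply: pr; rewrite mem_cat kK.
- by rewrite size_map.
- by apply: config_indep ok _ ind; rewrite size_map.
apply: (config_pres (pres := fun v => present W v) ok) => [v w|m m2|m mL].
- exact: present_eq.
- have sm : (size (mask m s) <= 2)%N.
    apply: leq_trans (proj2 (andP m2)).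
    by elim: (m) (s) => [|[] m' IHm] [|p s'] //=; rewrite ?add1n ?ltnS ?add0n.
  apply: (present_mono UW); rewrite comb_base.
  case: (mask m s) sm => [|p [|q [|]]] //= _.
  + by rewrite big_nil -(addvv (t p0)).
  + by rewrite !big_cons big_nil addr0.
  + by rewrite !big_cons big_nil addr0.
by apply: (present_mono UW); apply: pr; rewrite mem_cat mL orbT.
Qed.

Lemma config_PG n U D p0 s (K b L : seq bitseq) m0 :
  contracted U -> affine_indep U D -> complete U ->
  uniq (p0 :: s) -> {subset p0 :: s <= D} -> size s = n ->
  [&& config_ok n K b (PG_cols m0) L, size b == 4, size m0 == 4 & has id m0] ->
  ~ (forall m, m \in K ++ L ->
     fam U (if odd (size (mask m s)) then p0 :: mask m s else mask m s)).
Proof.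
move=> cU aff pairs us sD sn /and4P[ok /eqP b4 /eqP m4 m0n] h.
have [W [s' [cW s4 indW prW]]] := config_fam cU aff pairs us sD sn ok h.
by apply: (no_PG rM noPG cW _ indW m4 m0n prW); rewrite s4.
Qed.

Lemma config_L11 n U D p0 s (K b L : seq bitseq) :
  contracted U -> affine_indep U D -> complete U ->
  uniq (p0 :: s) -> {subset p0 :: s <= D} -> size s = n ->
  config_ok n K b L11_cols L && (size b == 6) ->
  ~ (forall m, m \in K ++ L ->
     fam U (if odd (size (mask m s)) then p0 :: mask m s else mask m s)).
Proof.
move=> cU aff pairs us sD sn /andP[ok /eqP b6] h.
have [W [s' [cW s6 indW prW]]] := config_fam cU aff pairs us sD sn ok h.
by apply: (no_L11 rM noL11 cW _ indW prW); rewrite s6.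
Qed.

(** * Forbidden configurations of even vertex sets *)

Section Cases.
Variables (U : {vspace V}) (D : {set T}).
Hypothesis cU : contracted U.
Hypothesis aff : affine_indep U D.
Hypothesis pairs : complete U.
Local Notation "1" := true : bool_scope.
Local Notation "0" := false : bool_scope.
Local Open Scope bool_scope.

(** Even subsets of six points modulo the whole set form a space of dimension 4, whose 15 nonzero
    classes are represented by the 15 pairs. Contracting the six-set thus turns $K_6$ into
    PG(3,2). *)
Lemma no_six a1 a2 a3 a4 a5 a6 :
  let s := [:: a1; a2; a3; a4; a5; a6] in uniq s -> {subset s <= D} ->
  ~ fam U [:: a1; a2; a3; a4; a5; a6].
Proof.
move=> s us sD h0.
refine (@config_PG 5 U D a1 [:: a2; a3; a4; a5; a6] [:: [:: 1;1;1;1;1]]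
  [:: [:: 1;0;0;0;0]; [:: 0;1;0;0;0]; [:: 0;0;1;0;0]; [:: 0;0;0;1;0]]
  [::] [:: 1;1;1;1] cU aff pairs us sD erefl _ _).
  by vm_compute.
by move=> m; rewrite /= !inE => /eqP->.
Qed.

(** Modulo both sets the seven points leave dimension 4, and each nonzero class contains a pair: 3
    classes from each of the two sets and 9 from pairs across. *)
Lemma no_meet_one a b1 b2 b3 c1 c2 c3 :
  let s := [:: a; b1; b2; b3; c1; c2; c3] in uniq s -> {subset s <= D} ->
  fam U [:: a; b1; b2; b3] -> ~ fam U [:: a; c1; c2; c3].
Proof.
move=> s us sD h0 h1.
refine (@config_PG 6 U D a [:: b1; b2; b3; c1; c2; c3] [:: [:: 1;1;1;0;0;0]; [:: 0;0;0;1;1;1]]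
  [:: [:: 1;0;0;0;0;0]; [:: 0;1;0;0;0;0]; [:: 0;0;0;1;0;0]; [:: 0;0;0;0;1;0]]
  [::] [:: 1;1;1;1] cU aff pairs us sD erefl _ _).
  by vm_compute.
by move=> m; rewrite /= !inE => /orP[] /eqP->.
Qed.

(** The third contracted vector is the edge from [b1] to [c1]. It identifies its ends, after which
    the sets share one vertex as in [no_meet_one]. *)
Lemma no_disjoint a b1 b2 b3 c1 c2 c3 c4 :
  let s := [:: a; b1; b2; b3; c1; c2; c3; c4] in uniq s -> {subset s <= D} ->
  fam U [:: a; b1; b2; b3] -> ~ fam U [:: c1; c2; c3; c4].
Proof.
move=> s us sD h0 h1.
refine (@config_PG 7 U D a [:: b1; b2; b3; c1; c2; c3; c4] [:: [:: 1;1;1;0;0;0;0]; [:: 0;0;0;1;1;1;1]; [:: 1;0;0;1;0;0;0]]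
  [:: [:: 1;0;0;0;0;0;0]; [:: 0;1;0;0;0;0;0]; [:: 0;0;0;0;1;0;0]; [:: 0;0;0;0;0;1;0]]
  [::] [:: 1;1;1;1] cU aff pairs us sD erefl _ _).
  by vm_compute.
by move=> m; rewrite /= !inE => /or3P[] /eqP-> //=; rewrite /fam !big_cons big_nil addr0.
Qed.

(** Modulo the two contracted sets the pairs on seven points give 13 of the 15 nonzero classes. The
    third set supplies a fourteenth, and [0111] is the point left out. *)
Lemma no_fano_triple a1 a2 a3 a4 a5 a6 a7 :
  let s := [:: a7; a1; a2; a3; a4; a5; a6] in uniq s -> {subset s <= D} ->
  fam U [:: a1; a2; a3; a4] -> fam U [:: a1; a2; a5; a6] -> ~ fam U [:: a7; a1; a3; a5].
Proof.
move=> s us sD h0 h1 h2.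
refine (@config_PG 6 U D a7 [:: a1; a2; a3; a4; a5; a6] [:: [:: 1;1;1;1;0;0]; [:: 1;1;0;0;1;1]]
  [:: [:: 1;0;0;0;0;0]; [:: 0;1;0;0;0;0]; [:: 0;0;1;0;0;0]; [:: 0;0;0;0;1;0]]
  [:: [:: 1;0;1;0;1;0]] [:: 0;1;1;1] cU aff pairs us sD erefl _ _).
  by vm_compute.
by move=> m; rewrite /= !inE => /or3P[] /eqP->.
Qed.

(** Nothing is contracted: the 10 pairs and 5 four-sets on five points are the 15 points of PG(3,2),
    and a single four-set is left out. *)
Lemma no_four_in_five a1 a2 a3 a4 a5 :
  let s := [:: a5; a1; a2; a3; a4] in uniq s -> {subset s <= D} ->
  fam U [:: a1; a2; a3; a4] -> fam U [:: a5; a1; a2; a3] -> fam U [:: a5; a1; a2; a4] -> ~ fam U [:: a5; a1; a3; a4].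
Proof.
move=> s us sD h0 h1 h2 h3.
refine (@config_PG 4 U D a5 [:: a1; a2; a3; a4] [::]
  [:: [:: 1;0;0;0]; [:: 0;1;0;0]; [:: 0;0;1;0]; [:: 0;0;0;1]]
  [:: [:: 1;1;1;1]; [:: 1;1;1;0]; [:: 1;1;0;1]; [:: 1;0;1;1]] [:: 0;1;1;1] cU aff pairs us sD erefl _ _).
  by vm_compute.
by move=> m; rewrite /= !inE => /or4P[] /eqP->.
Qed.

(** Contracting the last set leaves 12 classes of pairs on six points; the other two sets raise this
    to 14. *)
Lemma no_mixed_triple a1 a2 a3 a4 a5 a6 :
  let s := [:: a6; a1; a2; a3; a4; a5] in uniq s -> {subset s <= D} ->
  fam U [:: a1; a2; a3; a4] -> fam U [:: a1; a2; a3; a5] -> ~ fam U [:: a6; a1; a4; a5].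
Proof.
move=> s us sD h0 h1 h2.
refine (@config_PG 5 U D a6 [:: a1; a2; a3; a4; a5] [:: [:: 1;0;0;1;1]]
  [:: [:: 1;0;0;0;0]; [:: 0;1;0;0;0]; [:: 0;0;1;0;0]; [:: 0;0;0;1;0]]
  [:: [:: 1;1;1;1;0]; [:: 1;1;1;0;1]] [:: 1;1;1;0] cU aff pairs us sD erefl _ _).
  by vm_compute.
by move=> m; rewrite /= !inE => /or3P[] /eqP->.
Qed.

(** In the basis listed, the columns of [L11] are the three sets, whose sum is zero, and eight edges
    on the seven points. Four of these edges end at [a7], a point off all three sets. *)
Lemma no_pair_cover a1 a2 a3 a4 a5 a6 a7 :
  let s := [:: a7; a1; a2; a3; a4; a5; a6] in uniq s -> {subset s <= D} ->
  fam U [:: a1; a2; a3; a4] -> fam U [:: a1; a2; a5; a6] -> ~ fam U [:: a3; a4; a5; a6].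
Proof.
move=> s us sD h0 h1 h2.
refine (@config_L11 6 U D a7 [:: a1; a2; a3; a4; a5; a6] [::]
  [:: [:: 1;1;1;1;0;0]; [:: 1;1;0;0;1;1]; [:: 1;0;0;0;0;0]; [:: 0;1;0;0;0;0]; [:: 0;1;0;0;1;0]; [:: 0;0;1;0;0;0]]
  [:: [:: 1;1;1;1;0;0]; [:: 1;1;0;0;1;1]; [:: 0;0;1;1;1;1]] cU aff pairs us sD erefl _ _).
  by vm_compute.
by move=> m; rewrite /= !inE => /or3P[] /eqP->.
Qed.

End Cases.

Ltac perm_lia :=
  apply/permP => p /=;
  repeat match goal with |- context [nat_of_bool ?b] =>
    generalize (nat_of_bool b) end; clear; intros; lia.

Lemma card_setI_seq J J' s :
  uniq s -> J' =i s -> #|J :&: J'| = count [in J] s.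
Proof.
move=> us J's; rewrite -size_filter -(card_uniqP _) ?filter_uniq //.
by apply: eq_card => p; rewrite mem_filter !inE J's.
Qed.

Lemma venn_enum J J' : exists s0 s1 s2 : seq T,
  [/\ uniq (s0 ++ s1 ++ s2), J =i s0 ++ s1, J' =i s0 ++ s2
    & [/\ size s0 = #|J :&: J'|, size s1 = #|J :\: J'| & size s2 = #|J' :\: J|]].
Proof.
exists (enum (J :&: J')), (enum (J :\: J')), (enum (J' :\: J)).
split; rewrite -?cardE //.
- rewrite !cat_uniq !enum_uniq /= andbT; apply/andP; split; last first.
    apply/hasPn => p; rewrite !mem_enum !inE.
    by case: (p \in J); rewrite ?andbF.
  apply/hasPn => p; rewrite mem_cat !mem_enum !inE.
  by case: (p \in J); case: (p \in J').
- by move=> p; rewrite mem_cat !mem_enum !inE; case: (p \in J); case: (p \in J').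
by move=> p; rewrite mem_cat !mem_enum !inE; case: (p \in J); case: (p \in J').
Qed.

Definition present_set U J : bool := present U (\sum_(i in J) t i).

Lemma fam_present_set U s J : uniq s -> J =i s -> fam U s = present_set U J.
Proof.
by move=> us Js; rewrite /fam big_uniq //; congr present; apply: eq_bigl => p; rewrite Js.
Qed.

(** * Families of present four-element sets *)

Section FourSets.
Variables (U : {vspace V}) (D : {set T}).
Hypothesis cU : contracted U.
Hypothesis aff : affine_indep U D.
Hypothesis pairs : complete U.

Definition four_sets : {set {set T}} :=
  [set J : {set T} | [&& J \subset D, #|J| == 4 & present_set U J]].

Lemma four_setP J x1 x2 x3 x4 : J \in four_sets -> uniq [:: x1; x2; x3; x4] ->
  x1 \in J -> x2 \in J -> x3 \in J -> x4 \in J -> fam U [:: x1; x2; x3; x4].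
Proof.
rewrite inE => /and3P[_ /eqP J4 pJ] us xJ1 xJ2 xJ3 xJ4.
have sJ : {subset [:: x1; x2; x3; x4] <= enum J}.
  by move=> q; rewrite mem_enum !inE => /or4P[] /eqP->.
have [_ e] := uniq_min_size us sJ (eq_leq (etrans (esym (cardE _)) J4)).
by rewrite (fam_present_set _ us (J := J)) // => p; rewrite e mem_enum.
Qed.

Lemma four_sets_meet J J' : J \in four_sets -> J' \in four_sets -> (1 < #|J :&: J'|)%N.
Proof.
move=> JF JF'; have := JF; have := JF'.
rewrite !inE => /and3P[/subsetP J'D /eqP J'4 pJ'] /and3P[/subsetP JD /eqP J4 pJ].
have [s0 [s1 [s2 [us Js J's [z0 z1 z2]]]]] := venn_enum J J'.
have e1 : (size s0 + size s1 = 4)%N by rewrite z0 z1 cardsID.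
have e2 : (size s0 + size s2 = 4)%N by rewrite z0 z2 setIC cardsID.
rewrite -z0.
have sD : {subset s0 ++ s1 ++ s2 <= D}.
  move=> p; rewrite !mem_cat => /or3P[] h.
  - by apply: JD; rewrite Js mem_cat h.
  - by apply: JD; rewrite Js mem_cat h orbT.
  - by apply: J'D; rewrite J's mem_cat h orbT.
rewrite -(fam_present_set _ _ Js) in pJ; last by apply: subseq_uniq us; rewrite cat_subseq ?prefix_subseq.
rewrite -(fam_present_set _ _ J's) in pJ'; last first.
  by apply: subseq_uniq us; rewrite cat_subseq ?suffix_subseq.
case: s0 us sD pJ pJ' e1 e2 {Js J's z0 z1 z2} => [|a [|//]] us sD pJ pJ' e1 e2.
  case: s1 e1 us sD pJ => [|b1 [|b2 [|b3 [|b4 []]]]] //= _ us sD pJ.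
  case: s2 e2 us sD pJ' => [|c1 [|c2 [|c3 [|c4 []]]]] //= _ us sD pJ'.
  by case: (no_disjoint cU aff pairs us sD pJ pJ').
case: s1 e1 us sD pJ => [|b1 [|b2 [|b3 []]]] //= _ us sD pJ.
case: s2 e2 us sD pJ' => [|c1 [|c2 [|c3 []]]] //= _ us sD pJ'.
by case: (no_meet_one cU aff pairs us sD pJ pJ').
Qed.

Lemma uniq_sub s s' r : uniq s' -> perm_eq (s ++ r) s' -> uniq s.
Proof. by move=> us /perm_uniq; rewrite us cat_uniq => /andP[]. Qed.

(** If [J3] contains [x4] or [x6], it meets one of the two sets in three points, which is excluded
    by [no_mixed_triple]. Otherwise its fourth point [y] is new, which is excluded by
    [no_fano_triple]. *)
Lemma four_sets_split J3 x1 x2 x3 x4 x5 x6 :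
  let s := [:: x1; x2; x3; x4; x5; x6] in uniq s -> {subset s <= D} ->
  fam U [:: x1; x2; x3; x4] -> fam U [:: x1; x2; x5; x6] ->
  J3 \in four_sets -> x1 \in J3 -> x2 \notin J3 -> x3 \in J3 -> x5 \in J3 -> False.
Proof.
move=> s us sD h1 h2 J3F x1J x2J x3J x5J.
have sub s' : perm_eq s' s -> {subset s' <= D} by move=> /perm_mem e p; rewrite e; apply: sD.
have [x4J|x4J] := boolP (x4 \in J3).
  apply: (no_mixed_triple cU aff pairs (a1 := x1) (a2 := x3) (a3 := x4) (a4 := x2)
            (a5 := x5) (a6 := x6)).
  - by apply: (uniq_sub (r := [::]) us); perm_lia.
  - by apply: sub; perm_lia.
  - by rewrite (fam_perm _ (s' := [:: x1; x2; x3; x4])) //; perm_lia.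
  - apply: (four_setP J3F) => //.
    by apply: (uniq_sub (r := [:: x2; x6]) us); perm_lia.
  by rewrite (fam_perm _ (s' := [:: x1; x2; x5; x6])) //; perm_lia.
have [x6J|x6J] := boolP (x6 \in J3).
  apply: (no_mixed_triple cU aff pairs (a1 := x1) (a2 := x5) (a3 := x6) (a4 := x2)
            (a5 := x3) (a6 := x4)).
  - by apply: (uniq_sub (r := [::]) us); perm_lia.
  - by apply: sub; perm_lia.
  - by rewrite (fam_perm _ (s' := [:: x1; x2; x5; x6])) //; perm_lia.
  - apply: (four_setP J3F) => //.
    by apply: (uniq_sub (r := [:: x2; x4]) us); perm_lia.
  by rewrite (fam_perm _ (s' := [:: x1; x2; x3; x4])) //; perm_lia.
have := J3F; rewrite inE => /and3P[/subsetP J3D /eqP J34 _].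
have [y yJ ys] : exists2 y, y \in J3 & y \notin s.
  have cs : #|[set p in s] :&: J3| = 3.
    rewrite setIC (card_setI_seq _ us) => [|p]; last by rewrite inE.
    by rewrite /= x1J (negPf x2J) x3J (negPf x4J) x5J (negPf x6J).
  have : (0 < #|J3 :\: [set p in s]|)%N.
    by have := cardsID [set p in s] J3; rewrite setIC cs J34; lia.
  by case/card_gt0P => y; rewrite !inE => /andP[ys yJ]; exists y; rewrite ?inE.
have us7 : uniq (y :: s) by rewrite /= ys.
apply: (no_fano_triple cU aff pairs us7 _ h1 h2).
  by move=> p; rewrite inE => /predU1P[->|/sD//]; apply: J3D.
apply: (four_setP J3F) => //.
by apply: (uniq_sub (r := [:: x2; x4; x6]) us7); perm_lia.
Qed.

Lemma four_sets_five x1 x2 x3 x4 x5 :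
  let s := [:: x1; x2; x3; x4; x5] in uniq s -> {subset s <= D} ->
  fam U [:: x1; x2; x3; x4] -> fam U [:: x1; x2; x3; x5] ->
  fam U [:: x1; x2; x4; x5] -> ~ fam U [:: x1; x3; x4; x5].
Proof.
move=> s us sD h1 h2 h3 h4.
apply: (no_four_in_five cU aff pairs (a1 := x1) (a2 := x2) (a3 := x3) (a4 := x4) (a5 := x5)) => //.
- by apply: (uniq_sub (r := [::]) us); perm_lia.
- have e : perm_eq [:: x5; x1; x2; x3; x4] s by perm_lia.
  by move=> p; rewrite (perm_mem e); apply: sD.
- by rewrite (fam_perm _ (s' := [:: x1; x2; x3; x5])) //; perm_lia.
- by rewrite (fam_perm _ (s' := [:: x1; x2; x4; x5])) //; perm_lia.
by rewrite (fam_perm _ (s' := [:: x1; x3; x4; x5])) //; perm_lia.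
Qed.

(** If two sets meet in exactly two points, these form the pair: a set containing just one of them
    is excluded by [four_sets_split], and a set containing neither is the symmetric difference,
    which yields L11. Otherwise any two sets meet in three points; a set missing one of the points
    common to [J1] and [J2] lies in their union, and two sets missing different ones would give four
    of the five four-sets on five points. *)
Lemma four_sets_common_pair :
  (6 < #|D|)%N -> four_sets != set0 ->
  exists a b, a != b /\ forall J, J \in four_sets -> (a \in J) && (b \in J).
Proof.
move=> D7 F0.
have sub_D J p : J \in four_sets -> p \in J -> p \in D.
  by rewrite inE => /and3P[/subsetP JD _ _]; apply: JD.
have card4 J : J \in four_sets -> #|J| = 4.
  by rewrite inE => /and3P[_ /eqP].
case: (pickP [pred J | [&& J.1 \in four_sets, J.2 \in four_sets & #|J.1 :&: J.2| == 2]]).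
  case=> J1 J2 /= /and3P[J1F J2F m12].
  have [s0 [s1 [s2 [us J1s J2s [z0 z1 z2]]]]] := venn_enum J1 J2.
  have e1 : (size s0 + size s1 = 4)%N by rewrite z0 z1 cardsID card4.
  have e2 : (size s0 + size s2 = 4)%N by rewrite z0 z2 setIC cardsID card4.
  rewrite (eqP m12) in z0.
  case: s0 z0 us J1s J2s e1 e2 => [|x1 [|x2 []]] //= _ us J1s J2s e1 e2.
  case: s1 e1 us J1s {z1} => [|x3 [|x4 []]] //= _ us J1s.
  case: s2 e2 us J2s {z2} => [|x5 [|x6 []]] //= _ us J2s.
  have {}us : uniq [:: x1; x2; x3; x4; x5; x6] := us.
  have x12 : x1 != x2 by move: us; rewrite /= inE negb_or => /andP[/andP[]].
  have sD : {subset [:: x1; x2; x3; x4; x5; x6] <= D}.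
    move=> p hp; have [pJ|pJ] := boolP (p \in J1); first exact: sub_D J1F pJ.
    apply: (sub_D _ _ J2F); rewrite J2s; move: hp pJ; rewrite J1s !inE.
    by do 6 case: (p == _).
  have h1 : fam U [:: x1; x2; x3; x4].
    rewrite (fam_present_set _ _ J1s); first by move: J1F; rewrite inE => /and3P[].
    by apply: (uniq_sub (r := [:: x5; x6]) us); perm_lia.
  have h2 : fam U [:: x1; x2; x5; x6].
    rewrite (fam_present_set _ _ J2s); first by move: J2F; rewrite inE => /and3P[].
    by apply: (uniq_sub (r := [:: x3; x4]) us); perm_lia.
  exists x1, x2; split=> // J JF; apply/negPn/negP => nJ.
  have := four_sets_meet J1F JF; rewrite setIC (card_setI_seq _ _ J1s) => [/= m1|]; last first.
    by apply: (uniq_sub (r := [:: x5; x6]) us); perm_lia.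
  have := four_sets_meet J2F JF; rewrite setIC (card_setI_seq _ _ J2s) => [/= m2|]; last first.
    by apply: (uniq_sub (r := [:: x3; x4]) us); perm_lia.
  have split1 y1 y2 y3 y4 y5 y6 :
      perm_eq [:: y1; y2; y3; y4; y5; y6] [:: x1; x2; x3; x4; x5; x6] ->
      fam U [:: y1; y2; y3; y4] -> fam U [:: y1; y2; y5; y6] ->
      y1 \in J -> y2 \notin J -> y3 \in J -> y5 \in J -> False.
    move=> e g1 g2 i1 i2 i3 i5.
    refine (four_sets_split _ _ g1 g2 JF i1 i2 i3 i5); first by rewrite (perm_uniq e).
    by move=> p; rewrite (perm_mem e); apply: sD.
  have fp s s' : fam U s -> perm_eq s s' -> fam U s' by move=> fs /(fam_perm U) <-.
  (* [J] meets both sets in at least two points, so if it misses [x1] and [x2] it consists of the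
     other four; otherwise [y] is the one it contains. *)
  have [y [y' [ys yJ y'J]]] : exists y y', [/\ (y, y') \in [:: (x1, x2); (x2, x1)],
      y' \notin J & (y \in J) || (y \notin J) && (x3 \in J) && (x4 \in J) && (x5 \in J) && (x6 \in J)].
    move: nJ m1 m2; have [i1|i1] := boolP (x1 \in J); have [i2|i2] := boolP (x2 \in J) => //= _ m1 m2.
    - by exists x1, x2; rewrite !inE eqxx i1.
    - by exists x2, x1; rewrite !inE eqxx i2 orbT.
    exists x1, x2; split=> //; first by rewrite !inE eqxx.
    by move: m1 m2 i1 i2; do 6 case: (_ \in J).
  have f1 : fam U [:: y; y'; x3; x4].
    by move: ys; rewrite !inE !xpair_eqE => /orP[]/andP[/eqP-> /eqP->] //; apply: (fp _ _ h1); perm_lia.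
  have f2 : fam U [:: y; y'; x5; x6].
    by move: ys; rewrite !inE !xpair_eqE => /orP[]/andP[/eqP-> /eqP->] //; apply: (fp _ _ h2); perm_lia.
  have e : perm_eq [:: y; y'; x3; x4; x5; x6] [:: x1; x2; x3; x4; x5; x6].
    by move: ys; rewrite !inE !xpair_eqE => /orP[]/andP[/eqP-> /eqP->] //; perm_lia.
  case/orP: y'J => [yinJ|/andP[/andP[/andP[/andP[yJ' j3] j4] j5] j6]].
    have m1' : (x3 \in J) || (x4 \in J).
      by move: m1 ys yJ; rewrite !inE !xpair_eqE => h /orP[]/andP[_ /eqP->] /negPf nj;
        move: h; rewrite nj; do 3 case: (_ \in J).
    have m2' : (x5 \in J) || (x6 \in J).
      by move: m2 ys yJ; rewrite !inE !xpair_eqE => h /orP[]/andP[_ /eqP->] /negPf nj;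
        move: h; rewrite nj; do 3 case: (_ \in J).
    have g1 : fam U [:: y; y'; x4; x3] by apply: (fp _ _ f1); perm_lia.
    have g2 : fam U [:: y; y'; x6; x5] by apply: (fp _ _ f2); perm_lia.
    case/orP: m1' => j3; case/orP: m2' => j5.
    - exact: (split1 y y' x3 x4 x5 x6).
    - by apply: (split1 y y' x3 x4 x6 x5) => //; apply: perm_trans e; perm_lia.
    - by apply: (split1 y y' x4 x3 x5 x6) => //; apply: perm_trans e; perm_lia.
    - by apply: (split1 y y' x4 x3 x6 x5) => //; apply: perm_trans e; perm_lia.
  (* Here more than six vertices are used: [z] is the vertex off all three sets. *)
  have [z zD zs] : exists2 z, z \in D & z \notin [:: x1; x2; x3; x4; x5; x6].
    have : ~~ (D \subset [:: x1; x2; x3; x4; x5; x6]).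
      by apply/negP => /subset_leq_card; rewrite (card_uniqP us) leqNgt D7.
    by case/subsetPn => z; exists z.
  apply: (no_pair_cover cU aff pairs (a7 := z) _ _ h1 h2).
  - by rewrite /= zs.
  - by move=> p; rewrite inE => /predU1P[->|/sD].
  apply: (four_setP JF) => //.
  by apply: (uniq_sub (r := [:: x1; x2]) us); perm_lia.
move=> no2; have meet3 J J' : J \in four_sets -> J' \in four_sets -> (2 < #|J :&: J'|)%N.
  move=> JF JF'; rewrite ltn_neqAle four_sets_meet // andbT eq_sym.
  by have := no2 (J, J'); rewrite /= JF JF' => /= ->.
have [J1 J1F] := set0Pn _ F0.
case: (pickP [pred J | (J \in four_sets) && (J != J1)]) => [J2 /= /andP[J2F J21]|only]; last first.
  have : (1 < #|J1|)%N by rewrite card4.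
  case/card_gt1P => x1 [x2 [x1J x2J x12]]; exists x1, x2; split=> // J JF.
  by have := only J; rewrite /= JF => /negPn/eqP->; rewrite x1J x2J.
have [s0 [s1 [s2 [us J1s J2s [z0 z1 z2]]]]] := venn_enum J1 J2.
have e1 : (size s0 + size s1 = 4)%N by rewrite z0 z1 cardsID card4.
have e2 : (size s0 + size s2 = 4)%N by rewrite z0 z2 setIC cardsID card4.
have z3 : size s0 = 3.
  have := meet3 _ _ J1F J2F; rewrite -z0.
  have : size s2 != 0%N.
    rewrite z2 cards_eq0 setD_eq0; apply: contra J21 => sJ.
    by rewrite eqEcard sJ !card4.
  by move: e1 e2; case: (size s2) => // n; lia.
rewrite z3 in e1 e2.
case: s0 z3 us J1s J2s {z0} => [|x1 [|x2 [|x3 []]]] //= _ us J1s J2s.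
case: s1 e1 us J1s {z1} => [|x4 []] //= _ us J1s.
case: s2 e2 us J2s {z2} => [|x5 []] //= _ us J2s.
have {}us : uniq [:: x1; x2; x3; x4; x5] := us.
have sD : {subset [:: x1; x2; x3; x4; x5] <= D}.
  move=> p hp; have [pJ|pJ] := boolP (p \in J1); first exact: sub_D J1F pJ.
  apply: (sub_D _ _ J2F); rewrite J2s; move: hp pJ; rewrite J1s !inE.
  by do 5 case: (p == _).
have u1 : uniq [:: x1; x2; x3; x4] by apply: (uniq_sub (r := [:: x5]) us); perm_lia.
have u2 : uniq [:: x1; x2; x3; x5] by apply: (uniq_sub (r := [:: x4]) us); perm_lia.
have h1 : fam U [:: x1; x2; x3; x4].
  by rewrite (fam_present_set _ u1 J1s); move: J1F; rewrite inE => /and3P[].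
have h2 : fam U [:: x1; x2; x3; x5].
  by rewrite (fam_present_set _ u2 J2s); move: J2F; rewrite inE => /and3P[].
have bits J : J \in four_sets ->
    (2 < (x1 \in J) + ((x2 \in J) + ((x3 \in J) + (x4 \in J))))%N /\
    (2 < (x1 \in J) + ((x2 \in J) + ((x3 \in J) + (x5 \in J))))%N.
  move=> JF; split.
    by have := meet3 _ _ J1F JF; rewrite setIC (card_setI_seq _ u1 J1s) /= !addn0.
  by have := meet3 _ _ J2F JF; rewrite setIC (card_setI_seq _ u2 J2s) /= !addn0.
(* Given intersections of size three with both sets, one missing common point determines the whole
   set. *)
have K12 J : J \in four_sets -> x3 \notin J -> fam U [:: x1; x2; x4; x5].
  move=> JF n3; have [] := bits J JF => b1 b2; apply: (four_setP JF).
  - by apply: (uniq_sub (r := [:: x3]) us); perm_lia.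
  - by move: n3 b1 b2; do 5 case: (_ \in J).
  - by move: n3 b1 b2; do 5 case: (_ \in J).
  - by move: n3 b1 b2; do 5 case: (_ \in J).
  - by move: n3 b1 b2; do 5 case: (_ \in J).
have K13 J : J \in four_sets -> x2 \notin J -> fam U [:: x1; x3; x4; x5].
  move=> JF n3; have [] := bits J JF => b1 b2; apply: (four_setP JF).
  - by apply: (uniq_sub (r := [:: x2]) us); perm_lia.
  - by move: n3 b1 b2; do 5 case: (_ \in J).
  - by move: n3 b1 b2; do 5 case: (_ \in J).
  - by move: n3 b1 b2; do 5 case: (_ \in J).
  - by move: n3 b1 b2; do 5 case: (_ \in J).
have K23 J : J \in four_sets -> x1 \notin J -> fam U [:: x2; x3; x4; x5].
  move=> JF n3; have [] := bits J JF => b1 b2; apply: (four_setP JF).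
  - by apply: (uniq_sub (r := [:: x1]) us); perm_lia.
  - by move: n3 b1 b2; do 5 case: (_ \in J).
  - by move: n3 b1 b2; do 5 case: (_ \in J).
  - by move: n3 b1 b2; do 5 case: (_ \in J).
  - by move: n3 b1 b2; do 5 case: (_ \in J).
have fp s s' : fam U s -> perm_eq s s' -> fam U s' by move=> fs /(fam_perm U) <-.
have bad12_13 : fam U [:: x1; x2; x4; x5] -> ~ fam U [:: x1; x3; x4; x5].
  exact: four_sets_five us sD h1 h2.
have five y1 y2 y3 : perm_eq [:: y1; y2; y3] [:: x1; x2; x3] ->
    fam U [:: y1; y2; x4; x5] -> ~ fam U [:: y1; y3; x4; x5].
  move=> e; have e5 : perm_eq [:: y1; y2; y3; x4; x5] [:: x1; x2; x3; x4; x5].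
    by rewrite -(perm_cat2r [:: x4; x5]) in e.
  apply: four_sets_five.
  - by rewrite (perm_uniq e5).
  - by move=> p; rewrite (perm_mem e5); apply: sD.
  - by apply: (fp _ _ h1); rewrite perm_sym -(perm_cat2r [:: x4]) in e *.
  - by apply: (fp _ _ h2); rewrite perm_sym -(perm_cat2r [:: x5]) in e *.
have common a b : a != b -> (forall J, J \in four_sets -> a \in J) ->
    (forall J, J \in four_sets -> b \in J) ->
    exists a b, a != b /\ forall J, J \in four_sets -> (a \in J) && (b \in J).
  by move=> ab ha hb; exists a, b; split=> // J JF; rewrite ha ?hb.
have dec a : (forall J, J \in four_sets -> a \in J) \/
    (exists2 J, J \in four_sets & a \notin J).
  case: (pickP [pred J | (J \in four_sets) && (a \notin J)]) => [J /andP[JF aJ]|h].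
    by right; exists J.
  by left=> J JF; have := h J; rewrite /= JF => /negbFE.
have /andP[/norP[x12 /norP[x13 _]] /andP[/norP[x23 _] _]] := us.
(* At most one of [x1], [x2], [x3] is missed by some set; the other two are the common pair. *)
case: (dec x1) => [a1|[J /K23 h /h k23]].
  case: (dec x2) => [a2|[J /K13 h /h k13]]; first exact: common x12 a1 a2.
  case: (dec x3) => [a3|[J' /K12 h' /h' k12]]; first exact: common x13 a1 a3.
  by case: (bad12_13 k12 k13).
case: (dec x2) => [a2|[J' /K13 h' /h' k13]].
  case: (dec x3) => [a3|[J' /K12 h' /h' k12]]; first exact: common x23 a2 a3.
  case: (five x2 x1 x3 _ _ k23); first by perm_lia.
  by apply: (fp _ _ k12); perm_lia.
case: (five x3 x1 x2); first by perm_lia.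
  by apply: (fp _ _ k13); perm_lia.
by apply: (fp _ _ k23); perm_lia.
Qed.

End FourSets.

Lemma odd_symdiff (S S' : {set T}) :
  odd #|(S :\: S') :|: (S' :\: S)| = odd #|S| (+) odd #|S'|.
Proof.
rewrite cardsU (_ : _ :&: _ = set0); last first.
  by apply/setP => p; rewrite !inE; case: (p \in S); case: (p \in S').
rewrite cards0 subn0 oddD -(cardsID S' S) -(cardsID S S') !oddD setIC.
by case: (odd _); case: (odd _); case: (odd _).
Qed.

(** Contracting the edge from [a] to [b] identifies its ends, and [b] remains to represent both. *)
Lemma affine_merge U D a b : affine_indep U D -> a \in D -> b \in D -> a != b ->
  affine_indep (U + <[t a + t b]>)%VS (D :\ a).
Proof.
move=> aff aD bD ab S SD oS; have SD' := subset_trans SD (subsetDl _ _).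
rewrite mem_add_line => /orP[|]; first exact: aff.
have -> : t a + t b = \sum_(i in [set a; b]) t i.
  by rewrite big_setU1 ?big_set1 ?inE.
rewrite sumv_symdiff => h.
have := in_set0 a; rewrite -(aff _ _ _ h) ?odd_symdiff ?(negPf oS) ?cards2 ?ab //.
  have /negPf aS : a \notin S by apply/negP => /(subsetP SD); rewrite !inE eqxx.
  by rewrite !inE eqxx aS.
apply/subsetP => p; rewrite !inE => /orP[]/andP[h1 h2]; first exact: (subsetP SD').
by case/orP: h2 => /eqP->.
Qed.

Lemma set_remove2 (J : {set T}) a b : a \in J -> b \in J -> a != b ->
  #|J| = #|J :\ a :\ b|.+2 /\ \sum_(i in J) t i = t a + t b + \sum_(i in J :\ a :\ b) t i.
Proof.
move=> aJ bJ ab; have bJ' : b \in J :\ a by rewrite !inE eq_sym ab.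
rewrite (cardsD1 a J) aJ (cardsD1 b (J :\ a)) bJ'; split=> //.
by rewrite (big_setD1 a) //= (big_setD1 b) //= addrA.
Qed.

(** Contracting an edge inside [J] removes its two ends from the sum, so the size drops by two until
    six vertices remain. *)
Lemma no_large_even U D J :
  contracted U -> affine_indep U D -> complete U ->
  J \subset D -> ~~ odd #|J| -> (5 < #|J|)%N -> ~ present_set U J.
Proof.
have [n] := ubnP #|J|; elim: n => // n IHn in U D J * => Jn cU aff pairs JD oJ J5 pJ.
have JE : J =i enum J by move=> p; rewrite mem_enum.
have uJ := enum_uniq J; have sJ := cardE J.
case: (enum J) uJ sJ JE => [|a [|b [|x3 [|x4 [|x5 [|x6 s]]]]]] uJ sJ JE;
  try by rewrite sJ in J5.
have [s0|s0] := eqVneq s [::].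
  rewrite {}s0 in uJ sJ JE.
  apply: (no_six cU aff pairs uJ); last by rewrite (fam_present_set _ uJ JE).
  by move=> p; rewrite -JE; apply: (subsetP JD).
have aJ : a \in J by rewrite JE !inE eqxx.
have bJ : b \in J by rewrite JE !inE eqxx orbT.
have ab : a != b by move: uJ; rewrite /= inE negb_or => /andP[/andP[]].
have [cJ sumJ] := set_remove2 aJ bJ ab.
have UU : (U <= U + <[t a + t b]>)%VS by rewrite addvSl.
apply: (IHn (U + <[t a + t b]>)%VS (D :\ a) (J :\ a :\ b)).
- by rewrite cJ in Jn; lia.
- exact: contracted_line.
- by apply: affine_merge => //; apply: (subsetP JD).
- exact: complete_mono pairs.
- by rewrite (subset_trans (subsetDl _ _)) // setSD.
- by move: oJ; rewrite cJ /= negbK.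
- by move: sJ oJ s0; rewrite cJ /= => -[->]; case: (s) => [|y [|y' s']].
apply: present_eq (present_mono UU pJ) _.
by rewrite sumJ addrAC -addrA addvv addr0 memvE addvSr.
Qed.

(** * Complete graphs with every edge doubled by a vector [x] *)

Section Doubled.
Variable x : V.

Definition doubled U : Prop := forall i j, present U (t i + t j + x).

Lemma doubled_mono U W : (U <= W)%VS -> doubled U -> doubled W.
Proof. by move=> UW dU i j; apply: present_mono UW _. Qed.

Lemma comb_three_bits p0 p1 p2 p3 m : size m = 3 -> m != nseq 3 true ->
  exists i j, comb m [seq t p + t p0 | p <- [:: p1; p2; p3]] = t i + t j.
Proof.
move=> sm m1; rewrite comb_base.
case: m sm m1 => [|b1 [|b2 [|b3 []]]] // _.
by case: b1; case: b2; case: b3 => //= _; rewrite ?big_cons ?big_nil ?addr0;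
  do ?[by exists p0, p1|by exists p0, p2|by exists p0, p3
      |by exists p1, p2|by exists p1, p3|by exists p2, p3
      |by exists p0, p0; rewrite addvv].
Qed.

(* The doubled [K_4] on [J] together with [x] and the sum of [J] has 14
   elements. *)
Lemma no_doubled_four U D J :
  contracted U -> x \notin U -> affine_indep (U + <[x]>)%VS D ->
  complete U -> doubled U -> present U x ->
  J \subset D -> #|J| = 4 ->
  ~ present (U + <[x]>)%VS (\sum_(i in J) t i).
Proof.
move=> cU xU aff pairs dbl px JD J4 pJ.
have JE : J =i enum J by move=> p; rewrite mem_enum.
have uJ := enum_uniq J; have sJ := cardE J; rewrite J4 in sJ.
have sumJ : \sum_(i in J) t i = \sum_(i <- enum J) t i by rewrite big_uniq // (eq_bigl _ _ JE).
rewrite sumJ in pJ.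
case: (enum J) uJ sJ JE pJ {sumJ} => [|p0 [|p1 [|p2 [|p3 []]]]] // uJ _ JE pJ.
pose s := [seq t p + t p0 | p <- [:: p1; p2; p3]].
have sD : {subset [:: p0; p1; p2; p3] <= D} by move=> p; rewrite -JE; apply: (subsetP JD).
have ind := affine_indep_indep aff uJ sD.
have ind' : indep U (x :: s).
  case=> [|b m] //= sm; rewrite ltnS in sm => h.
  have : comb m s \in (U + <[x]>)%VS.
    by rewrite mem_add_line; move: h; case: b; rewrite ?add0r 1?addrC => ->; rewrite ?orbT.
  move=> /(ind _ sm) nm; rewrite negb_or nm andbT; apply/negP => b1; case/negP: xU.
  suff s0 : comb m s = 0 by move: h; rewrite b1 s0 addr0.
  have : comb m s \in (0 : {vspace V})%VS; last by rewrite memv0 => /eqP.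
  clear -nm; move: s; elim: m nm => [|[] m IHm] // nm [|v s] /=; rewrite ?mem0v //.
  by rewrite add0r IHm.
have s111 : comb [:: true; true; true] s = \sum_(i <- [:: p0; p1; p2; p3]) t i.
  by rewrite comb_base.
(* Presence modulo [x] means that the sum of [J] is present either as it stands or with [x] added.
   The bit [b] says which, and the other one is the point left out of PG(3,2). *)
have [b pb] : exists b : bool, present U (comb [:: b; true; true; true] (x :: s)).
  have [e ev] := existsP pJ; move: ev; rewrite mem_add_line -s111 => /orP[ev|ev].
    by exists false; apply/existsP; exists e; rewrite [comb _ _]add0r.
  by exists true; apply/existsP; exists e; rewrite /= [x + _]addrC addrA.
apply: (no_PG rM noPG cU (s := x :: s) (m0 := [:: ~~ b; true; true; true])) => // [|m].
  by rewrite /= orbT.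
rewrite mem_filter mem_all_masks => /andP[/andP[hm mb] /eqP].
case: m hm mb => [|b' m] //= hm mb [sm].
have [m1|m1] := eqVneq m (nseq 3 true).
  by move: hm mb pb; rewrite m1 /=; case: b; case: b'.
have [i [j mE]] := comb_three_bits p0 p1 p2 p3 sm m1.
rewrite -/s in mE; rewrite mE; case: b' hm mb => hm mb; rewrite ?add0r.
  by rewrite addrC.
exact: pairs.
Qed.

(** Edges inside [J] are contracted down to four vertices. [x] survives each contraction because
    affine independence modulo [x] keeps it different from the contracted edge. *)
Lemma no_doubled_even U D J :
  contracted U -> x \notin U -> affine_indep (U + <[x]>)%VS D ->
  complete U -> doubled U -> present U x ->
  J \subset D -> ~~ odd #|J| -> (3 < #|J|)%N ->
  ~ present (U + <[x]>)%VS (\sum_(i in J) t i).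
Proof.
have [n] := ubnP #|J|; elim: n => // n IHn in U D J *.
move=> Jn cU xU aff pairs dbl px JD oJ J3 pJ.
have [J4|J4] := eqVneq #|J| 4; first exact: (no_doubled_four cU xU aff pairs dbl px JD J4).
have /card_gt1P[a [b [aJ bJ ab]]] : (1 < #|J|)%N by lia.
have [cJ sumJ] := set_remove2 aJ bJ ab.
have UU : (U <= U + <[t a + t b]>)%VS by rewrite addvSl.
have UxC : (U + <[t a + t b]> + <[x]> = U + <[x]> + <[t a + t b]>)%VS.
  by rewrite -!addvA [(<[x]> + _)%VS]addvC.
have aD := subsetP JD a aJ; have bD := subsetP JD b bJ.
apply: (IHn (U + <[t a + t b]>)%VS (D :\ a) (J :\ a :\ b)).
- by rewrite cJ in Jn; lia.
- exact: contracted_line.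
- rewrite mem_add_line (negPf xU) /=; apply/negP => h.
  have := aff [set a; b]; rewrite cards2 ab big_setU1 ?inE //= big_set1.
  rewrite mem_add_line [_ + x]addrC h orbT subUset !sub1set aD bD.
  by move=> /(_ isT isT isT)/setP/(_ a); rewrite !inE eqxx.
- by rewrite UxC; apply: affine_merge.
- exact: complete_mono pairs.
- exact: doubled_mono dbl.
- exact: present_mono px.
- by rewrite (subset_trans (subsetDl _ _)) // setSD.
- by move: oJ; rewrite cJ /= negbK.
- by move: oJ J4 J3; rewrite cJ; case: #|_| => [|[|[|[|k]]]].
rewrite UxC; apply: present_eq (present_mono (addvSl _ _) pJ) _.
by rewrite sumJ addrAC -addrA addvv addr0 memvE addvSr.
Qed.

End Doubled.
End GraphFamily.

(** * Templates *)

Section TestMatrix.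
Local Open Scope ring_scope.
Variables (Phi : template) (P : finType) (delta : P -> {ffun tcols Phi -> 'F_2}).
Hypothesis deltaP : forall p, delta p \in tDelta Phi.

Lemma template0 : (0 : {ffun tX Phi -> 'F_2}) \in tLambda Phi.
Proof. by have [] := tLambda_group Phi. Qed.

(** All frame columns on the rows [P]: the set is the support in [P], the vector the part in the
    rows [X]. *)
Definition frame_column : finType :=
  {sl : {set P} * {ffun tX Phi -> 'F_2} |
    (#|sl.1| <= 2)%N && (sl.2 \in tLambda Phi)}.

(** The left summand is $Z$: one column for each row of [P] and each partner in $Y_1$. *)
Definition test_column : finType := (P * tY1 Phi + frame_column)%type.

Definition test_respecting : bmatrix (tX Phi + P)%type (tcols Phi + test_column)%type :=
  fun b e => match e, b with
  | inl y, inl x => tA1 x y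
  | inl y, inr p => delta p y
  | inr (inl pj), inl _ => 0
  | inr (inl pj), inr p => (p == pj.1)%:R
  | inr (inr sl), inl x => (val sl).2 x
  | inr (inr sl), inr p => (p \in (val sl).1)%:R
  end.

Definition test_matrix : bmatrix (tX Phi + P)%type (tcols Phi + test_column)%type :=
  fun b e => if e is inr (inl pj) then
    test_respecting b e + test_respecting b (inl (inl (inr pj.2)))
  else test_respecting b e.

Lemma test_matrix_conforms : matrix_conforms test_matrix.
Proof.
exists test_respecting, [set q | if q is inl _ then true else false]; split=> //.
- split=> //.
  + case=> [[p j]|sl]; rewrite inE // => _; split=> //.
    by exists p.
  + case=> [?|sl]; rewrite inE // => _; have /andP[c2 _] := valP sl.
    apply: leq_trans c2; apply/subset_leq_card/subsetP => p; rewrite inE /=.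
    by case: (p \in _); rewrite ?eqxx.
  + case=> [?|sl]; rewrite inE // => _; have /andP[_ h] := valP sl.
    by rewrite (_ : [ffun _ => _] = (val sl).2) //; apply/ffunP => x; rewrite ffunE.
  + move=> p; rewrite (_ : [ffun _ => _] = delta p) //.
    by apply/ffunP => x; rewrite ffunE.
- by move=> b [?|sl]; rewrite inE.
by case=> [[p j]|sl]; rewrite inE // => _; exists j.
Qed.

Definition test_matroid :=
  minor (vector_matroid test_matrix) (C_cols Phi test_column) (Y1_cols Phi test_column).

Lemma test_matroid_conforms : conforms Phi test_matroid.
Proof.
exists P, test_column, test_matrix; split; first exact: test_matrix_conforms.
exact: rk_matroid_iso.
Qed.

Definition test_family
    (e : minor_ground (C_cols Phi test_column) (Y1_cols Phi test_column)) :=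
  column test_matrix (val e).
Definition test_base := (sp (column test_matrix) (C_cols Phi test_column) + 0)%VS.

Lemma test_rep : rep test_matroid test_family test_base.
Proof.
exact: rep_minor_emb (rep_vector _) (minor_emb_val _ _ _).
Qed.

Lemma test_element (q : test_column) :
  inr q \notin C_cols Phi test_column :|: Y1_cols Phi test_column.
Proof. by rewrite !inE; apply/norP; split; apply/imsetP => -[]. Qed.

Lemma test_element0 (y : tY0 Phi) :
  inl (inl (inl y)) \notin C_cols Phi test_column :|: Y1_cols Phi test_column.
Proof. by rewrite !inE; apply/norP; split; apply/imsetP => -[]. Qed.

Definition vec (w : {ffun tX Phi -> ('F_2)^o}) (s : {ffun P -> ('F_2)^o}) :
    {ffun (tX Phi + P)%type -> ('F_2)^o} :=
  [ffun b => match b with inl x => w x | inr p => s p end].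

Definition indic (S : {set P}) : {ffun P -> ('F_2)^o} := [ffun p => (p \in S)%:R].

Lemma vecD w s w' s' : vec w s + vec w' s' = vec (w + w') (s + s').
Proof. by apply/ffunP => -[x|p]; rewrite !ffunE. Qed.

Lemma vec0 : vec 0 0 = 0.
Proof. by apply/ffunP => -[x|p]; rewrite !ffunE. Qed.

Definition tcol (y : tcols Phi) : {ffun tX Phi -> ('F_2)^o} := [ffun x => tA1 x y].
Definition dcol (y : tcols Phi) : {ffun P -> ('F_2)^o} := [ffun p => delta p y].

Implicit Types U : {vspace {ffun (tX Phi + P)%type -> ('F_2)^o}}.

Lemma present_frame U (l : {ffun tX Phi -> ('F_2)^o}) (S : {set P}) :
  l \in tLambda Phi -> (#|S| <= 2)%N -> present test_family U (vec l (indic S)).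
Proof.
move=> lL S2; have hP : (#|(S, l).1| <= 2)%N && ((S, l).2 \in tLambda Phi).
  by rewrite /= lL S2.
pose q : frame_column := Sub (S, l) hP.
apply/existsP; exists (exist _ (inr (inr q)) (test_element (inr q))).
rewrite (_ : test_family _ = vec l (indic S)) ?addvv ?mem0v //.
by apply/ffunP => -[x|p]; rewrite !ffunE.
Qed.

Lemma present_Z U (p : P) (j : tY1 Phi) :
  present test_family U (vec (tcol (inl (inr j))) (dcol (inl (inr j)) + indic [set p])).
Proof.
apply/existsP; exists (exist _ (inr (inl (p, j))) (test_element (inl (p, j)))).
rewrite (_ : test_family _ = vec (tcol (inl (inr j))) (dcol (inl (inr j)) + indic [set p]))
  ?addvv ?mem0v //.
apply/ffunP => -[x|p']; rewrite !ffunE /test_matrix /=; first by rewrite add0r.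
by rewrite addrC inE.
Qed.

Lemma present_Y0 U (y : tY0 Phi) :
  present test_family U (vec (tcol (inl (inl y))) (dcol (inl (inl y)))).
Proof.
apply/existsP; exists (exist _ (inl (inl (inl y))) (test_element0 y)).
rewrite (_ : test_family _ = vec (tcol (inl (inl y))) (dcol (inl (inl y)))) ?addvv ?mem0v //.
by apply/ffunP => -[x|p]; rewrite !ffunE.
Qed.

Lemma mem_sp_base (V : vectType 'F_2) (E : finType) (c : E -> V) (S : {set E})
    (U : {vspace V}) (K : V -> Prop) :
  K 0 -> (forall v w, K v -> K w -> K (v + w)) -> (forall e, e \in S -> K (c e)) ->
  (forall u, u \in U -> K u) -> forall v, v \in (sp c S + U)%VS -> K v.
Proof.
move=> K0 KD Kc KU v /mem_spP[T sT vU].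
rewrite -[v](addvK _ (\sum_(e in T) c e)); apply: (KD); first exact: KU.
by elim/big_rec: _ => [|e x eT Kx]; [|apply: KD => //; apply/Kc/(subsetP sT)].
Qed.

Lemma test_base_ind (K : {ffun (tX Phi + P)%type -> ('F_2)^o} -> Prop) :
  K 0 -> (forall v w, K v -> K w -> K (v + w)) ->
  (forall y : tC Phi, K (vec (tcol (inr y)) (dcol (inr y)))) ->
  forall v, v \in test_base -> K v.
Proof.
move=> K0 KD Kc; apply: mem_sp_base => // [e|u]; last by rewrite memv0 => /eqP->.
case/imsetP => y _ ->.
rewrite (_ : column _ _ = vec (tcol (inr y)) (dcol (inr y))) //.
by apply/ffunP => -[x|p]; rewrite !ffunE.
Qed.

Lemma mem_test_base (y : tC Phi) : vec (tcol (inr y)) (dcol (inr y)) \in test_base.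
Proof.
rewrite (_ : vec _ _ = column test_matrix (inl (inr y))); last first.
  by apply/ffunP => -[x|p]; rewrite !ffunE.
by rewrite /test_base addv0 memvE /sp (sumv_sup (inl (inr y))) // imset_f // inE.
Qed.

End TestMatrix.

(** * Constraints on Lambda and Delta *)

Section TemplateConstraints.
Local Open Scope ring_scope.
Variable Phi : template.
Local Notation W := {ffun tX Phi -> ('F_2)^o}.

Definition spanC : {vspace W} := sp (fun y : tC Phi => tcol (inr y)) setT.

Lemma lambda_add (l1 l2 : W) : l1 \in tLambda Phi -> l2 \in tLambda Phi ->
  l1 + l2 \in tLambda Phi.
Proof.
have [_ sub] := tLambda_group Phi; move=> h1 h2.
by have := sub _ _ h1 h2; rewrite (oppv (l2 : W)).
Qed.

Lemma delta0 : (0 : {ffun tcols Phi -> 'F_2}) \in tDelta Phi.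
Proof. by have [] := tDelta_group Phi. Qed.

Definition no_delta (P : finType) (p : P) : {ffun tcols Phi -> 'F_2} := 0.

Lemma dcol_no_delta (P : finType) y : dcol (@no_delta P) y = 0.
Proof. by apply/ffunP => p; rewrite !ffunE. Qed.

Lemma mem_test_base_no_delta (P : finType) v :
  v \in test_base (@no_delta P) <-> exists2 w, w \in spanC & v = vec w 0.
Proof.
split=> [|[w wC ->]].
  move: v; apply: test_base_ind => [|_ _ [w wC ->] [w' wC' ->]|y].
  - by exists 0; rewrite ?mem0v ?vec0.
  - by exists (w + w'); rewrite ?memvD // vecD addr0.
  exists (tcol (inr y)); last by rewrite dcol_no_delta.
  by rewrite memvE /spanC /sp (sumv_sup y).
rewrite -[spanC]addv0 in wC; move: w wC.
apply: mem_sp_base => [|w w' hw hw'|y _|u]; first by rewrite vec0 mem0v.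
- by have := memvD hw hw'; rewrite vecD addr0.
- by have := mem_test_base (@no_delta P) y; rewrite dcol_no_delta.
by rewrite memv0 => /eqP->; rewrite vec0 mem0v.
Qed.

(** With zero rows from Delta the columns of $C$ vanish on [P], so contracting them affects only the
    rows [X]. *)
Lemma vec_no_delta (P : finType) w (s : {ffun P -> ('F_2)^o}) :
  (vec w s \in test_base (@no_delta P)) = (w \in spanC) && (s == 0).
Proof.
apply/idP/andP => [/mem_test_base_no_delta[w' wC e]|[wC /eqP->]]; last first.
  by apply/mem_test_base_no_delta; exists w.
have -> : w = w' by apply/ffunP => x; have /ffunP/(_ (inl x)) := e; rewrite !ffunE.
by split=> //; apply/eqP/ffunP => p; have /ffunP/(_ (inr p)) := e; rewrite !ffunE.
Qed.

Hypothesis noPG : forall (E : finType) (M : matroid E), conforms Phi M ->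
  forall e : PG_ground 4, ~ has_minor M (PG32_del e).
Hypothesis noL11 : forall (E : finType) (M : matroid E), conforms Phi M ->
  ~ has_minor M L11.

Lemma no_delta_in (P : finType) (p : P) : no_delta p \in tDelta Phi.
Proof. exact: delta0. Qed.

Lemma contracted_base (P : finType) (delta : P -> {ffun tcols Phi -> 'F_2}) :
  contracted (test_family delta) (test_base delta) (test_base delta).
Proof. by exists set0; rewrite sp_set0 add0v. Qed.

(** With only two rows in [P], every subset of them is the support of a frame column. The
    combinations of [l1], [l2] and the two unit vectors are thus all present and would form
    PG(3,2). *)
Lemma lambda_dim (l1 l2 : W) : l1 \in tLambda Phi -> l2 \in tLambda Phi ->
  l1 \notin spanC -> l2 \in (spanC + <[l1]>)%VS.
Proof.
move=> l1L l2L l1C; apply/negPn/negP => l2C.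
have dP := @no_delta_in 'I_2.
pose e (i : 'I_2) : {ffun 'I_2 -> ('F_2)^o} := indic [set i].
pose s : seq {ffun (tX Phi + 'I_2)%type -> ('F_2)^o} :=
  [:: vec l1 0; vec l2 0; vec 0 (e ord0); vec 0 (e ord_max)].
have combE b1 b2 b3 b4 : comb [:: b1; b2; b3; b4] s =
    vec ((if b1 then l1 else 0) + (if b2 then l2 else 0))
        (indic [set i : 'I_2 | if i == ord0 then b3 else b4]).
  apply/ffunP => -[x|i]; rewrite /s /= !addr0 !ffunE.
    by case: b1; case: b2; case: b3; case: b4; rewrite ?ffunE ?addr0 ?add0r.
  rewrite inE; have [->|->] : i = ord0 \/ i = ord_max.
    by case: i => -[|[|]] // ?; [left|right]; apply: val_inj.
    by case: b1; case: b2; case: b3; case: b4; rewrite ?ffunE ?inE ?addr0 ?add0r.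
  by case: b1; case: b2; case: b3; case: b4; rewrite ?ffunE ?inE ?addr0 ?add0r.
have := no_PG (test_rep (@no_delta 'I_2)) (noPG (test_matroid_conforms dP)) (contracted_base _)
          (s := s) (m0 := nseq 4 true).
apply=> //.
- move=> m; rewrite /= => sm; pose m' := m ++ nseq (4 - size m) false.
  have sm' : size m' = 4 by rewrite size_cat size_nseq subnKC.
  rewrite -(comb_cat_false m (4 - size m)) -/m'.
  suff : comb m' s \in test_base (@no_delta 'I_2) -> ~~ has id m'.
    by move=> h /h; rewrite has_cat negb_or => /andP[].
  case: m' sm' => [|b1 [|b2 [|b3 [|b4 []]]]] // _.
  rewrite combE vec_no_delta => /andP[hl /eqP/ffunP he].
  have := he ord0; have := he ord_max; rewrite !ffunE !inE /=.
  case: b4 {he} => //; case: b3 => // _ _.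
  move: l1C l2C hl; rewrite mem_add_line negb_or => n1 /andP[n2 n12].
  by case: b1; case: b2; rewrite ?addr0 ?add0r //= 1?addrC ?(negPf n1) ?(negPf n2) ?(negPf n12).
move=> m; rewrite mem_filter mem_all_masks => /andP[_ /eqP].
case: m => [|b1 [|b2 [|b3 [|b4 []]]]] // _; rewrite combE.
apply: present_frame => //.
  have l0 := template0 Phi.
  by apply: lambda_add; [case: b1|case: b2].
by rewrite (leq_trans (max_card _)) ?card_ord.
Qed.

Lemma addlines_ind (V : vectType 'F_2) (U : {vspace V}) (s : seq V) (K : V -> Prop) :
  (forall v w, K v -> K w -> K (v + w)) -> (forall e, e \in s -> K e) ->
  (forall u, u \in U -> K u) -> forall v, v \in addlines U s -> K v.
Proof.
rewrite /addlines => KD; elim: s U => [|v s IHs] U Ks KU //=.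
apply: IHs => [e es|u]; first by apply: Ks; rewrite inE es orbT.
rewrite mem_add_line => /orP[/KU //|/KU h].
by rewrite -[u](addvK _ v); apply: KD => //; apply: Ks; rewrite inE eqxx.
Qed.

Lemma mem_addlines_line (V : vectType 'F_2) (U : {vspace V}) (s : seq V) v :
  v \in s -> v \in addlines U s.
Proof.
rewrite /addlines; elim: s U => [|w s IHs] U //=; rewrite inE => /predU1P[->|/IHs//].
apply: (subvP (sub_addlines _ _)); by rewrite memvE addvSr.
Qed.

(** Suppose [phi] sums to 1 on [w0]. Let the rows below [4 + b] carry [phi], and contract all
    columns of the template. The columns of [w0] sum to a vector of Lambda together with the
    indicator [dv] of those rows, so frame columns can be complemented within these rows. Subsets of
    the rows 0 to 3 with at most two elements are frame columns, and the larger ones have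
    complements with at most two elements, so all points of PG(3,2) appear. *)
Lemma delta_vanish (phi : {ffun tcols Phi -> 'F_2}) (w : {set tcols Phi}) :
  phi \in tDelta Phi -> \sum_(y in w) tcol y \in tLambda Phi ->
  \sum_(y in w) phi y = 0.
Proof.
move=> phiD wL; apply/eqP/negPn/negP; rewrite F2_neq0 => /eqP phiw.
(* [b] records whether some zero sum of columns of $A_1$ has [phi]-sum 1. In that case [dv] itself
   falls into the contracted space, and row 4 keeps the unit vectors of rows 0 to 3 independent. *)
have [b [w0 [w0L phiw0 bP]]] : exists (b : bool) (w0 : {set tcols Phi}),
  [/\ \sum_(y in w0) tcol y \in tLambda Phi, \sum_(y in w0) phi y = 1
    & ~~ b -> forall w' : {set tcols Phi}, \sum_(y in w') tcol y = 0 ->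
        \sum_(y in w') phi y = 0].
  case: (pickP [pred w' : {set tcols Phi} |
      (\sum_(y in w') tcol y == 0) && (\sum_(y in w') phi y != 0)]) => [w'|h].
    rewrite /= F2_neq0 => /andP[/eqP w'0 /eqP phiw'].
    by exists true, w'; rewrite w'0; split=> //; apply: template0.
  exists false, w; split=> // _ w' w'0; apply/eqP/negPn/negP => n0.
  by have := h w'; rewrite /= w'0 eqxx n0.
pose dv : {ffun 'I_6 -> ('F_2)^o} := [ffun p : 'I_6 => (p < 4 + b)%N%:R].
pose delta (p : 'I_6) : {ffun tcols Phi -> 'F_2} := if (p < 4 + b)%N then phi else 0.
have deltaP p : delta p \in tDelta Phi by rewrite /delta; case: ifP => _; [|apply: delta0].
have dcolE y : dcol delta y = (phi y : 'F_2) *: dv.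
  apply/ffunP => p; rewrite !ffunE /delta; case: (p < 4 + b)%N; rewrite ?ffunE ?scaler0 //.
  by rewrite [RHS]mulr1.
(* Row 5 does not carry [phi]. Contracting its unit column makes a column of $Z$ in that row equal
   to its partner in $Y_1$, which can thereby be contracted although $Y_1$ itself is deleted. *)
pose e5 : {ffun (tX Phi + 'I_6)%type -> ('F_2)^o} := vec 0 (indic [set ord_max]).
pose U1 := (test_base delta + <[e5]>)%VS.
pose cols := [seq vec (tcol (inl y)) (dcol delta (inl y)) | y : tY0 Phi + tY1 Phi].
pose U := addlines U1 cols.
have p5 : present (test_family delta) (test_base delta) e5.
  by apply: present_frame; [apply: template0|rewrite cards1].
have cU : contracted (test_family delta) (test_base delta) U.
  apply: contracted_addlines => [|v /mapP[y _ ->]].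
    exact: contracted_line (contracted_base _) p5.
  case: y => y; first exact: present_Y0.
  apply: present_eq (present_Z _ _ ord_max y) _.
  by rewrite vecD addvv addrAC addvv add0r memvE addvSr.
have e5U : e5 \in U.
  by apply: (subvP (sub_addlines _ _)); rewrite memvE addvSr.
have colU y : vec (tcol y) (dcol delta y) \in U.
  case: y => y; last first.
    apply: (subvP (sub_addlines _ _)); apply: (subvP (addvSl _ _)).
    exact: mem_test_base.
  by apply: mem_addlines_line; apply: (image_f (fun y => vec (tcol (inl y)) (dcol delta (inl y)))).
pose vsum (w : {set tcols Phi}) := vec (\sum_(y in w) tcol y) ((\sum_(y in w) phi y : 'F_2) *: dv).
have vsumE (w' : {set tcols Phi}) : vsum w' = \sum_(y in w') vec (tcol y) (dcol delta y).
  rewrite /vsum; elim/big_rec3: _ => [|y a b' c' _ <-]; first by rewrite scale0r vec0.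
  by rewrite vecD dcolE scalerDl.
have Uind v : v \in U -> exists (w' : {set tcols Phi}) (k : bool),
    v = vsum w' + (if k then e5 else 0).
  move: v; apply: addlines_ind => [v v' [w1 [k1 ->]] [w2 [k2 ->]]|v /mapP[y _ ->]|v].
  - exists ((w1 :\: w2) :|: (w2 :\: w1)), (k1 (+) k2).
    rewrite addrACA !vsumE sumv_symdiff; congr (_ + _).
    by case: k1; case: k2; rewrite ?addvv ?addr0 ?add0r.
  - by exists [set inl y], false; rewrite vsumE big_set1 addr0.
  rewrite mem_add_line => h.
  have {}h : exists2 k : bool, true & v + (if k then e5 else 0) \in test_base delta.
    by case/orP: h => h; [exists false; rewrite ?addr0|exists true].
  have [k _ hk] := h; rewrite -[v](addvK _ (if k then e5 else 0)).
  move: hk; move: (v + _) => u uB.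
  have [w' ->] : exists w', u = vsum w'.
    move: u uB; apply: test_base_ind => [|_ _ [w1 ->] [w2 ->]|y].
    - by exists set0; rewrite vsumE big_set0.
    - by exists ((w1 :\: w2) :|: (w2 :\: w1)); rewrite !vsumE sumv_symdiff.
    by exists [set inr y]; rewrite vsumE big_set1.
  by exists w', k.
pose s : seq {ffun (tX Phi + 'I_6)%type -> ('F_2)^o} :=
  [seq vec 0 (indic [set inord i]) | i <- iota 0 4].
have combE m : size m = 4 -> comb m s = vec 0 [ffun p : 'I_6 => (nth false m p)%:R].
  move=> sm; apply/ffunP => -[x|p].
    rewrite !ffunE; case: m sm => [|b1 [|b2 [|b3 [|b4 []]]]] // _; rewrite /s /= !ffunE.
    by case: b1; case: b2; case: b3; case: b4; rewrite !ffunE ?addr0.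
  rewrite !ffunE; case: m sm => [|b1 [|b2 [|b3 [|b4 []]]]] // _; rewrite /s /= !ffunE.
  have vE (k : bool) i : (i < 6)%N -> ((if k then vec 0 (indic [set inord i]) else 0 :
      {ffun (tX Phi + 'I_6)%type -> ('F_2)^o}) (inr p)) = (k && (p == i :> nat))%:R.
    by move=> i6; case: k; rewrite !ffunE // inE -val_eqE /= inordK.
  rewrite !vE //; clear vE; case: p => -[|[|[|[|[|[|k]]]]]] //= _;
    by case: b1; case: b2; case: b3; case: b4; rewrite ?addr0 ?add0r.
have := no_PG (test_rep delta) (noPG (test_matroid_conforms deltaP)) cU
          (s := s) (m0 := nseq 4 true).
apply=> //.
- move=> m; rewrite size_map size_iota => sm; pose m' := m ++ nseq (4 - size m) false.
  have sm' : size m' = 4 by rewrite size_cat size_nseq subnKC.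
  rewrite -(comb_cat_false m (4 - size m)) -/m'.
  suff : comb m' s \in U -> ~~ has id m'.
    by move=> h /h; rewrite has_cat negb_or => /andP[].
  rewrite combE // => /Uind[w' [k e]].
  have w'0 : \sum_(y in w') tcol y = 0.
    apply/ffunP => x; have /ffunP/(_ (inl x)) := e; rewrite [in RHS]ffunE !ffunE => ->.
    by case: k {e}; rewrite ?ffunE addr0.
  have ep (p : 'I_6) : (nth false m' p)%:R =
      (\sum_(y in w') phi y : 'F_2) * (p < 4 + b)%N%:R + (k && (p == 5 :> nat))%:R.
    have /ffunP/(_ (inr p)) := e; rewrite !ffunE => ->; congr (_ + _).
    by case: (k); rewrite !ffunE // inE -val_eqE.
  have m'4 i : (4 <= i)%N -> nth false m' i = false.
    by move=> i4; rewrite nth_default ?sm'.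
  have k0 : k = false.
    have := ep ord_max; rewrite m'4 //= ltnNge -[5]/(4 + 1)%N leq_add2l.
    by case: (b); case: (k); rewrite ?mulr0 ?add0r ?eqxx.
  have phi0 : \sum_(y in w') phi y = 0.
    move: bP; case b1: b => bP; last exact: bP.
    have := ep (inord 4); rewrite !inordK // m'4 // k0 b1 /=.
    by rewrite mulr1 addr0 => <-.
  apply/negP => /(has_nthP false)[i]; rewrite sm' => i4 mi.
  have i6 : (i < 6)%N by lia.
  by have := ep (Ordinal i6); rewrite /= mi phi0 k0 mul0r addr0.
move=> m; rewrite mem_filter mem_all_masks => /andP[_ /eqP sm]; rewrite combE //.
have cardE (f : nat -> bool) : #|[set p : 'I_6 | f p]| =
    (f 0 + (f 1 + (f 2 + (f 3 + (f 4 + f 5)))))%N.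
  rewrite -sum1_card big_mkcond /= (eq_bigr (fun p : 'I_6 => f p : nat)).
    by rewrite !big_ord_recl big_ord0 /= addn0.
  by move=> p _; rewrite inE; case: (f p).
have [m2|m2] := leqP (count id m) 2.
  rewrite (_ : [ffun _ => _] = indic [set p : 'I_6 | nth false m p]); last first.
    by apply/ffunP => p; rewrite !ffunE inE.
  apply: present_frame; first exact: template0.
  by rewrite cardE; move: m2; case: m sm => [|b1 [|b2 [|b3 [|b4 []]]]].
(* Sets of three or four rows are complemented within the rows of [dv], at the cost of the Lambda
   part of [w0]. *)
apply: (present_eq (v := vec (\sum_(y in w0) tcol y)
    (indic [set p : 'I_6 | (p < 4 + b)%N && ~~ nth false m p]))).
  apply: present_frame => //.
  rewrite (cardE (fun p => (p < 4 + b)%N && ~~ nth false m p)).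
  move: m2; case: m sm => [|b1 [|b2 [|b3 [|b4 []]]]] //= _.
  by case: (b); case: b1; case: b2; case: b3; case: b4.
rewrite vecD addr0 (_ : _ + _ = (1 : 'F_2) *: dv); last first.
  apply/ffunP => p; rewrite !ffunE inE [RHS]mul1r.
  have [p4|p4] := ltnP p (4 + b); first by case: (nth _ _ _); rewrite ?addr0 ?add0r.
  by rewrite nth_default ?sm ?addr0 // (leq_trans (leq_addr b 4)).
by rewrite -phiw0 -/(vsum w0) vsumE memv_suml.
Qed.

End TemplateConstraints.

Lemma maximal_indep (V : vectType 'F_2) (E : finType) (c : E -> V) (U : {vspace V}) :
  exists O : {set E},
    (forall S : {set E}, S \subset O -> (\sum_(e in S) c e)%R \in U -> S = set0) /\
    (sp c setT + U <= sp c O + U)%VS.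
Proof.
pose ind (O : {set E}) :=
  [forall S : {set E}, (S \subset O) && ((\sum_(e in S) c e)%R \in U) ==> (S == set0)].
have indP (O : {set E}) : reflect
    (forall S : {set E}, S \subset O -> (\sum_(e in S) c e)%R \in U -> S = set0) (ind O).
  apply: (iffP forallP) => h S; last by apply/implyP => /andP[SO /(h S SO)->].
  by move=> SO SU; have := h S; rewrite SO SU => /eqP.
have ind0 : ind set0 by apply/indP => S; rewrite subset0 => /eqP.
have [O indO maxO] := @arg_maxnP _ set0 ind (fun O => #|O|) ind0.
exists O; split; first exact/indP.
rewrite subv_add addvSr andbT; apply/subv_sumP => e _; rewrite -memvE.
have [eO|eO] := boolP (e \in O).
  by apply: (subvP (addvSl _ _)); rewrite memvE /sp (sumv_sup e).
have : ~~ ind (e |: O) by apply: contraL (leqnn #|O|) => /maxO; rewrite /= cardsU1 eO -ltnNge.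
rewrite negb_forall => /existsP[S]; rewrite negb_imply => /andP[/andP[SO SU] S0].
have eS : e \in S.
  apply: contraNT S0 => eS; apply/eqP; apply: (indP O indO) => //.
  apply/subsetP => f fS; have := subsetP SO f fS; rewrite !inE => /predU1P[fe|//].
  by rewrite fe (negPf eS) in fS.
apply/mem_spP; exists (S :\ e); last by rewrite (big_setD1 e) in SU.
apply/subsetP => f; rewrite !inE => /andP[fe /(subsetP SO)].
by rewrite !inE (negPf fe).
Qed.

(** * A normal form for templates *)

Section FrameForm.
Local Open Scope ring_scope.

Lemma sum_indicator (T : finType) (S : {set T}) y :
  \sum_(z in S) (z == y)%:R = (y \in S)%:R :> 'F_2.
Proof.
have [yS|yS] := boolP (y \in S).
  by rewrite (bigD1 y) //= eqxx big1 ?addr0 // => z /andP[_ /negPf->].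
by rewrite big1 // => z zS; case: eqP => // zy; rewrite -zy zS in yS.
Qed.

Variable Phi : template.
Local Notation W := {ffun tX Phi -> ('F_2)^o}.
Local Notation Y1 := (tY1 Phi).
Local Notation P := (Y1 + 'I_8)%type.
Local Notation T := (option Y1 + 'I_8)%type.
Local Notation V := {ffun (tX Phi + P)%type -> ('F_2)^o}.
Local Notation base := (test_base (@no_delta Phi P)).
Local Notation spanC := (spanC Phi).

Definition y1col (z : option Y1) : W := if z is Some j then tcol (inl (inr j)) else 0.

(** The zero vertex [None] makes the columns of $Y_1$ themselves edges. The eight extra rows are
    vertices independent of the template: they complete odd sets to even ones and guarantee more
    than six vertices. *)
Definition vertex (z : T) : V :=
  match z with inl z => vec (y1col z) 0 | inr k => vec 0 (indic [set inr k]) end.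

Definition vertex_rows (z : T) : {set P} :=
  match z with
  | inl None => set0 | inl (Some j) => [set inl j] | inr k => [set inr k]
  end.

(* Contracting the column of [Z] with unit entry in row [j] and partner [j] in
   [Y_1] makes that row behave as column [j] of [Y_1]. *)
Definition mainU : {vspace V} :=
  addlines base [seq vec (y1col (Some j)) (indic [set inl j]) | j : Y1].

Lemma indicD (S S' : {set P}) :
  indic S + indic S' = indic ((S :\: S') :|: (S' :\: S)).
Proof.
apply/ffunP => p; rewrite !ffunE !inE.
by case: (p \in S); case: (p \in S'); rewrite ?addF2 ?addr0 ?add0r.
Qed.

Lemma vertex_vertex_rows z : vertex z + vec 0 (indic (vertex_rows z)) \in mainU.
Proof.
case: z => [[j|]|k] /=; last by rewrite addvv mem0v.
  by rewrite vecD addr0 add0r; apply: mem_addlines_line; apply/imageP; exists j.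
by rewrite vecD addr0 add0r (_ : indic _ = 0) ?vec0 ?mem0v //; apply/ffunP => p; rewrite !ffunE inE.
Qed.

Lemma contracted_mainU : contracted (test_family (@no_delta Phi P)) base mainU.
Proof.
apply: contracted_addlines => [|v /imageP[j _ ->]]; first exact: contracted_base.
by have := present_Z (@no_delta Phi P) base (inl j) j; rewrite dcol_no_delta add0r.
Qed.

Lemma mainU_lin (v : V) : v \in mainU -> exists (S : {set Y1}) (u : W),
  u \in spanC /\ v = vec (u + \sum_(j in S) y1col (Some j)) (indic [set inl j | j in S]).
Proof.
move: v; apply: addlines_ind => [v v' [S [u [uC ->]]] [S' [u' [uC' ->]]]|v /imageP[j _ ->]|v].
- exists ((S :\: S') :|: (S' :\: S)), (u + u'); split; first exact: memvD.
  rewrite vecD addrACA sumv_symdiff indicD; congr (vec _ (indic _)).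
  have inl_inj : injective (inl : Y1 -> P) by move=> ? ? [].
  have nr (R : {set Y1}) k : (inr k \in [set (inl j : P) | j in R]) = false.
    by apply/imsetP => -[].
  by apply/setP => -[j|k]; rewrite !inE ?nr // !(mem_imset _ _ inl_inj) !inE.
- by exists [set j], 0; rewrite mem0v big_set1 add0r imset_set1.
move/mem_test_base_no_delta => [w wC ->]; exists set0, w.
rewrite big_set0 addr0 imset0; split=> //; congr (vec _ _).
by apply/ffunP => p; rewrite !ffunE inE.
Qed.

(** Each column contracted beyond $C$ has an entry in a row of its own, so a combination vanishing
    on [P] uses none of them. *)
Lemma vec_mainU w : (vec w 0 \in mainU) = (w \in spanC).
Proof.
apply/idP/idP => [/mainU_lin[S [u [uC e]]]|wC]; last first.
  apply: (subvP (sub_addlines _ _)); apply/mem_test_base_no_delta; by exists w.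
have S0 : S = set0.
  apply/setP => j; rewrite inE; apply/negP => jS.
  by have /ffunP/(_ (inr (inl j))) := e; rewrite !ffunE imset_f.
suff -> : w = u by [].
by apply/ffunP => x; have /ffunP/(_ (inl x)) := e; rewrite S0 big_set0 addr0 !ffunE.
Qed.

Lemma vec_mainU_line w x :
  (vec w 0 \in (mainU + <[vec x 0%R : V]>)%VS) = (w \in (spanC + <[x]>)%VS).
Proof. by rewrite !mem_add_line vecD addr0 !vec_mainU. Qed.

(** Modulo [mainU] a vertex is a vector with at most one entry in [P], so two of them sum to the
    support of a frame column, to which any vector of Lambda can be attached. *)
Lemma present_vertices (l : W) z z' : l \in tLambda Phi ->
  present (test_family (@no_delta Phi P)) mainU (vertex z + vertex z' + vec l 0).
Proof.
move=> lL; apply: (present_eq (v := vec l (indic (vertex_rows z) + indic (vertex_rows z')))).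
  rewrite indicD; apply: present_frame => //.
  have r1 y (R : {set P}) : (#|vertex_rows y :\: R| <= 1)%N.
    apply: leq_trans (subset_leq_card (subsetDl _ _)) _.
    by case: y => [[j|]|k] /=; rewrite ?cards0 ?cards1.
  exact: leq_trans (leq_card_setU _ _) (leq_add (r1 _ _) (r1 _ _)).
have -> : vec l (indic (vertex_rows z) + indic (vertex_rows z')) =
    vec 0 (indic (vertex_rows z) + indic (vertex_rows z')) + vec l 0.
  by rewrite vecD add0r addr0.
have := memvD (vertex_vertex_rows z) (vertex_vertex_rows z').
by rewrite [X in _ -> X \in _]addrACA addvv addr0 addrACA vecD addr0 addrC.
Qed.

Definition basis_vertices (O : {set Y1}) : {set option Y1} :=
  [set z | if z is Some j then j \in O else true].

Definition basis_points (O : {set Y1}) : {set T} :=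
  [set z | match z with inl z => z \in basis_vertices O | inr _ => true end].

Lemma sum_vertex_extra (S : {set T}) k : (\sum_(z in S) vertex z) (inr (inr k)) = (inr k \in S)%:R.
Proof.
rewrite sum_ffunE -sum_indicator; apply: eq_bigr => -[z|k'] _ /=; rewrite !ffunE //.
by rewrite inE eq_sym.
Qed.

Lemma sum_vertex_inner (S : {set T}) j : (\sum_(z in S) vertex z) (inr (inl j)) = 0.
Proof. by rewrite sum_ffunE big1 // => -[z|k] _ /=; rewrite !ffunE ?inE. Qed.

Lemma sum_vertex_rows (S : {set T}) x : (\sum_(z in S) vertex z) (inl x) =
  (\sum_(j in [set j | inl (Some j) \in S]) y1col (Some j)) x.
Proof.
pose h (j : Y1) : T := inl (Some j); pose S1 := [set j | inl (Some j) \in S].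
rewrite (big_setID (h @: S1)) /= ffunE [X in _ + X]sum_ffunE [X in _ + X]big1 ?addr0 => [|z].
  rewrite (_ : S :&: _ = h @: S1); last first.
    apply/setP => z; rewrite inE andbC; case: (boolP (z \in _)) => //= /imsetP[j].
    by rewrite inE => jS ->.
  rewrite big_imset /= => [|? ? _ _ []//]; rewrite !sum_ffunE; apply: eq_bigr => j _.
  by rewrite ffunE.
rewrite inE => /andP[zS1 zS]; case: z zS1 zS => [[j|]|k] zS1 zS /=; rewrite !ffunE //.
by case/negP: zS1; apply: imset_f; rewrite inE.
Qed.

(** The entries in [P] exclude the extra vertices and independence excludes [O]. Only [None], with
    its zero vector, could remain, and alone it is an odd set. *)
Lemma affine_basis (O : {set Y1}) x :
  (forall S : {set Y1}, S \subset O ->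
     \sum_(j in S) y1col (Some j) \in (spanC + <[x]>)%VS -> S = set0) ->
  affine_indep vertex (mainU + <[vec x 0%R : V]>)%VS (basis_points O).
Proof.
move=> indO S SD oS hS.
have [y [yx hy]] : exists y : W, y \in <[x]>%VS /\ \sum_(z in S) vertex z + vec y 0 \in mainU.
  move: hS; rewrite mem_add_line => /orP[h|h].
    by exists 0; rewrite mem0v vec0 addr0.
  by exists x; rewrite memv_line.
have [S' [u [uC e]]] := mainU_lin hy.
have S'0 : S' = set0.
  apply/setP => j; rewrite inE; apply/negP => jS'.
  by have /ffunP/(_ (inr (inl j))) := e; rewrite ffunE sum_vertex_inner !ffunE imset_f ?addr0.
have S1 : [set j | inl (Some j) \in S] = set0.
  apply: indO; first by apply/subsetP => j; rewrite inE => /(subsetP SD); rewrite !inE.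
  have -> : \sum_(j in [set j | inl (Some j) \in S]) y1col (Some j) = u + y.
    apply/ffunP => r; rewrite -sum_vertex_rows; have /ffunP/(_ (inl r)) := e.
    rewrite S'0 big_set0 addr0 ffunE [in RHS]ffunE [vec y 0 _]ffunE => h.
    by rewrite [RHS]ffunE -h addvK.
  exact: memv_add.
have Sk k : inr k \notin S.
  have /ffunP/(_ (inr (inr k))) := e; rewrite ffunE sum_vertex_extra S'0 imset0 !ffunE inE addr0.
  by case: (_ \in S).
have S_None : S \subset [set inl None].
  apply/subsetP => -[[j|]|k] hz; rewrite ?inE //; last by rewrite (negPf (Sk k)) in hz.
  by have := in_set0 j; rewrite -S1 inE hz.
apply/eqP; rewrite -cards_eq0; have := subset_leq_card S_None; rewrite cards1.
by move: oS; case: #|S| => [|[|]].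
Qed.

Lemma sum_vertex_inl (J : {set option Y1}) :
  \sum_(z in inl @: J) vertex z = vec (\sum_(z in J) y1col z) 0.
Proof.
rewrite big_imset /= => [|? ? _ _ []//].
by elim/big_rec2: _ => [|z v w _ ->]; rewrite ?vec0 // vecD addr0.
Qed.

(** Adding [None] adjusts the parity of [J] without changing the sum. *)
Lemma span_basis (O : {set Y1}) (U : {vspace W}) (b : bool) w :
  w \in (sp (fun j => y1col (Some j)) O + U)%VS ->
  exists J : {set option Y1}, [/\ J \subset basis_vertices O, odd #|J| = b
    & w + \sum_(z in J) y1col z \in U].
Proof.
case/mem_spP => S SO hw.
have cS : #|Some @: S| = #|S| by rewrite card_imset // => ? ? [].
have sS : \sum_(z in Some @: S) y1col z = \sum_(j in S) y1col (Some j).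
  by rewrite big_imset //= => ? ? _ _ [].
have SO' : Some @: S \subset basis_vertices O.
  by apply/subsetP => _ /imsetP[j jS ->]; rewrite inE (subsetP SO).
have nS : None \notin Some @: S by apply/imsetP => -[].
case: (boolP (odd #|S| == b)) => [/eqP ob|ob].
  by exists (Some @: S); rewrite cS sS.
exists (None |: Some @: S); split.
- by rewrite subUset SO' andbT sub1set inE.
- by rewrite cardsU1 nS cS oddD; move: ob; case: (odd _); case: b.
by rewrite big_setU1 //= add0r sS.
Qed.

(** The template modulo $C$ and the future sign vector [x]: Lambda vanishes, the columns of $Y_1$
    become basis vertices, and those of $Y_0$ in the span become edges between them. *)
Definition frame_form (x : W) (O : {set Y1}) : Prop :=
  [/\ forall l : W, l \in tLambda Phi -> l \in (spanC + <[x]>)%VS,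
      forall S : {set Y1}, S \subset O ->
        \sum_(j in S) y1col (Some j) \in (spanC + <[x]>)%VS -> S = set0,
      forall j, exists2 z, z \in basis_vertices O &
        y1col (Some j) + y1col z \in (spanC + <[x]>)%VS
    & forall y, tcol (inl (inl y)) \in
          (sp (fun j => y1col (Some j)) setT + (spanC + <[x]>))%VS ->
        exists z z', [/\ z \in basis_vertices O, z' \in basis_vertices O
          & tcol (inl (inl y)) + (y1col z + y1col z') \in (spanC + <[x]>)%VS]].

Section Existence.
Hypothesis noPG : forall (E : finType) (M : matroid E), conforms Phi M ->
  forall e : PG_ground 4, ~ has_minor M (PG32_del e).
Hypothesis noL11 : forall (E : finType) (M : matroid E), conforms Phi M ->
  ~ has_minor M L11.
Local Notation fam := (test_family (@no_delta Phi P)).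
Local Notation Y1sp := (sp (fun j => y1col (Some j))).

Lemma complete_mainU : complete fam vertex mainU.
Proof.
move=> z z'; have := present_vertices z z' (template0 Phi).
by rewrite (vec0 Phi P) addr0.
Qed.

(** [J] will be odd, and the edge from column [j] to the extra vertex [k] gives an even set. That
    [k] is arbitrary matters in [frame_form_no_lambda]. *)
Lemma present_Y1_set (U : {vspace V}) (j : Y1) k (J : {set option Y1}) :
  (mainU <= U)%VS -> vec (y1col (Some j) + \sum_(z in J) y1col z) 0 \in U ->
  present fam U (\sum_(z in inr k |: inl @: J) vertex z).
Proof.
move=> mU h; apply: present_eq (present_mono mU (complete_mainU (inl (Some j)) (inr k))) _.
rewrite big_setU1 /=; last by apply/imsetP => -[].
by rewrite sum_vertex_inl addrA addvK vecD addr0.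
Qed.

Lemma present_Y0_set (U : {vspace V}) (y : tY0 Phi) (J : {set option Y1}) :
  vec (tcol (inl (inl y)) + \sum_(z in J) y1col z) 0 \in U ->
  present fam U (\sum_(z in inl @: J) vertex z).
Proof.
move=> h; apply: present_eq (present_Y0 (@no_delta Phi P) _ y) _.
by rewrite sum_vertex_inl dcol_no_delta vecD addr0.
Qed.

Lemma basis_points_inl (O : {set Y1}) (J : {set option Y1}) :
  J \subset basis_vertices O -> inl @: J \subset basis_points O.
Proof.
by move=> /subsetP h; apply/subsetP => _ /imsetP[z /h zO ->]; rewrite inE.
Qed.

Lemma basis_points_inr (O : {set Y1}) (J : {set option Y1}) k :
  J \subset basis_vertices O -> (inr k : T) |: inl @: J \subset basis_points O.
Proof. by move=> h; rewrite subUset sub1set inE basis_points_inl. Qed.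

Lemma card_inl (J : {set option Y1}) : #|[set (inl z : T) | z in J]| = #|J|.
Proof. by apply: card_imset => ? ? []. Qed.

Lemma card_inr (J : {set option Y1}) k :
  #|(inr k : T) |: [set (inl z : T) | z in J]| = #|J|.+1.
Proof. by rewrite cardsU1 card_inl (_ : inr k \notin _) //; apply/imsetP => -[]. Qed.

(** With [x = l] every edge is doubled, so [no_doubled_even] leaves only sets of two vertices modulo
    [x]: expansions in the basis have one vertex for $Y_1$ and at most two for $Y_0$. *)
Lemma frame_form_lambda (l : W) :
  l \in tLambda Phi -> l \notin spanC -> exists x O, frame_form x O.
Proof.
move=> lL lC; pose U := (spanC + <[l]>)%VS.
have [O [indO maxO]] := maximal_indep (fun j => y1col (Some j)) U.
have even_le3 (J : {set T}) : J \subset basis_points O -> ~~ odd #|J| ->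
    present fam (mainU + <[vec l 0%R : V]>)%VS (\sum_(z in J) vertex z) -> (#|J| <= 3)%N.
  move=> JO oJ pJ; rewrite leqNgt; apply/negP => J3.
  have conf := test_matroid_conforms (@no_delta_in Phi P).
  apply: (no_doubled_even (test_rep (@no_delta Phi P)) (noPG conf) contracted_mainU
    (x := vec l 0) (D := basis_points O) _ _ _ _ _ JO oJ J3 pJ).
  - by rewrite vec_mainU.
  - exact: affine_basis.
  - exact: complete_mainU.
  - by move=> z z'; apply: present_vertices.
  - by have := present_vertices (inl None) (inl None) lL; rewrite addvv add0r.
exists l, O; split.
- by move=> l' l'L; apply: lambda_dim.
- exact: indO.
- move=> j; have [J [JO oJ hJ]] : exists J : {set option Y1}, [/\ J \subset basis_vertices O,
      odd #|J| = true & y1col (Some j) + \sum_(z in J) y1col z \in U].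
    apply: span_basis; apply: (subvP maxO); apply: (subvP (addvSl _ _)).
    by rewrite memvE /sp (sumv_sup j).
  have := even_le3 (inr ord0 |: inl @: J) (basis_points_inr _ JO).
  rewrite card_inr /= oJ => /(_ isT) le3.
  have /le3 : present fam (mainU + <[vec l 0%R : V]>)%VS
      (\sum_(z in inr ord0 |: inl @: J) vertex z).
    by apply: (present_Y1_set (j := j)); rewrite ?addvSl // vec_mainU_line.
  rewrite ltnS => J2; have /cards1P[z Jz] : #|J| == 1 by case: #|J| oJ J2 => [|[|[|]]].
  by exists z; [rewrite (subsetP JO) // Jz inE|rewrite Jz big_set1 in hJ].
move=> y hy; have [J [JO oJ hJ]] : exists J : {set option Y1}, [/\ J \subset basis_vertices O,
    odd #|J| = false & tcol (inl (inl y)) + \sum_(z in J) y1col z \in U].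
  by apply: span_basis; apply: (subvP maxO).
have := even_le3 (inl @: J) (basis_points_inl JO).
rewrite card_inl oJ => /(_ isT) le3.
have /le3 J3 : present fam (mainU + <[vec l 0%R : V]>)%VS (\sum_(z in inl @: J) vertex z).
  by apply: (present_Y0_set (y := y)); rewrite vec_mainU_line.
have [J0|J0] := eqVneq J set0.
  exists None, None; rewrite !inE; split=> //.
  by move: hJ; rewrite J0 big_set0 /= !addr0.
have /cards2P[z [z' [zz' Jz]]] : #|J| == 2.
  by move: J0; rewrite -cards_eq0; case: #|J| oJ J3 => [|[|[|[|]]]].
exists z, z'; split; try by rewrite (subsetP JO) // Jz !inE eqxx ?orbT.
by move: hJ; rewrite Jz big_setU1 ?inE //= big_set1.
Qed.

(** The vertices [Some i] and [z2] agree modulo their sum [x], so [z2] takes over the role of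
    [Some i], and dropping [i] restores independence modulo [x]. *)
Lemma frame_form_eliminate (O : {set Y1}) i z2 :
  (forall S : {set Y1}, S \subset O ->
     \sum_(j in S) y1col (Some j) \in spanC -> S = set0) ->
  i \in O -> z2 \in basis_vertices O -> z2 != Some i ->
  let x := y1col (Some i) + y1col z2 in
  (forall l : W, l \in tLambda Phi -> l \in spanC) ->
  (forall j, exists2 z, z \in basis_vertices O &
        y1col (Some j) + y1col z \in (spanC + <[x]>)%VS) ->
  (forall y, tcol (inl (inl y)) \in (Y1sp setT + (spanC + <[x]>))%VS ->
        exists z z', [/\ z \in basis_vertices O, z' \in basis_vertices O
          & tcol (inl (inl y)) + (y1col z + y1col z') \in (spanC + <[x]>)%VS]) ->
  frame_form x (O :\ i).
Proof.
move=> indO iO z2O z2i x LC HY1 HY0; set U := (spanC + <[x]>)%VS.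
have xU : x \in U by apply: (subvP (addvSr _ _)); apply: memv_line.
have repl z : z \in basis_vertices O ->
    exists2 z', z' \in basis_vertices (O :\ i) & y1col z + y1col z' \in U.
  have [-> _|zi zO] := eqVneq z (Some i).
    exists z2 => //; move: z2O z2i; rewrite !inE; case: (z2) => // j jO ji.
    by rewrite !inE jO andbT; apply: contraNneq ji => ->.
  exists z; last by rewrite addvv mem0v.
  move: zO zi; rewrite !inE; case: z => // j jO ji.
  by rewrite !inE jO andbT; apply: contraNneq ji => ->.
split.
- by move=> l /LC; apply: (subvP (addvSl _ _)).
- move=> S SO; have SO' := subset_trans SO (subsetDl _ _).
  rewrite mem_add_line => /orP[|]; first exact: indO.
  pose R := i |: (if z2 is Some j then [set j] else set0).
  have -> : x = \sum_(j in R) y1col (Some j).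
    rewrite /x /R; case: (z2) z2i => [j|] ij.
      by rewrite big_setU1 ?big_set1 // inE eq_sym.
    by rewrite setU0 big_set1 addr0.
  rewrite sumv_symdiff => /indO h.
  have RO : R \subset O.
    rewrite subUset sub1set iO /=; move: z2O; rewrite inE.
    by case: (z2) => [j|]; rewrite ?sub1set ?sub0set.
  have := in_set0 i; rewrite -h; last first.
    by rewrite subUset !(subset_trans (subsetDl _ _)).
  have iS : (i \in S) = false by apply/negP => /(subsetP SO); rewrite !inE eqxx.
  by rewrite !inE iS eqxx.
- move=> j; have [z zO hz] := HY1 j; have [z' z'O hz'] := repl z zO.
  by exists z' => //; have := memvD hz hz'; rewrite addrA addvK.
move=> y /HY0[z1 [z3 [z1O z3O hz]]].
have [z1' z1'O hz1] := repl z1 z1O; have [z3' z3'O hz3] := repl z3 z3O.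
exists z1', z3'; split=> //; have := memvD hz (memvD hz1 hz3).
by rewrite (addrACA (y1col z1)) [X in X \in _ -> _]addrA addvK.
Qed.

Lemma card_basis_points (O : {set Y1}) : (6 < #|basis_points O|)%N.
Proof.
apply: leq_trans (subset_leq_card (_ : [set (inr k : T) | k in [set: 'I_8]] \subset _)).
  by rewrite card_imset ?cardsT ?card_ord // => ? ? [].
by apply/subsetP => _ /imsetP[k _ ->]; rewrite inE.
Qed.

(** Expansions that lead to four-sets contain the common pair, so adding its sum [x] shortens them
    to a vertex or an edge. Without four-sets [x = 0] serves. *)
Lemma frame_form_no_lambda :
  (forall l : W, l \in tLambda Phi -> l \in spanC) -> exists x O, frame_form x O.
Proof.
move=> LC; have [O [indO maxO]] := maximal_indep (fun j => y1col (Some j)) spanC.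
have conf := test_matroid_conforms (@no_delta_in Phi P).
have rT := test_rep (@no_delta Phi P).
have aff : affine_indep vertex mainU (basis_points O).
  move=> S SO oS hS; apply: (affine_basis (x := 0)) SO oS _.
    by move=> S' S'O; rewrite mem_add_line addr0 orbb; apply: indO.
  exact: (subvP (addvSl _ _)).
have even_le4 (J : {set T}) : J \subset basis_points O -> ~~ odd #|J| ->
    present fam mainU (\sum_(z in J) vertex z) -> (#|J| <= 5)%N.
  move=> JO oJ pJ; rewrite leqNgt; apply/negP => J5.
  exact: (no_large_even rT (noPG conf) contracted_mainU aff complete_mainU JO oJ J5 pJ).
pose F := four_sets fam vertex mainU (basis_points O).
have inF (J : {set T}) : J \subset basis_points O -> #|J| = 4 ->
    present fam mainU (\sum_(z in J) vertex z) -> J \in F.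
  by move=> JO J4 pJ; rewrite inE JO J4.
pose good (x : W) : Prop :=
    [/\ x = 0 \/ exists z1 z2, [/\ z1 \in basis_vertices O, z2 \in basis_vertices O,
                                 z1 != z2 & x = y1col z1 + y1col z2],
      forall J : {set option Y1}, J \subset basis_vertices O -> #|J| = 3 ->
        (forall k, inr k |: inl @: J \in F) ->
        exists2 z, z \in basis_vertices O & \sum_(z in J) y1col z + y1col z \in <[x]>%VS
    & forall J : {set option Y1}, J \subset basis_vertices O -> #|J| = 4 ->
        inl @: J \in F ->
        exists z z', [/\ z \in basis_vertices O, z' \in basis_vertices O
          & \sum_(z in J) y1col z + (y1col z + y1col z') \in <[x]>%VS]].
have [x [hx h3 h4]] : exists x : W, good x.
  have [F0|F0] := eqVneq F set0.
    exists 0; split=> [|J _ _ /(_ ord0)|J _ _]; [by left| |]; by rewrite F0 inE.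
  have [a [b [ab abF]]] := four_sets_common_pair rT (noPG conf) (noL11 conf)
    contracted_mainU aff complete_mainU (card_basis_points O) F0.
  (* A common vertex among the extra ones means that no expansion leads to a four-set: those of
     $Y_0$ contain no extra vertex, and those of $Y_1$ occur with every [k]. *)
  have extra c : (forall J, J \in F -> inr c \in J) ->
      [/\ forall J : {set option Y1}, (forall k, inr k |: inl @: J \in F) -> False
        & forall J : {set option Y1}, inl @: J \in F -> False].
    move=> hc; split=> J hJ; last by have /imsetP[] := hc _ hJ.
    pose k : 'I_8 := if c == ord0 then ord_max else ord0.
    have := hc _ (hJ k); rewrite !inE => /orP[/eqP[ck]|/imsetP[] //].
    by move: ck; rewrite /k; case: eqP => // ->.
  have none c : (forall J, J \in F -> inr c \in J) -> exists x : W, good x.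
    move=> /extra[no3 no4]; exists 0; split; first by left.
      by move=> J _ _ /no3.
    by move=> J _ _ /no4.
  case: a ab abF => [z1|c] ab abF; last by apply: (none c) => J /abF/andP[].
  case: b ab abF => [z2|c] ab abF; last by apply: (none c) => J /abF/andP[].
  have z12 : z1 != z2 by [].
  have inl_inj : injective (inl : option Y1 -> T) by move=> ? ? [].
  exists (y1col z1 + y1col z2); split.
  - right; exists z1, z2; have [J JF] := set0Pn _ F0.
    have /andP[z1J z2J] := abF J JF; move: JF; rewrite inE => /and3P[/subsetP JO _ _].
    by have := JO _ z1J; have := JO _ z2J; rewrite !inE.
  - move=> J JO J3 /(_ ord0)/abF; rewrite !in_setU1 /= !(mem_imset _ _ inl_inj).
    move=> /andP[z1J z2J]; have [cJ ->] := set_remove2 y1col z1J z2J z12.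
    have /cards1P[z Jz] : #|J :\ z1 :\ z2| == 1 by move: cJ; rewrite J3 => -[<-].
    exists z; last by rewrite Jz big_set1 addvK memv_line.
    have : z \in J :\ z1 :\ z2 by rewrite Jz inE.
    by rewrite !in_setD1 => /and3P[_ _ /(subsetP JO)].
  move=> J JO J4 /abF; rewrite !(mem_imset _ _ inl_inj).
  move=> /andP[z1J z2J]; have [cJ ->] := set_remove2 y1col z1J z2J z12.
  have /cards2P[z [z' [zz' Jz]]] : #|J :\ z1 :\ z2| == 2 by move: cJ; rewrite J4 => -[<-].
  exists z, z'; split.
  - have : z \in J :\ z1 :\ z2 by rewrite Jz !inE eqxx.
    by rewrite !in_setD1 => /and3P[_ _ /(subsetP JO)].
  - have : z' \in J :\ z1 :\ z2 by rewrite Jz !inE eqxx orbT.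
    by rewrite !in_setD1 => /and3P[_ _ /(subsetP JO)].
  by rewrite Jz big_setU1 ?inE //= big_set1 addvK memv_line.
have HY1 j : exists2 z, z \in basis_vertices O &
    y1col (Some j) + y1col z \in (spanC + <[x]>)%VS.
  have [J [JO oJ hJ]] : exists J : {set option Y1}, [/\ J \subset basis_vertices O,
      odd #|J| = true & y1col (Some j) + \sum_(z in J) y1col z \in spanC].
    apply: span_basis; apply: (subvP maxO); apply: (subvP (addvSl _ _)).
    by rewrite memvE /sp (sumv_sup j).
  have pJ k : present fam mainU (\sum_(z in inr k |: inl @: J) vertex z).
    by apply: (present_Y1_set (j := j)); rewrite // vec_mainU.
  have := even_le4 (inr ord0 |: inl @: J) (basis_points_inr _ JO).
  rewrite card_inr /= oJ => /(_ isT (pJ ord0)) J4.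
  have [J3|J3] := eqVneq #|J| 3.
    have [z zO hz] := h3 J JO J3 (fun k => inF _ (basis_points_inr k JO)
       (etrans (card_inr J k) (congr1 S J3)) (pJ k)).
    exists z => //; have := memvD (subvP (addvSl _ <[x]>) _ hJ) (subvP (addvSr spanC _) _ hz).
    by rewrite addrA addvK.
  have /cards1P[z Jz] : #|J| == 1 by move: oJ J4 J3; case: #|J| => [|[|[|[|[|]]]]].
  exists z; first by rewrite (subsetP JO) // Jz inE.
  by apply: (subvP (addvSl _ _)); move: hJ; rewrite Jz big_set1.
have HY0 y : tcol (inl (inl y)) \in (Y1sp setT + (spanC + <[x]>))%VS ->
    exists z z', [/\ z \in basis_vertices O, z' \in basis_vertices O
      & tcol (inl (inl y)) + (y1col z + y1col z') \in (spanC + <[x]>)%VS].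
  move=> hy.
  have {}hy : tcol (inl (inl y)) \in (Y1sp setT + spanC)%VS.
    apply: (subvP _ _ hy); rewrite subv_add addvSl subv_add addvSr /= -memvE.
    have y1sp z : y1col z \in (Y1sp setT + spanC)%VS.
      case: z => [j|]; last by rewrite mem0v.
      by apply: (subvP (addvSl _ _)); rewrite memvE /sp (sumv_sup j).
    by case: hx => [->|[z1 [z2 [_ _ _ ->]]]]; rewrite ?mem0v ?memvD.
  have [J [JO oJ hJ]] : exists J : {set option Y1}, [/\ J \subset basis_vertices O,
      odd #|J| = false & tcol (inl (inl y)) + \sum_(z in J) y1col z \in spanC].
    by apply: span_basis; apply: (subvP maxO).
  have pJ : present fam mainU (\sum_(z in inl @: J) vertex z).
    by apply: (present_Y0_set (y := y)); rewrite vec_mainU.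
  have := even_le4 (inl @: J) (basis_points_inl JO).
  rewrite card_inl oJ => /(_ isT pJ) J5.
  have [J4|J4] := eqVneq #|J| 4.
    have [z [z' [zO z'O hz]]] := h4 J JO J4
      (inF _ (basis_points_inl JO) (etrans (card_inl J) J4) pJ).
    exists z, z'; split=> //.
    have := memvD (subvP (addvSl _ <[x]>) _ hJ) (subvP (addvSr spanC _) _ hz).
    by rewrite addrA addvK.
  have [J0|J0] := eqVneq J set0.
    exists None, None; rewrite !inE; split=> //.
    by apply: (subvP (addvSl _ _)); move: hJ; rewrite J0 big_set0 /= !addr0.
  have /cards2P[z [z' [zz' Jz]]] : #|J| == 2.
    by move: J0; rewrite -cards_eq0; case: #|J| oJ J5 J4 => [|[|[|[|[|[|]]]]]].
  exists z, z'; split; try by rewrite (subsetP JO) // Jz !inE eqxx ?orbT.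
  by apply: (subvP (addvSl _ _)); move: hJ; rewrite Jz big_setU1 ?inE //= big_set1.
case: hx => [x0|[z1 [z2 [z1O z2O z12 xE]]]].
  exists x, O; split=> [l /LC|S SO||//]; [exact: (subvP (addvSl _ _))| |exact: HY1].
  by rewrite mem_add_line x0 addr0 orbb; apply: indO.
(* At least one of the two vertices is not [None], and that one leaves [O]. *)
case: z1 z1O z12 xE => [i|] z1O z12 xE.
  exists x, (O :\ i); rewrite xE in HY1 HY0 *.
  by apply: frame_form_eliminate => //; [rewrite inE in z1O|rewrite eq_sym].
case: z2 z2O z12 xE => [i|] // z2O z12 xE.
exists x, (O :\ i); rewrite addrC in xE; rewrite xE in HY1 HY0 *.
by apply: frame_form_eliminate => //; rewrite inE in z2O.
Qed.

Lemma frame_form_exists : exists x O, frame_form x O.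
Proof.
case: (pickP [pred l : W | (l \in tLambda Phi) && (l \notin spanC)]) => [l /andP[lL lC]|h].
  exact: frame_form_lambda lL lC.
apply: frame_form_no_lambda => l lL; have := h l.
by rewrite /= lL => /negbFE.
Qed.

End Existence.
End FrameForm.

(** * Conforming matroids that are even-cycle *)

Section ConformingMatroid.
Local Open Scope ring_scope.
Variables (Phi : template) (P Q : finType).
Variables (A A' : bmatrix (tX Phi + P)%type (tcols Phi + Q)%type) (Z : {set Q}).
Hypothesis resp : respects A' Z.
Hypothesis AA'y : forall b y, A b (inl y) = A' b (inl y).
Hypothesis AA'q : forall b q, q \notin Z -> A b (inr q) = A' b (inr q).
Hypothesis AA'Z : forall i, i \in Z -> exists j : tY1 Phi, forall b,
  A b (inr i) = A' b (inr i) + A' b (inl (inl (inr j))).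
Hypothesis delta_vanish : forall (phi : {ffun tcols Phi -> 'F_2}) (w : {set tcols Phi}),
  phi \in tDelta Phi -> \sum_(y in w) tcol y \in tLambda Phi ->
  \sum_(y in w) phi y = 0.
Local Notation W := {ffun tX Phi -> ('F_2)^o}.
Local Notation V := {ffun (tX Phi + P)%type -> ('F_2)^o}.

Definition delta_rows (p : P) : {ffun tcols Phi -> 'F_2} := [ffun y => A' (inr p) (inl y)].

Lemma column_tcols y : column A (inl y) = vec (tcol y) (dcol delta_rows y).
Proof.
have [h1 _ _ _ _] := resp.
by apply/ffunP => -[x|p]; rewrite !ffunE AA'y ?h1.
Qed.

Definition xpart (g : tcols Phi + Q) : W := [ffun x => A (inl x) g].

(* The entries in rows of [P], without the contribution of [Delta]. *)
Definition ppart (g : tcols Phi + Q) : {ffun P -> ('F_2)^o} :=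
  [ffun p => if g is inr q then A' (inr p) (inr q) else 0].

(** [R] holds the template column itself, or the partner in $Y_1$ of a column of $Z$. What remains
    has its upper part in Lambda and no contribution of Delta. *)
Lemma column_split g : exists (l : W) (R : {set tcols Phi}),
  [/\ l \in tLambda Phi, xpart g = l + \sum_(y in R) tcol y
    & column A g = vec l (ppart g) + \sum_(y in R) column A (inl y)].
Proof.
have [h1 h2 _ h4 _] := resp; have l0 := template0 Phi.
case: g => [y|q].
  exists 0, [set y]; rewrite !big_set1 add0r; split=> //.
    by apply/ffunP => x; rewrite !ffunE AA'y h1.
  by rewrite (_ : vec _ _ = 0) ?add0r // -(vec0 Phi P); congr vec; apply/ffunP => p; rewrite !ffunE.
have [qZ|qZ] := boolP (q \in Z).
  have [z0 _] := h2 q qZ; have [j hj] := AA'Z qZ.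
  exists 0, [set inl (inr j)]; rewrite !big_set1 add0r; split=> //.
    by apply/ffunP => x; rewrite !ffunE hj z0 h1 add0r.
  by apply/ffunP => -[x|p]; rewrite !ffunE hj AA'y ?z0.
exists [ffun x => A' (inl x) (inr q)], set0; rewrite !big_set0 !addr0; split=> //.
- exact: h4.
- by apply/ffunP => x; rewrite !ffunE AA'q.
by apply/ffunP => -[x|p]; rewrite !ffunE AA'q.
Qed.

Lemma sum_vec (I : finType) (S : {set I}) (w : I -> W) (s : I -> {ffun P -> ('F_2)^o}) :
  \sum_(i in S) vec (w i) (s i) = vec (\sum_(i in S) w i) (\sum_(i in S) s i).
Proof. by elim/big_rec3: _ => [|i a b c _ ->]; rewrite ?vec0 ?vecD. Qed.

Lemma vec_inj (w w' : W) (s s' : {ffun P -> ('F_2)^o}) :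
  vec w s = vec w' s' -> w = w' /\ s = s'.
Proof.
move=> /ffunP e; split; apply/ffunP => i.
  by have := e (inl i); rewrite !ffunE.
by have := e (inr i); rewrite !ffunE.
Qed.

Lemma column_sum (E : finType) (g : E -> tcols Phi + Q) (S : {set E}) :
  exists (l : W) (R : {set tcols Phi}),
  [/\ l \in tLambda Phi, \sum_(e in S) xpart (g e) = l + \sum_(y in R) tcol y
    & \sum_(e in S) column A (g e) =
      vec l (\sum_(e in S) ppart (g e)) + \sum_(y in R) column A (inl y)].
Proof.
have [n] := ubnP #|S|; elim: n S => // n IHn S.
have [->|[e eS]] := set_0Vmem S.
  by exists 0, set0; rewrite !big_set0 !addr0 vec0; split=> //; apply: template0.
rewrite (cardsD1 e) eS add1n ltnS => /IHn[l [R [lL xE cE]]].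
have [l' [R' [l'L xE' cE']]] := column_split (g e).
exists (l' + l), ((R' :\: R) :|: (R :\: R')); split.
- exact: lambda_add.
- by rewrite (big_setD1 e) //= xE xE' addrACA sumv_symdiff.
rewrite (big_setD1 e) //= cE cE' addrACA sumv_symdiff vecD.
by rewrite [\sum_(i in S) ppart (g i)](big_setD1 e).
Qed.

(* If a sum of columns of [A_1] lies in [Lambda], then the corresponding sum in
   every row of [Delta] vanishes: this makes the rows of [P] independent of
   [Delta]. *)
Lemma sum_column_base (E : finType) (g : E -> tcols Phi + Q) (S : {set E}) :
  (\sum_(e in S) column A (g e) \in (sp (column A) (C_cols Phi Q) + 0)%VS) =
  (\sum_(e in S) vec (xpart (g e)) (ppart (g e)) \in test_base (@no_delta Phi P)).
Proof.
have [l [R [lL xE cE]]] := column_sum g S.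
rewrite sum_vec vec_no_delta xE cE.
have vanish (R' : {set tcols Phi}) : \sum_(y in R') tcol y = l ->
    \sum_(y in R') column A (inl y) = vec l 0.
  move=> hl; under eq_bigr do rewrite column_tcols.
  rewrite sum_vec hl; congr vec; apply/ffunP => p; rewrite sum_ffunE ffunE.
  rewrite (eq_bigr (fun y => delta_rows p y)) => [|y _]; last by rewrite ffunE.
  apply: delta_vanish; last by rewrite hl.
  by have [_ _ _ _] := resp; apply.
have C_sum (F : finType) (h : F -> tcols Phi) (T : {set F}) (V' : lmodType 'F_2) (c : tcols Phi -> V') :
    injective h -> \sum_(y in h @: T) c y = \sum_(y in T) c (h y).
  by move=> inj_h; rewrite big_imset //= => ? ? _ _ /inj_h.
have inr_inj : injective (inr : tC Phi -> tcols Phi) by move=> ? ? [].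
have symd (T : {set tC Phi}) (V' : lmodType 'F_2) (c : tcols Phi -> V') :
    \sum_(y in R) c y + \sum_(y in T) c (inr y) =
    \sum_(y in (R :\: inr @: T) :|: (inr @: T :\: R)) c y.
  by rewrite -(C_sum _ inr T _ c inr_inj) sumv_symdiff.
have spE : sp (column A) (C_cols Phi Q) = sp (fun y : tC Phi => column A (inl (inr y))) setT.
  rewrite /C_cols (_ : [set inl (inr c) | c in [set: tC Phi]] =
    [set (fun c : tC Phi => inl (inr c) : tcols Phi + Q) c | c in [set: tC Phi]]) //.
  by rewrite sp_comp.
apply/idP/andP.
  (* The columns of $C$ in the dependency are merged with [R] into [R'], whose columns in $A_1$ sum
     to [l], so that [vanish] applies. *)
  rewrite spE => /mem_spP[T _]; rewrite memv0 -addrA symd addv_eq0 => /eqP e.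
  set R' := _ :|: _ in e.
  have e' : \sum_(y in R') column A (inl y) =
      vec (\sum_(y in R') tcol y) (\sum_(y in R') dcol delta_rows y).
    by under eq_bigr do rewrite column_tcols; rewrite sum_vec.
  have lE : \sum_(y in R') tcol y = l.
    by move: e; rewrite e' => /vec_inj[].
  have := vanish R' lE; rewrite -e => /vec_inj[_ s0]; split; last by rewrite s0.
  have -> : l + \sum_(y in R) tcol y = \sum_(y in T) tcol (inr y).
    by rewrite -lE -symd addrAC addvv add0r.
  by apply: memv_suml => y _; rewrite memvE /spanC /sp (sumv_sup y).
case=> lC /eqP->; move: lC; rewrite -[spanC Phi]addv0 => /mem_spP[T _].
rewrite memv0 -addrA symd addv_eq0 => /eqP lE.
rewrite spE; apply/mem_spP; exists T; first exact: subsetT.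
by rewrite -addrA symd vanish // -?lE // addvv mem0v.
Qed.

Section EvenCycleRepresentation.
Variables (x : W) (O : {set tY1 Phi}).
Hypothesis form : frame_form x O.
Variables (E : finType) (M : matroid E) (g : E -> tcols Phi + Q).
Hypothesis gCY : forall e, g e \notin C_cols Phi Q :|: Y1_cols Phi Q.
Hypothesis g_inj : injective g.
Hypothesis rM : rep M (fun e => column A (g e)) (sp (column A) (C_cols Phi Q) + 0)%VS.
Local Notation c0 := (fun e => vec (xpart (g e)) (ppart (g e))).
Local Notation U0 := (test_base (@no_delta Phi P)).

Lemma rep_no_delta : rep M c0 U0.
Proof. by apply: rep_sums rM => S; apply: sum_column_base. Qed.

Definition Y0_elements : {set E} :=
  [set e | if g e is inl (inl (inl _)) then true else false].

Lemma card_Y0_elements : (#|Y0_elements| <= #|tY0 Phi|)%N.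
Proof.
rewrite -(card_imset _ g_inj).
rewrite -cardsT -(card_imset [set: tY0 Phi] (f := fun y => inl (inl (inl y)) : tcols Phi + Q)).
  apply/subset_leq_card/subsetP => _ /imsetP[e he ->]; move: he; rewrite inE.
  by case: (g e) => // -[[y|]|] // _; apply: imset_f.
by move=> ? ? [].
Qed.

(** If the complement did not span, the connectivity of the elements of $Y_0$ would be less than
    their rank, hence than their number: a separation of order below [k]. *)
Lemma Y0_in_closure k : kconnected M k -> (#|tY0 Phi| < k)%N -> (2 * k <= #|E|)%N ->
  rk M (~: Y0_elements) = rk M setT.
Proof.
move=> kM Y0k Ek; have := card_Y0_elements => cY.
apply/eqP; rewrite eqn_leq rk_mono ?subsetT //= leqNgt; apply/negP => lt.
have [Y00|Y00] := posnP #|Y0_elements|.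
  by move: lt; rewrite (cards0_eq Y00) setC0 ltnn.
apply: (kM #|Y0_elements| Y0_elements); first by rewrite Y00 /=; lia.
have := cardsC Y0_elements; have := rk_card M Y0_elements.
by split=> //; [lia | rewrite /connectivity; lia].
Qed.

(** On the rows [X], every element outside $Y_0$ lies in this span: those of $Z$ equal columns of
    $Y_1$, and the others belong to Lambda. *)
Lemma xpart_Y0 k y e : kconnected M k -> (#|tY0 Phi| < k)%N -> (2 * k <= #|E|)%N ->
  g e = inl (inl (inl y)) ->
  tcol (inl (inl y)) \in
    (sp (fun j => y1col (Some j)) setT + (spanC Phi + <[x]>))%VS.
Proof.
move=> kM Y0k Ek ge; have [h1 h2 _ h4 _] := resp; have [LC _ _ _] := form.
have : c0 e \in (sp c0 (~: Y0_elements) + U0)%VS.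
  have : (sp c0 setT + U0 <= sp c0 (~: Y0_elements) + U0)%VS.
    have sub : (sp c0 (~: Y0_elements) + U0 <= sp c0 setT + U0)%VS.
      by rewrite addvS // spS // subsetT.
    have := dimv_leqif_sup sub; case=> _ <-.
    by rewrite -!rep_no_delta (Y0_in_closure kM).
  move/subvP; apply; apply: (subvP (addvSl _ _)).
  by rewrite memvE /sp (sumv_sup e).
have xE : tcol (inl (inl y)) = xpart (g e).
  by apply/ffunP => r; rewrite !ffunE ge AA'y h1.
pose target := (sp (fun j => y1col (Some j)) setT + (spanC Phi + <[x]>))%VS.
rewrite -/target.
have : forall v : V, v \in (sp c0 (~: Y0_elements) + U0)%VS ->
    ([ffun r => v (inl r)] : W) \in target.
  apply: mem_sp_base => [|v w hv hw|e' he'|u].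
  - by rewrite (_ : [ffun _ => _] = 0) ?mem0v //; apply/ffunP => r; rewrite !ffunE.
  - have -> : [ffun r => (v + w) (inl r)] = [ffun r => v (inl r)] + [ffun r => w (inl r)] :> W.
      by apply/ffunP => r; rewrite !ffunE.
    exact: memvD.
  - rewrite (_ : [ffun _ => _] = xpart (g e')); last by apply/ffunP => r; rewrite !ffunE.
    have := gCY e'; rewrite !inE negb_or; case geq: (g e') => [[[y'|j]|cc]|q].
    + by move: he'; rewrite !inE geq.
    + by case/andP => _ /imsetP[]; exists j; rewrite ?inE.
    + by case/andP => /imsetP[]; exists cc; rewrite ?inE.
    move=> _; have [qZ|qZ] := boolP (q \in Z).
      have [z0 _] := h2 q qZ; have [j hj] := AA'Z qZ.
      rewrite (_ : xpart _ = y1col (Some j)).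
        by apply: (subvP (addvSl _ _)); rewrite memvE /sp (sumv_sup j).
      by apply/ffunP => r; rewrite !ffunE hj z0 h1 add0r.
    apply: (subvP (addvSr _ _)); apply: LC.
    rewrite (_ : xpart _ = [ffun r => A' (inl r) (inr q)]); first exact: h4.
    by apply/ffunP => r; rewrite !ffunE AA'q.
  case/mem_test_base_no_delta => w wC ->.
  rewrite (_ : [ffun _ => _] = w); last by apply/ffunP => r; rewrite !ffunE.
  by apply: (subvP (addvSr _ _)); apply: (subvP (addvSl _ _)).
move=> h /h; rewrite (_ : [ffun _ => _] = tcol (inl (inl y))) // xE.
by apply/ffunP => r; rewrite !ffunE.
Qed.

Local Notation vertices := (option (tY1 Phi) + P)%type.

Definition vertex_vector (v : vertices) : V :=
  match v with inl z => vec (y1col z) 0 | inr p => vec 0 (indic [set p]) end.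

Definition allowed (v : vertices) : bool :=
  if v is inl z then z \in basis_vertices O else true.

(** A column of $Z$ joins its row to the basis vertex of its partner. A frame column joins its rows
    in [P], with [None] standing in for missing ones. *)
Lemma edge_ends k e : kconnected M k -> (#|tY0 Phi| < k)%N -> (2 * k <= #|E|)%N ->
  exists u w, [/\ allowed u, allowed w &
    c0 e + (vertex_vector u + vertex_vector w) \in (U0 + <[vec x 0%R : V]>)%VS].
Proof.
move=> kM Y0k Ek; have [h1 h2 h3 h4 _] := resp; have [LC _ hY1 hY0] := form.
have inU w (s : {ffun P -> ('F_2)^o}) : s = 0 -> w \in (spanC Phi + <[x]>)%VS ->
    vec w s \in (U0 + <[vec x 0%R : V]>)%VS.
  move=> ->; rewrite (mem_add_line (spanC Phi)) (mem_add_line U0) vecD addr0.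
  by rewrite !vec_no_delta eqxx !andbT.
have NoneO : None \in basis_vertices O by rewrite inE.
have := gCY e; rewrite !inE negb_or; case geq: (g e) => [[[y|j]|cc]|q].
- move=> _; have [z [z' [zO z'O hz]]] := hY0 y (xpart_Y0 kM Y0k Ek geq).
  exists (inl z), (inl z'); split=> //; rewrite !vecD; apply: inU.
    by rewrite !addr0; apply/ffunP => p; rewrite !ffunE.
  rewrite (_ : xpart _ = tcol (inl (inl y))) //.
  by apply/ffunP => r; rewrite !ffunE AA'y h1.
- by case/andP => _ /imsetP[]; exists j; rewrite ?inE.
- by case/andP => /imsetP[]; exists cc; rewrite ?inE.
move=> _; have [qZ|qZ] := boolP (q \in Z).
  have [z0 [p hp]] := h2 q qZ; have [j hj] := AA'Z qZ.
  have [z zO hz] := hY1 j; exists (inr p), (inl z); split=> //.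
  rewrite !vecD add0r addr0; apply: inU.
    by apply/ffunP => p'; rewrite !ffunE hp inE addF2.
  rewrite (_ : xpart _ = y1col (Some j)) //.
  by apply/ffunP => r; rewrite !ffunE hj z0 h1 add0r.
have xL : xpart (inr q) \in (spanC Phi + <[x]>)%VS.
  apply: LC; rewrite (_ : xpart _ = [ffun r => A' (inl r) (inr q)]); first exact: h4.
  by apply/ffunP => r; rewrite !ffunE AA'q.
have := h3 q qZ; set S := [set p | _].
have pS : ppart (inr q) = indic S.
  by apply/ffunP => p; rewrite !ffunE inE F2_natr_bool.
case cS: #|S| => [|[|[|//]]] _.
- exists (inl None), (inl None); split=> //; rewrite addvv addr0; apply: inU => //.
  by rewrite pS (cards0_eq cS); apply/ffunP => p; rewrite !ffunE inE.
- have /cards1P[p Sp] : #|S| == 1%N by rewrite cS.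
  exists (inr p), (inl None); split=> //; rewrite !vecD !addr0; apply: inU => //.
  by rewrite pS Sp addvv.
have /cards2P[p [p' [pp' Sp]]] : #|S| == 2 by rewrite cS.
exists (inr p), (inr p'); split=> //; rewrite !vecD !addr0; apply: inU => //.
rewrite pS Sp; apply/ffunP => r; rewrite !ffunE !inE.
case: (eqVneq r p) => [->|_] /=; first by rewrite (negPf pp') addr0 addF2.
by rewrite add0r addF2.
Qed.

(** The graph joins the ends given by [edge_ends], and the sign tells whether [x] must be added. If
    a sum of columns vanishes modulo [U0], the rows of [P] and the independence of [O] annihilate
    every vertex coordinate except that of [None], which parity settles. *)
Lemma conforming_even_cycle k :
  kconnected M k -> (#|tY0 Phi| < k)%N -> (2 * k <= #|E|)%N -> even_cycle M.
Proof.
move=> kM Y0k Ek; have [_ indO _ _] := form.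
have [u hu] := fin_all_exists (fun e => edge_ends e kM Y0k Ek).
have [w huw] := fin_all_exists hu.
pose end_sum e := vertex_vector (u e) + vertex_vector (w e).
(* If [x] already lies in [spanC], all signs are false and the sign row is zero. *)
pose sign e := c0 e + end_sum e \notin U0.
pose d e : {ffun option vertices -> ('F_2)^o} :=
  [ffun b => if b is Some v then (v == u e)%:R + (v == w e)%:R else (sign e)%:R].
apply/even_cycleP; exists vertices, d; split.
  by move=> e; apply/ec_vectorP; exists (u e), (w e) => z; rewrite ffunE.
apply: rep_sums rep_no_delta => S; rewrite memv0.
pose n := \sum_(e in S) d e.
pose Theta := \sum_v (n (Some v) : 'F_2) *: vertex_vector v.
(* Modulo [U0] the sum of the columns is the combination of the vertex vectors and [x] with
   coefficients [n]. *)
have total : \sum_(e in S) c0 e + (Theta + (n None : 'F_2) *: vec x 0) \in U0.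
  have ThetaE : Theta = \sum_(e in S) end_sum e.
    rewrite /Theta /n; under eq_bigr do rewrite sum_ffunE scaler_suml.
    rewrite exchange_big /=; apply: eq_bigr => e _.
    have one v0 : \sum_v ((v == v0)%:R : 'F_2) *: vertex_vector v = vertex_vector v0.
      by rewrite (bigD1 v0) //= eqxx scale1r big1 ?addr0 // => v /negPf->; rewrite scale0r.
    under eq_bigr do rewrite ffunE scalerDl.
    by rewrite big_split /= !one.
  rewrite ThetaE /n sum_ffunE scaler_suml -!big_split /=.
  apply: memv_suml => e _; rewrite ffunE addrA /sign.
  case: (boolP (c0 e + end_sum e \in U0)) => h /=; first by rewrite scale0r addr0.
  have [_ _] := huw e; rewrite (mem_add_line U0) -/(end_sum e) (negPf h) /=.
  by rewrite scale1r.
rewrite (mem_congr total); apply/idP/eqP => [|n0]; last first.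
  have n0E b : n b = 0 by rewrite /n n0 ffunE.
  rewrite /Theta n0E big1 => [|v _]; first by rewrite scale0r addr0 mem0v.
  by rewrite n0E scale0r.
move=> hU.
have nE v : n (Some v) = \sum_(e in S) ((v == u e)%:R + (v == w e)%:R).
  by rewrite /n sum_ffunE; apply: eq_bigr => e _; rewrite ffunE.
have n_allowed v : ~~ allowed v -> n (Some v) = 0.
  move=> va; rewrite nE big1 // => e _; have [ua wa _] := huw e.
  by case: eqP => [vu|_]; [rewrite vu ua in va|case: eqP => [vw|_]; [rewrite vw wa in va|rewrite addr0]].
have ThetaP : Theta = vec (\sum_z (n (Some (inl z)) : 'F_2) *: y1col z)
    [ffun p => n (Some (inr p))].
  rewrite /Theta big_sumType /=.
  have -> : \sum_z (n (Some (inl z)) : 'F_2) *: vec (y1col z) 0 =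
      vec (\sum_z (n (Some (inl z)) : 'F_2) *: y1col z) 0 :> V.
    elim/big_rec2: _ => [|z a b _ ->]; first by rewrite vec0.
    rewrite -[X in vec (_ + a) X](addr0 0) -vecD; congr (_ + _); apply/ffunP => -[r|p]; rewrite !ffunE //.
    by rewrite scaler0.
  have -> : \sum_p (n (Some (inr p)) : 'F_2) *: vec 0 (indic [set p]) =
      vec 0 [ffun p => n (Some (inr p))] :> V.
    apply/ffunP => -[r|p]; rewrite sum_ffunE ffunE.
      by rewrite ffunE big1 // => p _; rewrite !ffunE scaler0.
    rewrite (bigD1 p) //= big1 => [|p' pp']; rewrite !ffunE !inE.
      by rewrite eqxx addr0 [LHS]mulr1.
    by rewrite eq_sym (negPf pp') scaler0.
  by rewrite vecD addr0 add0r.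
move: hU; rewrite ThetaP.
have -> : (n None : 'F_2) *: vec x 0 = vec ((n None : 'F_2) *: x) 0 :> V.
  by apply/ffunP => -[r|p]; rewrite !ffunE ?scaler0.
rewrite vecD vec_no_delta addr0 => /andP[hW /eqP nP].
have nP0 p : n (Some (inr p)) = 0 by have /ffunP/(_ p) := nP; rewrite !ffunE.
pose S1 := [set j | n (Some (inl (Some j))) != 0].
have sumS1 : \sum_z (n (Some (inl z)) : 'F_2) *: y1col z = \sum_(j in S1) y1col (Some j).
  have big_option (F : option (tY1 Phi) -> W) : \sum_z F z = F None + \sum_j F (Some j).
    rewrite (bigD1 None) //=; congr (_ + _); rewrite (reindex_omap Some id) => [|[]] //=.
    rewrite (eq_bigl predT) // => j; by rewrite eqxx.
  have scaleE j : (n (Some (inl (Some j))) : 'F_2) *: y1col (Some j) =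
      if j \in S1 then y1col (Some j) else 0.
    by rewrite inE; case: (F2_cases (n (Some (inl (Some j))))) => ->;
      rewrite ?scale0r ?scale1r ?eqxx.
  by rewrite big_option scaler0 add0r (eq_bigr _ (fun j _ => scaleE j)) -big_mkcond.
have S10 : S1 = set0.
  apply: indO.
    apply/subsetP => j; rewrite inE; apply: contraR => jO.
    by rewrite n_allowed //= inE.
  rewrite -sumS1 mem_add_line; case: (F2_cases (n None)) hW => ->.
    by rewrite scale0r addr0 => ->.
  by rewrite scale1r => ->; rewrite orbT.
have nY j : n (Some (inl (Some j))) = 0.
  by have := in_set0 j; rewrite -S10 inE => /negbFE/eqP.
(* A sign sum of 1 would put [x] into [spanC], and then no edge would have a sign. *)
have n_sign : n None = 0.
  case: (F2_cases (n None)) => // n1; exfalso.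
  move: hW; rewrite sumS1 S10 big_set0 add0r n1 scale1r => xC.
  have : n None != 0 by rewrite n1.
  case/negP; rewrite /n sum_ffunE big1 // => e _; rewrite ffunE /sign.
  have [_ _] := huw e; rewrite (mem_add_line U0) -/(end_sum e).
  have xU0 : vec x 0 \in U0 by rewrite vec_no_delta xC eqxx.
  by rewrite (rpredDr _ xU0) orbb => ->.
(* [None] has the zero vector, so the dependency says nothing about its coordinate; but each edge
   contributes 1 + 1 = 0 to the sum of all vertex coordinates. *)
have n_None : n (Some (inl None)) = 0.
  have : \sum_v n (Some v) = 0.
    under eq_bigr do rewrite nE.
    rewrite exchange_big big1 //= => e _; rewrite big_split /=.
    have one (v0 : vertices) : \sum_v (v == v0)%:R = 1 :> 'F_2.
      by rewrite (bigD1 v0) //= eqxx big1 ?addr0 // => v /negPf->.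
    by rewrite !one addF2.
  rewrite (bigD1 (inl None)) //= big1 ?addr0 // => -[[j|]|p] //= _.
apply/ffunP => b; rewrite [RHS]ffunE -/n.
by case: b => [[[j|]|p]|].
Qed.

End EvenCycleRepresentation.
End ConformingMatroid.

(** * The theorem *)

Lemma dual_dual_rk (E : finType) (M : matroid E) (S : {set E}) :
  rk (dual (dual M)) S = rk M S.
Proof.
rewrite /= /dual_rk /= /dual_rk setCK setCT rk_set0 addn0 cardsT.
have := cardsC S; have := rk_mono M (subsetT S); have := rk_card M setT.
have := dual_rk_ge M (~: S); rewrite setCK cardsT; lia.
Qed.

(** * Dual templates and cographic matroids *)

Section CographicMember.
Local Open Scope ring_scope.
Variable Psi : template.
Local Notation N := (test_matroid (@no_delta Psi 'I_7)).

(** The frame columns on seven rows with zero Lambda part include every column of the incidence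
    matrix of $K_7$. *)
Lemma test_matroid_L19_graph : has_minor N (cycle_matroid L19_graph).
Proof.
pose G := incidence L19_graph.
have [inj_G G0] := L19_cycle_simple.
pose ends (e : L19_edge) : {set 'I_7} := [set (val e).1; (val e).2].
have ltP (e : L19_edge) : (val e).1 != (val e).2.
  by apply: contraTneq (valP e) => ->; rewrite ltnn.
pose z : {ffun tX Psi -> 'F_2} := 0.
have endsP e : (#|(ends e, z).1| <= 2)%N && ((ends e, z).2 \in tLambda Psi).
  by rewrite /= cards2 ltP template0.
pose q e : frame_column Psi 'I_7 := Sub (ends e, z) (endsP e).
pose g e : minor_ground (C_cols Psi (test_column Psi 'I_7)) (Y1_cols Psi (test_column Psi 'I_7)) :=
  exist _ (inr (inr (q e))) (test_element (inr (q e))).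
have gE e : test_family (@no_delta Psi 'I_7) (g e) = vec 0 (column G e).
  apply/ffunP => -[x|p]; rewrite !ffunE /=; first by rewrite ffunE.
  rewrite !inE /G /incidence /L19_graph /=; case: (eqVneq p (val e).1) => [->|_].
    by rewrite (negPf (ltP e)) addr0.
  by rewrite add0r.
have inj_g : injective g.
  move=> e f ef; apply: inj_G; have := gE e; rewrite ef gE => /ffunP h.
  by apply/ffunP => p; have := h (inr p); rewrite !ffunE.
have rG : rep (cycle_matroid L19_graph) (column G) 0%VS := rep_vector G.
have rgG : rep (cycle_matroid L19_graph) (test_family (@no_delta Psi 'I_7) \o g)
    (test_base (@no_delta Psi 'I_7)).
  apply: rep_sums rG => S; rewrite memv0.
  under [in RHS]eq_bigr do rewrite /= gE.
  by rewrite sum_vec vec_no_delta [\sum_(e in S) 0]big1 // mem0v.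
apply/has_minorP; exists g, set0; split=> // [e|S]; first by rewrite inE.
have := rgG S; have := test_rep (@no_delta Psi 'I_7) (g @: S).
rewrite setU0 rk_set0 sp_comp -rgG addn0 => /eqP.
by rewrite eqn_add2r => /eqP.
Qed.

Lemma dual_conforms_L19 : exists (E : finType) (M : matroid E),
  conforms Psi (dual M) /\ has_minor M L19.
Proof.
exists _, (dual N); split; last exact: has_minor_dual test_matroid_L19_graph.
exists 'I_7, (test_column Psi 'I_7), (test_matrix (@no_delta Psi 'I_7)); split.
  exact: test_matrix_conforms (@no_delta_in Psi 'I_7).
by apply: rk_matroid_iso => S; apply: dual_dual_rk.
Qed.

End CographicMember.

Lemma kconnected_le (E : finType) (M : matroid E) k k' :
  k <= k' -> kconnected M k' -> kconnected M k.
Proof.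
by move=> kk' h j S /andP[j0 jk]; apply: h; rewrite j0 (leq_trans jk).
Qed.

Lemma conforms_even_cycle (Phi : template) (E : finType) (M : matroid E) k :
  (forall (E : finType) (M : matroid E), conforms Phi M ->
     forall e : PG_ground 4, ~ has_minor M (PG32_del e)) ->
  (forall (E : finType) (M : matroid E), conforms Phi M -> ~ has_minor M L11) ->
  conforms Phi M -> kconnected M k -> #|tY0 Phi| < k -> 2 * k <= #|E| ->
  even_cycle M.
Proof.
move=> noPG noL11 [P [Q [A [[A' [Z [resp hy hq hZ]]] isoM]]]] kM Y0k Ek.
have [x [O form]] := frame_form_exists noPG noL11.
have rN := rep_minor_emb (rep_vector A) (minor_emb_val _ (C_cols Phi Q) (Y1_cols Phi Q)).
have [f bij_f rM] := rep_iso rN isoM.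
apply: (conforming_even_cycle resp hy hq hZ (delta_vanish noPG) form
  (g := fun e => val (f e)) _ _ rM kM Y0k Ek).
  by move=> e; apply: (valP (f e)).
exact: inj_comp val_inj (bij_inj bij_f).
Qed.

Definition excludes_three (E : finType) (M : matroid E) : Prop :=
  [/\ binary M, forall e : PG_ground 4, ~ has_minor M (PG32_del e),
      ~ has_minor M L19 & ~ has_minor M L11].

Lemma excludes_three_minor_closed : minor_closed excludes_three.
Proof.
move=> E F M N [binM noPG no19 no11] MN; split.
- exact: binary_minor MN.
- by move=> e /(has_minor_trans MN)/noPG.
- by move=> /(has_minor_trans MN)/no19.
- by move=> /(has_minor_trans MN)/no11.
Qed.

Lemma matroid_iso_refl (E : finType) (M : matroid E) : matroid_iso M M.
Proof. exact: rk_matroid_iso. Qed.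

Lemma excludes_three_proper : proper_binary_class excludes_three.
Proof.
split=> [E M []//|]; exists _, L11; split.
  by eexists _, _, _; apply: matroid_iso_refl.
by case=> _ _ _; apply; apply/iso_has_minor/matroid_iso_refl.
Qed.

Lemma even_cycle_excludes (E : finType) (M : matroid E) : even_cycle M ->
  (forall e : PG_ground 4, ~ has_minor M (PG32_del e)) /\
  ~ has_minor M L19 /\ ~ has_minor M L11.
Proof.
move=> ecM; split=> [e|]; last split; move=> /(even_cycle_minor ecM).
- exact: PG32_del_not_even_cycle.
- exact: L19_not_even_cycle.
- exact: L11_not_even_cycle.
Qed.

Theorem theorem1p1 :
  template_hypothesis ->
  exists k : nat, 0 < k /\
    forall (E : finType) (M : matroid E),
      binary M -> kconnected M k -> 2 * k <= #|E| ->
      ((forall e : PG_ground 4, ~ has_minor M (PG32_del e)) /\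
       ~ has_minor M L19 /\
       ~ has_minor M L11
       <-> even_cycle M).
Proof.
move=> /(_ _ excludes_three_minor_closed excludes_three_proper).
move=> [k [s [t [Phi [Psi [k0 inPhi inPsi cover]]]]]].
(* The sum, with the successor, puts $|Y_0|$ of each [Phi i] strictly below the connectivity. *)
pose k' := (k + \sum_i #|tY0 (Phi i)|).+1.
exists k'; split=> // E M binM kM Ek; split; last exact: even_cycle_excludes.
move=> [noPG [no19 no11]].
have [|||[i cM]|[j _]] := cover E M.
- by split.
- by apply: kconnected_le kM; rewrite /k'; lia.
- by move: Ek; rewrite /k'; lia.
- apply: (conforms_even_cycle _ _ cM kM _ Ek) => [F N|F N|].
  + by case/inPhi.
  + by case/inPhi.
  + by rewrite /k' ltnS (bigD1 i) //= addnCA leq_addr.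
have [F [N [cN NL19]]] := dual_conforms_L19 (Psi j).
by case: (inPsi j F N cN).
Qed.
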